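(* Let $m\geq 5$ and $n\geq 4$, and suppose that $G\cong K_m$ and $H\cong K_n$ are disjointly embedded, weakly linked graphs in $\mathbb{R}^3$. Then exactly one of the following holds: (1) There is a vertex $p$ of $G$ common to all triangles of $G$ linking $H$. (2) There is a triangle $T^*$ in $G$ such that a triangle $T\neq T^*$ of $G$ links $H$ if and only if $T$ shares an edge with $T^*$.
   Context: An embedded graph is identified with its image in $\mathbb{R}^3$; a cycle in it is a simple closed curve formed by its edges, and a triangle is a cycle of length $3$. $\operatorname{Lk}(C,D)$ denotes the linking number of disjoint oriented simple closed curves $C,D$ in $\mathbb{R}^3$. Disjoint simple closed curves $C,D$ are linked (one links the other) if $\operatorname{Lk}(C,D)\neq 0$, and strongly linked if $|\operatorname{Lk}(C,D)|\geq 2$ (these do not depend on orientations). Disjointly embedded graphs $G,H$ are weakly linked if some cycle in $G$ links a cycle in $H$, but no cycle in $G$ strongly links any cycle in $H$. A cycle of $G$ links $H$ if it links some cycle of $H$. *)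

(* Defs.v *)
From HB Require Import structures.
From mathcomp Require Import all_boot all_order all_algebra.
From mathcomp Require Import all_classical all_reals all_analysis.

Set Implicit Arguments.
Unset Strict Implicit.
Unset Printing Implicit Defensive.

Import Order.TTheory GRing.Theory Num.Theory.
Import numFieldNormedType.Exports.

Local Open Scope classical_set_scope.
Local Open Scope ring_scope.

Record sgraph := SGraph {
  vertex :> finType;
  adj : rel vertex;
  adj_sym : symmetric adj;
  adj_irrefl : irreflexive adj
}.

Definition graph_iso (X Y : sgraph) : Prop :=
  exists2 f : X -> Y, bijective f & forall x y, adj (f x) (f y) = adj x y.

Definition complete_graph (n : nat) : sgraph :=
  @SGraph 'I_n (fun i j => i != j)
    (fun i j => congr1 negb (eq_sym i j)) (fun i => congr1 negb (eqxx i)).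

(* A cycle is listed in cyclic order, without repeating the first vertex; the
   list also orients the cycle and gives it a base point. *)
Definition is_cycle (X : sgraph) (c : seq X) : bool :=
  [&& 2 < size c, uniq c & cycle (@adj X) c]%N.

Definition is_triangle (X : sgraph) (c : seq X) : bool :=
  is_cycle c && (size c == 3).

(* As a subgraph, a cycle is determined by its edge set. *)
Definition cycle_edges (X : sgraph) (c : seq X) : {set {set X}} :=
  [set [set x; next c x]%SET | x in c]%SET.

Definition share_edge (X : sgraph) (c c' : seq X) : Prop :=
  exists e : {set X}, e \in cycle_edges c /\ e \in cycle_edges c'.

Section Space.
Variable R : realType.

Local Notation space := 'rV[R]_3.

Definition dot (u v : space) : R := \sum_i u 0 i * v 0 i.

Definition unit_dir (u : space) : space := (Num.sqrt (dot u u))^-1 *: u.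

Definition triple (a b c : space) : R :=
  \det (\matrix_(i < 3) tnth [tuple a; b; c] i).

(* The argument of x + i y in ]-pi, pi[, for (x, y) off the half-line
   y = 0, x <= 0. *)
Definition arg (x y : R) : R := 2 * atan (y / (Num.sqrt (x ^+ 2 + y ^+ 2) + x)).

(* Signed area of the geodesic triangle with vertices a, b, c on the unit
   sphere (no two of them antipodal), by the Euler-Lagrange formula
   tan (area / 2) = triple a b c / (1 + a.b + b.c + c.a). *)
Definition spherical_area (a b c : space) : R :=
  2 * arg (1 + dot a b + dot b c + dot c a) (triple a b c).

(* Degree of a continuous map F from the torus (the square [0, 1] x [0, 1] with
   opposite sides identified) to the unit sphere: F is replaced by the geodesic
   map with the same values at the vertices of a triangulated N.+1 x N.+1 grid,
   and the signed area swept is divided by the area of the sphere.  This is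
   the degree as soon as the mesh is fine enough. *)
Definition grid_degree (F : R -> R -> space) (N : nat) : R :=
  let P (i j : nat) := F (i%:R / N.+1%:R) (j%:R / N.+1%:R) in
  (4 * pi)^-1 * \sum_(i < N.+1) \sum_(j < N.+1)
    (spherical_area (P i j) (P i.+1 j) (P i.+1 j.+1) +
     spherical_area (P i j) (P i.+1 j.+1) (P i j.+1)).

Definition torus_degree (F : R -> R -> space) : R :=
  limn (grid_degree F).

(* The linking number of disjoint closed curves, parametrized by [0, 1], as the
   degree of their Gauss map; for C^1 curves it is Gauss's integral
   (4 pi)^-1 \int \int det (C', D', C - D) / |C - D|^3. *)
Definition Lk (C D : R -> space) : R :=
  torus_degree (fun s t => unit_dir (D t - C s)).

Definition linked (C D : R -> space) : Prop := Lk C D != 0.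

Definition strongly_linked (C D : R -> space) : Prop := 2 <= `|Lk C D|.

(* A topological embedding of a finite simple graph in space.  The edge between
   x and y comes with its two parametrizations, epath x y from x to y and
   epath y x from y to x. *)
Record spatial_graph := SpatialGraph {
  graph :> sgraph;
  vpos : graph -> space;
  epath : graph -> graph -> R -> space;
  vpos_inj : injective vpos;
  epath_continuous : forall x y, adj x y -> {within `[0, 1], continuous (epath x y)};
  epath_inj : forall x y, adj x y -> {in `[0, 1] &, injective (epath x y)};
  epath0 : forall x y, adj x y -> epath x y 0 = vpos x;
  epath1 : forall x y, adj x y -> epath x y 1 = vpos y;
  epath_rev : forall x y, adj x y ->
    {in `[0, 1], forall t, epath y x t = epath x y (1 - t)};
  epath_vpos : forall x y z, adj x y ->
    {in `[0, 1], forall t, epath x y t = vpos z -> z \in [set x; y]%SET};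
  epath_meet : forall x y x' y', adj x y -> adj x' y' ->
    [set x; y]%SET != [set x'; y']%SET ->
    {in `[0, 1] &, forall s t, epath x y s = epath x' y' t ->
      exists z, [/\ z \in [set x; y]%SET, z \in [set x'; y']%SET
                  & epath x y s = vpos z]}
}.

Definition image_of (G : spatial_graph) : set space :=
  [set p | (exists x : G, p = vpos x) \/
    exists x y : G, adj x y /\ exists2 t : R, t \in `[0, 1] & p = epath x y t].

Definition disjointly_embedded (G H : spatial_graph) : Prop :=
  image_of G `&` image_of H = set0.

(* The closed curve, parametrized by [0, 1], that runs along the k edges of the
   cycle c, each during a time 1 / k. *)
Definition cycle_curve (G : spatial_graph) (c : seq G) (t : R) : space :=
  if c is x0 :: _ then
    let i := Num.truncn ((size c)%:R * t) in
    let x := nth x0 c i in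
    epath x (next c x) ((size c)%:R * t - i%:R)
  else 0.

Definition weakly_linked (G H : spatial_graph) : Prop :=
  (exists (C : seq G) (D : seq H),
     [/\ is_cycle C, is_cycle D & linked (cycle_curve C) (cycle_curve D)]) /\
  (forall (C : seq G) (D : seq H), is_cycle C -> is_cycle D ->
     ~ strongly_linked (cycle_curve C) (cycle_curve D)).

Definition links_graph (G H : spatial_graph) (C : seq G) : Prop :=
  exists2 D : seq H, is_cycle D & linked (cycle_curve C) (cycle_curve D).

Definition common_vertex (G H : spatial_graph) : Prop :=
  exists p : G, forall T : seq G,
    is_triangle T -> links_graph H T -> p \in T.

Definition special_triangle (G H : spatial_graph) : Prop :=
  exists2 T0 : seq G, is_triangle T0 &
    forall T : seq G, is_triangle T -> cycle_edges T != cycle_edges T0 ->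
      (links_graph H T <-> share_edge T T0).

End Space.

(* Main.v *)
(* The Gauss map of two closed curves is replaced by its values on a grid.  In
   terms of spinors, half the area of a geodesic triangle is, modulo 2 pi, the
   circulation of a potential along its sides; hence the area swept by a fine
   grid does not change under refinement and is a multiple of 4 pi, and Lk is a
   sum over pairs of edges.  Up to a change of gauge this is a bilinear pairing
   with integer coefficients, bounded by 1 in absolute value on cycles.

   Fixing a cycle of H, the triangles of G that it links are those through some
   vertex p whose other two vertices are separated by some set S.  Any two
   triangles of G linking H link a common cycle of H, so that they are both of
   this form for the same p and S.  For six vertices or more this forces one of
   the two conclusions by the combinatorics of pairwise intersecting triangles.
   For five vertices the linking modulo 2 is a 1-cochain on H with values in the
   6-bit codes of cocycles on five points, all of whose cycle sums are codes of
   stars, and a finite search over these concludes. *)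
Require Import Defs.
From mathcomp Require Import all_boot all_order all_algebra.
From mathcomp Require Import all_classical all_reals all_analysis.
From mathcomp Require Import ring lra zify.

Set Implicit Arguments.
Unset Strict Implicit.
Unset Printing Implicit Defensive.

Import Order.TTheory GRing.Theory Num.Theory.
Import numFieldNormedType.Exports.

Local Open Scope classical_set_scope.
Local Open Scope ring_scope.

(** * Areas of geodesic triangles *)

Section Angles.
Variable R : realType.
Implicit Types x y s t : R.

(** The curves are merely continuous, so neither derivatives nor general position are available, and
    [Lk] has to be reached through inequalities alone. Acuteness takes the place of general
    position: among pairwise acute directions half areas stay below pi / 2, and identities that hold
    modulo 2 pi become equalities. A single pair of edges does not close up to a torus, so its share
    of [Lk] is a real number without integrality; hence the change of gauge before any combinatorics
    over the integers. After that, only the bound on all pairs of cycles is left. Quadrilaterals,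
    pentagons and hexagons constrain the values on triangles, symmetrically in [G] and [H]. The
    symmetry serves to find a cycle of [H] common to two linked triangles of [G], and again for five
    vertices against six or more. Six vertices are the threshold because two disjoint triangles of
    [G] cannot both link [H], and disjoint triangles exist only from six points on. On five points
    any two triangles meet, this argument is void, and finer information on [H] replaces it. *)

Definition eq_mod2pi s t := exists k : int, s - t = 2 * pi * k%:~R.

Lemma eq_mod2pi_refl s : eq_mod2pi s s.
Proof. by exists 0; rewrite subrr mulr0. Qed.

Lemma eq_mod2pi_sym s t : eq_mod2pi s t -> eq_mod2pi t s.
Proof. by case=> k e; exists (- k); rewrite mulrNz mulrN -e opprB. Qed.

Lemma eq_mod2piD s t s' t' :
  eq_mod2pi s t -> eq_mod2pi s' t' -> eq_mod2pi (s + s') (t + t').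
Proof.
move=> [k ek] [l el]; exists (k + l).
by rewrite intrD mulrDr -ek -el opprD addrACA.
Qed.

Lemma eq_mod2pi_trans s t u : eq_mod2pi s t -> eq_mod2pi t u -> eq_mod2pi s u.
Proof.
by move=> [k ek] [l el]; exists (k + l); rewrite intrD mulrDr -ek -el subrKA.
Qed.

Lemma eq_mod2pi_sum (I : Type) (r : seq I) (P : pred I) (f g : I -> R) :
  (forall i, P i -> eq_mod2pi (f i) (g i)) ->
  eq_mod2pi (\sum_(i <- r | P i) f i) (\sum_(i <- r | P i) g i).
Proof.
move=> fg; apply: (big_ind2 eq_mod2pi) => //; first exact: eq_mod2pi_refl.
by move=> *; apply: eq_mod2piD.
Qed.

Lemma eq_mod2pi_lt s t : `|s - t| < 2 * pi -> eq_mod2pi s t -> s = t.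
Proof.
move=> st [k e]; apply/eqP; rewrite -subr_eq0 e.
move: st; rewrite e normrM ger0_norm ?mulr_ge0 ?pi_ge0//.
rewrite -[X in _ < X]mulr1 ltr_pM2l ?mulr_gt0 ?pi_gt0//.
rewrite -intr_norm -[1]/(1%:~R) ltr_int => k1.
have -> : k = 0 by lia.
by rewrite mulr0.
Qed.

(** A relation rather than a function: multiplying complex numbers then adds arguments, with no
    branch to choose. *)
Definition has_arg x y t := exists2 r, 0 < r & x = r * cos t /\ y = r * sin t.

Lemma has_argM x y s x' y' t : has_arg x y s -> has_arg x' y' t ->
  has_arg (x * x' - y * y') (x * y' + y * x') (s + t).
Proof.
move=> [r r0 [-> ->]] [r' r0' [-> ->]]; exists (r * r'); first exact: mulr_gt0.
by rewrite cosD sinD; split; ring.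
Qed.

Lemma has_argJ x y t : has_arg x y t -> has_arg x (- y) (- t).
Proof.
by move=> [r r0 [-> ->]]; exists r => //; rewrite cosN sinN mulrN.
Qed.

Lemma has_arg_scale c x y t : 0 < c -> has_arg (c * x) (c * y) t -> has_arg x y t.
Proof.
move=> c0 [r r0 [ex ey]]; exists (c^-1 * r); first by rewrite mulr_gt0 ?invr_gt0.
by split; rewrite -mulrA -?ex -?ey mulKf ?gt_eqF.
Qed.

Lemma cosD_int t (k : int) : cos (t + k%:~R * (pi *+ 2)) = cos t.
Proof.
have cosn n (u : R) : cos (u + n%:R * (pi *+ 2)) = cos u.
  elim: n => [|n IHn]; first by rewrite mul0r addr0.
  by rewrite -addn1 natrD mulrDl mul1r addrA cosD2pi.
case: k => n; first exact: cosn.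
by rewrite NegzE mulrNz mulNr -[LHS](cosn n.+1) subrK.
Qed.

Lemma cos_eq1_mod2pi t : cos t = 1 -> eq_mod2pi t 0.
Proof.
move=> ct; set k := Num.floor (t / (2 * pi)); exists k; rewrite subr0.
have pi0 : 0 < 2 * pi :> R by rewrite mulr_gt0 ?pi_gt0.
set u := t - 2 * pi * k%:~R.
have u0 : 0 <= u by rewrite subr_ge0 mulrC -ler_pdivlMr// floor_le.
have u1 : u < 2 * pi.
  rewrite ltrBlDr -[X in X + _]mulr1 -mulrDr mulrC -ltr_pdivrMr// addrC.
  by case/andP: (floor_itv (t / (2 * pi))) => _; rewrite intrD addrC.
have cu : cos u = 1.
  rewrite /u -[LHS](_ : cos (t + (- k)%:~R * (pi *+ 2)) = _); last first.
    by congr cos; rewrite mulrNz; ring.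
  by rewrite cosD_int.
have : sin (u / 2) ^+ 2 = 0.
  have := cu; rewrite [u in cos u](_ : _ = (u / 2) *+ 2); last by field.
  by rewrite cos_mulr2n cos2sin2; lra.
move/eqP; rewrite sqrf_eq0 => /eqP su.
have [u2|u2] := ltP 0 u; last by apply/eqP; rewrite -subr_eq0 -/u eq_le u2.
have : 0 < sin (u / 2) by apply: sin_gt0_pi; lra.
by rewrite su ltxx.
Qed.

(** One polar form times the conjugate of the other is a positive real, so that [s - t] has cosine
    1. *)
Lemma has_arg_inj x y s t : has_arg x y s -> has_arg x y t -> eq_mod2pi s t.
Proof.
move=> hs /has_argJ ht; have := has_argM hs ht.
move=> [r r0 [e1 e2]].
have st0 : r * sin (s - t) = 0 by rewrite -e2; ring.
have cst0 : 0 < r * cos (s - t).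
  rewrite -e1; case: hs => q q0 [-> ->].
  rewrite (_ : _ - _ = q ^+ 2 * (cos s ^+ 2 + sin s ^+ 2)); last by ring.
  by rewrite cos2Dsin2 mulr1 exprn_gt0.
have /eqP := cos2Dsin2 (s - t).
move/eqP: st0; rewrite mulf_eq0 gt_eqF//= => /eqP ->.
rewrite expr0n addr0 sqrf_eq1 => /orP[]/eqP c1.
  by have [k] := cos_eq1_mod2pi c1; exists k; rewrite -[s - t]subr0.
by move: cst0; rewrite c1; lra.
Qed.

Lemma has_arg_exists x y : (x != 0) || (y != 0) -> exists t, has_arg x y t.
Proof.
move=> xy; set r := Num.sqrt (x ^+ 2 + y ^+ 2).
have r0 : 0 < r.
  by rewrite sqrtr_gt0 lt_neqAle addr_ge0 ?sqr_ge0// andbT eq_sym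
    paddr_eq0 ?sqr_ge0// !sqrf_eq0 negb_and.
have rr : r ^+ 2 = x ^+ 2 + y ^+ 2 by rewrite sqr_sqrtr// addr_ge0 ?sqr_ge0.
have xr : -1 <= x / r <= 1.
  rewrite ler_pdivlMr// ler_pdivrMr// mulN1r mul1r -ler_norml.
  by rewrite -sqrtr_sqr ler_sqrt ?lerDl ?addr_ge0 ?sqr_ge0.
have sq : sin (acos (x / r)) = `|y| / r.
  rewrite sin_acos// (_ : 1 - _ = (y / r) ^+ 2); last first.
    by rewrite !exprMn exprVn rr; field; rewrite -rr sqrf_eq0 gt_eqF.
  by rewrite sqrtr_sqr normrM normfV (ger0_norm (ltW r0)).
have [y0|y0] := leP 0 y.
  exists (acos (x / r)); exists r => //.
  by rewrite acosK// sq ger0_norm// !(mulrC r) !divfK ?gt_eqF.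
exists (- acos (x / r)); exists r => //.
rewrite cosN sinN acosK// sq ltr0_norm// mulNr opprK.
by rewrite !(mulrC r) !divfK ?gt_eqF.
Qed.

(** The quotient [w = y / (r + x)] is the tangent of half the argument. For [x > 0] it lies strictly
    between -1 and 1, which keeps [atan w] within pi / 4. *)
Lemma arg_spec x y : 0 < x -> has_arg x y (arg x y) /\ `|arg x y| < pi / 2.
Proof.
move=> x0; rewrite /arg; set r := Num.sqrt _.
have rr : r ^+ 2 = x ^+ 2 + y ^+ 2 by rewrite sqr_sqrtr// addr_ge0 ?sqr_ge0.
have yr : `|y| <= r by rewrite -sqrtr_sqr ler_sqrt ?lerDr ?addr_ge0 ?sqr_ge0.
have r0 : 0 < r by rewrite sqrtr_gt0 ltr_pwDl ?sqr_ge0// exprn_gt0.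
have rx : 0 < r + x by rewrite addr_gt0.
set w := y / (r + x).
have w1 : `|w| < 1.
  by rewrite normrM normfV (gtr0_norm rx) ltr_pdivrMr// mul1r; lra.
have w2 : 1 + w ^+ 2 = 2 * r / (r + x).
  rewrite /w exprMn exprVn; have -> : y ^+ 2 = r ^+ 2 - x ^+ 2 by rewrite rr; ring.
  by field; rewrite gt_eqF.
have c2 : cos (atan w) ^+ 2 = (r + x) / (2 * r).
  rewrite cos_atan exprVn sqr_sqrtr ?w2; last by rewrite divr_ge0 ?ltW ?mulr_gt0.
  by rewrite invf_div.
have sc : sin (atan w) = w * cos (atan w).
  have c0 : cos (atan w) != 0.
    by rewrite gt_eqF// cos_gt0_pihalf// atan_gtNpi2 atan_ltpi2.
  by rewrite -[w in w * _]atanK /tan divfK.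
split.
  exists r => //; rewrite (mulr_natl _ 2) cos_mulr2n sin_mulr2n sc mulrCA -expr2 c2.
  by split; rewrite ?mulr_natl /w; field; rewrite ?gt_eqF.
have aw (z : R) : z < 1 -> atan z < pi / 4.
  move=> z1; rewrite -atan1 ltNge; apply/negP => le1.
  have := le1; rewrite le_eqVlt => /orP[/eqP e|lt1].
    by move: z1; rewrite -[z]atanK -e atanK ltxx.
  have : tan (atan 1) < tan (atan z) :> R.
    by rewrite ltr_tan// in_itv/= atan_gtNpi2 atan_ltpi2.
  by rewrite !atanK; lra.
move: w1; rewrite ltr_norml => /andP[w1 w1'].
have := aw _ w1'; have : atan (- w) < pi / 4 by apply: aw; lra.
by rewrite atanN ltr_norml; lra.
Qed.

Lemma argN x y : arg x (- y) = - arg x y.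
Proof. by rewrite /arg sqrrN mulNr atanN mulrN. Qed.

End Angles.

(** * Spinors and signed areas on the sphere *)

Section SphericalTriangles.
Variable R : realType.
Local Notation space := 'rV[R]_3.
Implicit Types a b c d o : space.

Lemma dotE a b :
  dot a b = a 0 0 * b 0 0 + a 0 1 * b 0 1 + a 0 ord_max * b 0 ord_max.
Proof.
rewrite /dot !big_ord_recr big_ord0 /= add0r.
by congr (_ * _ + _ * _ + _); congr (fun_of_matrix _ _ _); apply: val_inj.
Qed.

Lemma tripleE a b c :
  triple a b c =
    a 0 0 * (b 0 1 * c 0 ord_max - b 0 ord_max * c 0 1)
    - a 0 1 * (b 0 0 * c 0 ord_max - b 0 ord_max * c 0 0)
    + a 0 ord_max * (b 0 0 * c 0 1 - b 0 1 * c 0 0).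
Proof.
rewrite /triple (expand_det_row _ ord0) !big_ord_recr big_ord0 /= add0r.
rewrite /cofactor !(expand_det_row _ ord0) !big_ord_recr !big_ord0 /= !add0r.
rewrite /cofactor !det_mx11 !mxE /= !expr0 /tnth /=.
(* Reading the entries through a function of natural numbers identifies ordinals that carry
   different proofs. *)
have [f fE] : exists f : space -> nat -> R, 
    forall (v : space) (i : 'I_3), v 0 i = f v i.
  by exists (fun v k => v 0 (inord k)) => v i; rewrite inord_val.
by rewrite !fE /= /bump /=; ring.
Qed.

Definition unit_vec a := dot a a = 1.

Lemma dotC a b : dot a b = dot b a.
Proof. by rewrite !dotE; ring. Qed.

(* Every unit vector is the Bloch vector of a unit spinor
   (p1 + i p2, q1 + i q2). *)
Lemma spinor_exists a : unit_vec a -> exists p1 p2 q1 q2 : R,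
  [/\ p1 ^+ 2 + p2 ^+ 2 + q1 ^+ 2 + q2 ^+ 2 = 1,
      a 0 0 = 2 * (p1 * q1 + p2 * q2),
      a 0 1 = 2 * (p1 * q2 - p2 * q1) &
      a 0 ord_max = p1 ^+ 2 + p2 ^+ 2 - q1 ^+ 2 - q2 ^+ 2].
Proof.
rewrite /unit_vec dotE; move: (a 0 0) (a 0 1) (a 0 ord_max) => x y z xyz.
have zN1 : 0 <= 1 + z.
  have : z * z <= 1 by rewrite -xyz lerDr addr_ge0// -expr2 sqr_ge0.
  by nra.
(* At the south pole the first component of the spinor vanishes; elsewhere it can be taken real and
   positive, which determines the second one. *)
have [z1|z1] := eqVneq (1 + z) 0.
  have x0 : x = 0 by nra.
  have y0 : y = 0 by nra.
  by exists 0, 0, 1, 0; rewrite x0 y0; split; lra.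
pose p := Num.sqrt ((1 + z) / 2).
have pp : p ^+ 2 = (1 + z) / 2 by rewrite sqr_sqrtr// divr_ge0.
have p0 : p != 0 by rewrite -sqrf_eq0 pp mulf_neq0// invr_neq0.
exists p, 0, (x / (2 * p)), (y / (2 * p)).
have qq : (x / (2 * p)) ^+ 2 + (y / (2 * p)) ^+ 2 = (1 - z) / 2.
  rewrite !exprMn !exprVn exprMn pp -mulrDl.
  have -> : x ^+ 2 + y ^+ 2 = (1 - z) * (1 + z) by nra.
  by field; rewrite z1.
split.
- by rewrite -addrA qq pp; field.
- by field.
- by field.
- by rewrite -addrA -opprD qq pp; field.
Qed.

Definition area_re a b c := 1 + dot a b + dot b c + dot c a.

Lemma spherical_areaE a b c :
  spherical_area a b c = 2 * arg (area_re a b c) (triple a b c).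
Proof. by []. Qed.

(* For spinors psi_a representing the points a, the complex number
   area_re a b c + i triple a b c is four times the product of hermitian
   products <psi_a, psi_b> <psi_b, psi_c> <psi_c, psi_a>, so that the half area
   is, modulo 2 pi, a coboundary. *)
Lemma spherical_area_potential : exists om : space -> space -> R,
  [/\ forall a b, unit_vec a -> unit_vec b -> 0 < dot a b ->
       eq_mod2pi (om b a) (- om a b) &
     forall a b c, unit_vec a -> unit_vec b -> unit_vec c ->
       0 < dot a b -> 0 < dot b c -> 0 < dot c a ->
       eq_mod2pi (arg (area_re a b c) (triple a b c))
         (om a b + om b c + om c a)].
Proof.
have /choice[s sP] (a : space) : exists s : R * R * R * R, unit_vec a ->
    let: (p1, p2, q1, q2) := s in
    [/\ p1 ^+ 2 + p2 ^+ 2 + q1 ^+ 2 + q2 ^+ 2 = 1,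
      a 0 0 = 2 * (p1 * q1 + p2 * q2),
      a 0 1 = 2 * (p1 * q2 - p2 * q1) &
      a 0 ord_max = p1 ^+ 2 + p2 ^+ 2 - q1 ^+ 2 - q2 ^+ 2].
  have [/spinor_exists[p1 [p2 [q1 [q2 h]]]]|ua] := pselect (unit_vec a).
    by exists (p1, p2, q1, q2).
  by exists (0, 0, 0, 0).
(* Real and imaginary parts of the hermitian product of the two spinors; exchanging the points
   conjugates it. *)
pose wre a b := let: (p1, p2, q1, q2) := s a in let: (r1, r2, t1, t2) := s b in
  p1 * r1 + p2 * r2 + q1 * t1 + q2 * t2.
pose wim a b := let: (p1, p2, q1, q2) := s a in let: (r1, r2, t1, t2) := s b in
  p1 * r2 - p2 * r1 + q1 * t2 - q2 * t1.
have wJ a b : wre b a = wre a b /\ wim b a = - wim a b.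
  rewrite /wre /wim; case: (s a) => [[[? ?] ?] ?]; case: (s b) => [[[? ?] ?] ?].
  by split; ring.
have wN a b : unit_vec a -> unit_vec b -> 0 < dot a b ->
    (wre a b != 0) || (wim a b != 0).
  move=> /sP + /sP; rewrite dotE /wre /wim.
  case: (s a) => [[[p1 p2] q1] q2] [n1 -> -> ->].
  case: (s b) => [[[r1 r2] t1] t2] [n2 -> -> ->] ab.
  rewrite -negb_and; apply/negP => /andP[/eqP w1 /eqP w2].
  have : (p1 * r1 + p2 * r2 + q1 * t1 + q2 * t2) ^+ 2 +
    (p1 * r2 - p2 * r1 + q1 * t2 - q2 * t1) ^+ 2 > 0; last first.
    by rewrite w1 w2 expr0n addr0 ltxx.
  (* Twice the squared modulus of the hermitian product is [1 + dot a b]. *)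
  rewrite -(@pmulr_rgt0 _ 2)//; apply: (lt_trans ab).
  rewrite -subr_gt0 [ltRHS](_ : _ =
    (p1 ^+ 2 + p2 ^+ 2 + q1 ^+ 2 + q2 ^+ 2) *
    (r1 ^+ 2 + r2 ^+ 2 + t1 ^+ 2 + t2 ^+ 2)); last by ring.
  by rewrite n1 n2 mulr1.
have /choice[om omP] (ab : space * space) : exists t : R,
    unit_vec ab.1 -> unit_vec ab.2 -> 0 < dot ab.1 ab.2 ->
    has_arg (wre ab.1 ab.2) (wim ab.1 ab.2) t.
  have [[ua ub ab0]|h] := pselect
      [/\ unit_vec ab.1, unit_vec ab.2 & 0 < dot ab.1 ab.2].
    by have [t ht] := has_arg_exists (wN _ _ ua ub ab0); exists t.
  by exists 0 => ? ? ?; exfalso; apply: h.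
exists (fun a b => om (a, b)); split.
  move=> a b ua ub ab.
  have h1 := omP (a, b) ua ub ab.
  have h2 := omP (b, a) ub ua; rewrite /= dotC in h2; have {}h2 := h2 ab.
  have [e1 e2] := wJ a b; rewrite e1 e2 in h2.
  by apply: (has_arg_inj h2); exact: has_argJ.
move=> a b c ua ub uc ab bc ca.
have zre0 : 0 < area_re a b c by rewrite !addr_gt0.
apply: (has_arg_inj (arg_spec _ zre0).1).
have h := has_argM (has_argM (omP (a, b) ua ub ab) (omP (b, c) ub uc bc))
  (omP (c, a) uc ua ca).
apply: (@has_arg_scale _ 4^-1); first by rewrite invr_gt0.
move: h => /=; congr (has_arg _ _ _).
  move: ua ub uc => /sP + /sP + /sP; rewrite /area_re !dotE /wre /wim.
  case: (s a) => [[[p1 p2] q1] q2] [n1 -> -> ->].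
  case: (s b) => [[[r1 r2] t1] t2] [n2 -> -> ->].
  case: (s c) => [[[v1 v2] w1] w2] [n3 -> -> ->].
  (* The squared norms, all equal to 1, make both sides homogeneous in each spinor; the claim
     becomes a polynomial identity. *)
  set n := (n in n = 1) in n1; set n' := (n in n = 1) in n2.
  set n'' := (n in n = 1) in n3.
  have -> X Y Z : 1 + X + Y + Z = n * n' * n'' + X * n'' + Y * n + Z * n'.
    by rewrite n1 n2 n3 !mulr1.
  by rewrite /n /n' /n''; field.
move: ua ub uc => /sP + /sP + /sP; rewrite tripleE /wre /wim.
case: (s a) => [[[p1 p2] q1] q2] [_ -> -> ->].
case: (s b) => [[[r1 r2] t1] t2] [_ -> -> ->].
case: (s c) => [[[v1 v2] w1] w2] [_ -> -> ->].
by field.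
Qed.

Lemma spherical_area_swap a b c : spherical_area a c b = - spherical_area a b c.
Proof.
rewrite !spherical_areaE -mulrN -argN; congr (2 * arg _ _).
  by rewrite /area_re (dotC a c) (dotC c b) (dotC b a); ring.
by rewrite !tripleE; ring.
Qed.

Lemma spherical_area_xx o a : spherical_area o a a = 0.
Proof. by apply/eqP; rewrite -eqNr -spherical_area_swap. Qed.

(* Any two points of an acute set are at an angle less than pi / 2, which makes
   the half areas small enough to be determined modulo 2 pi. *)
Definition acute (P : set space) :=
  (forall a, P a -> unit_vec a) /\ (forall a b, P a -> P b -> 0 < dot a b).

(** Modulo 2 pi the potentials along the sides through [o] cancel; and four half areas, each below
    pi / 2 in absolute value, cannot add up to a nonzero multiple of 2 pi. *)
Lemma spherical_area_cocycle P o a b c : acute P -> P o -> P a -> P b -> P c ->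
  spherical_area a b c =
    spherical_area o a b + spherical_area o b c + spherical_area o c a.
Proof.
move=> [uP dP] Po Pa Pb Pc; rewrite !spherical_areaE -2!mulrDr; congr (2 * _).
have [om [omN omP]] := spherical_area_potential.
have small x y z : P x -> P y -> P z ->
    `|arg (area_re x y z) (triple x y z)| < pi / 2.
  move=> Px Py Pz; apply: (arg_spec _ _).2.
  by rewrite /area_re !addr_gt0 ?dP.
have half x y z (Px : P x) (Py : P y) (Pz : P z) := omP _ _ _
  (uP _ Px) (uP _ Py) (uP _ Pz) (dP _ _ Px Py) (dP _ _ Py Pz) (dP _ _ Pz Px).
have anti x y (Px : P x) (Py : P y) := omN _ _ (uP _ Px) (uP _ Py) (dP _ _ Px Py).
apply: eq_mod2pi_lt.
  have := small _ _ _ Pa Pb Pc; have := small _ _ _ Po Pa Pb.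
  have := small _ _ _ Po Pb Pc; have := small _ _ _ Po Pc Pa.
  rewrite !ltr_norml => /andP[? ?] /andP[? ?] /andP[? ?] /andP[? ?].
  by apply/andP; split; lra.
apply: (eq_mod2pi_trans (half _ _ _ Pa Pb Pc)); apply: eq_mod2pi_sym.
apply: (eq_mod2pi_trans (eq_mod2piD (eq_mod2piD (half _ _ _ Po Pa Pb)
  (half _ _ _ Po Pb Pc)) (half _ _ _ Po Pc Pa))).
have e := eq_mod2piD (eq_mod2piD (anti _ _ Po Pa) (anti _ _ Po Pb)) (anti _ _ Po Pc).
have := eq_mod2piD e (eq_mod2pi_refl (om o a + om o b + om o c
  + om a b + om b c + om c a)).
by case=> k ek; exists k; rewrite -ek; ring.
Qed.

Definition quad_area a b c d := spherical_area a b c + spherical_area a c d.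

(** Coning from a point of the patch eliminates the diagonal: only the boundary of the quadrilateral
    remains. *)
Lemma quad_areaE P o a b c d : acute P -> P o -> P a -> P b -> P c -> P d ->
  quad_area a b c d = spherical_area o a b + spherical_area o b c
    + spherical_area o c d + spherical_area o d a.
Proof.
move=> aP Po Pa Pb Pc Pd; rewrite /quad_area.
rewrite (spherical_area_cocycle aP Po Pa Pb Pc).
rewrite (spherical_area_cocycle aP Po Pa Pc Pd).
by rewrite (spherical_area_swap o a c); ring.
Qed.

(** The reversed quadrilaterals are cut along the other diagonal, so this is not a mere change of
    signs; it needs the independence of the diagonal. *)
Lemma quad_area_flip P a b c d : acute P -> P a -> P b -> P c -> P d ->
  quad_area b a d c = - quad_area a b c d /\
  quad_area d c b a = - quad_area a b c d.
Proof.
move=> aP Pa Pb Pc Pd; rewrite !(quad_areaE aP Pa)//.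
rewrite (spherical_area_swap a a b) (spherical_area_swap a a d).
rewrite (spherical_area_swap a b c) (spherical_area_swap a c d).
by split; ring.
Qed.

End SphericalTriangles.

(** * Grids on the sphere *)

Section Grids.
Variable R : realType.
Local Notation space := 'rV[R]_3.
Implicit Types (Q : nat -> nat -> space) (q : nat -> space).

Lemma sum_nat_mul (V : nmodType) (F : nat -> V) a c :
  \sum_(i < a * c) F i = \sum_(I < a) \sum_(i < c) F (I * c + i)%N.
Proof.
elim: a => [|a IHa]; first by rewrite mul0n !big_ord0.
rewrite big_ord_recr /= -IHa mulSnr -!(big_mkord xpredT) (big_cat_nat _ (n := (a * c)%N))//=.
  by congr (_ + _); rewrite -[X in \sum_(X <= _ < _) _]add0n big_addn addKn
    big_mkord; apply: eq_bigr => i _; rewrite addnC.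
by rewrite leq_addr.
Qed.

Lemma discrete_stokes (f g : nat -> nat -> R) a b :
  \sum_(i < a) \sum_(j < b) (f i j + g i.+1 j - f i j.+1 - g i j) =
  \sum_(i < a) (f i 0%N - f i b) + \sum_(j < b) (g a j - g 0%N j).
Proof.
have -> : \sum_(j < b) (g a j - g 0%N j) =
    \sum_(i < a) \sum_(j < b) (g i.+1 j - g i j).
  rewrite exchange_big; apply: eq_bigr => j _.
  by rewrite -(big_mkord xpredT (fun i => g i.+1 j - g i j)) telescope_sumr.
rewrite -big_split; apply: eq_bigr => i _ /=.
have -> : f i 0%N - f i b = \sum_(j < b) (f i j - f i j.+1).
  rewrite -opprB -(telescope_sumr (f i))// -sumrN big_mkord.
  by apply: eq_bigr => j _; rewrite opprB.
by rewrite -big_split; apply: eq_bigr => j _ /=; ring.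
Qed.

Definition cell_area Q i j :=
  quad_area (Q i j) (Q i.+1 j) (Q i.+1 j.+1) (Q i j.+1).

(** The sliver between the polygonal line [q 0], ..., [q n] and its chord. *)
Definition fan_area q n := \sum_(i < n) spherical_area (q 0%N) (q i) (q i.+1).

Lemma eq_fan_area q q' n :
  (forall i, (i <= n)%N -> q i = q' i) -> fan_area q n = fan_area q' n.
Proof. by move=> e; apply: eq_bigr => i _; rewrite !e// ltnW. Qed.

Lemma fan_areaE P o q n : acute P -> P o -> (forall i, (i <= n)%N -> P (q i)) ->
  \sum_(i < n) spherical_area o (q i) (q i.+1) =
    spherical_area o (q 0%N) (q n) + fan_area q n.
Proof.
move=> aP Po; elim: n => [|n IHn] Pq.
  by rewrite /fan_area !big_ord0 spherical_area_xx addr0.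
rewrite big_ord_recr /= IHn => [|i /leqW/Pq//].
rewrite /fan_area big_ord_recr /=.
rewrite (@spherical_area_cocycle _ _ o (q 0%N) (q n) (q n.+1) aP)//; try exact: Pq.
by rewrite (spherical_area_swap o (q 0%N) (q n.+1)); ring.
Qed.

(* Inside an acute patch, refining a cell changes the area swept only by the
   slivers between the sides of the cell and their subdivisions. *)
Lemma patch_area P Q c d : acute P ->
    (forall i j, (i <= c)%N -> (j <= d)%N -> P (Q i j)) ->
  \sum_(i < c) \sum_(j < d) cell_area Q i j =
    quad_area (Q 0 0)%N (Q c 0)%N (Q c d) (Q 0 d)%N
    + (fan_area (Q^~ 0%N) c + fan_area (Q c) d
       - fan_area (Q^~ d) c - fan_area (Q 0%N) d).
Proof.
move=> aP PQ; set o := Q 0%N 0%N; have Po : P o by exact: PQ.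
pose f i j := spherical_area o (Q i j) (Q i.+1 j).
pose g i j := spherical_area o (Q i j) (Q i j.+1).
rewrite (eq_bigr (fun i : 'I_c => \sum_(j < d)
    (f i j + g i.+1 j - f i j.+1 - g i j))); last first.
  move=> i _; apply: eq_bigr => j _.
  have [ic jd] := (ltn_ord i, ltn_ord j).
  rewrite /cell_area (quad_areaE aP Po); do ?by apply: PQ; rewrite // ltnW.
  rewrite /f /g (spherical_area_swap o (Q i j.+1) (Q i.+1 j.+1)).
  by rewrite (spherical_area_swap o (Q i j) (Q i j.+1)); ring.
rewrite /= (discrete_stokes f g) !sumrB.
rewrite (fan_areaE (q := Q^~ 0%N) aP Po) => [|i ic]; last exact: PQ.
rewrite (fan_areaE (q := Q^~ d) aP Po) => [|i ic]; last exact: PQ.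
rewrite (fan_areaE (q := Q c) aP Po) => [|i ic]; last exact: PQ.
rewrite (fan_areaE (q := Q 0%N) aP Po) => [|i ic]; last exact: PQ.
rewrite (quad_areaE aP Po); do ?exact: PQ.
rewrite -/o (spherical_area_swap o (Q 0 d)%N (Q c d)).
by rewrite (spherical_area_swap o o (Q 0 d)%N); ring.
Qed.

Definition periodic_grid Q a b :=
  (forall i, (i <= a)%N -> Q i b = Q i 0%N) /\
  (forall j, (j <= b)%N -> Q a j = Q 0%N j).

(** The sliver along a side shared by two coarse cells is counted once with each sign, and
    periodicity pairs the slivers at opposite borders in the same way. *)
Lemma torus_refinement Q a b c d :
    periodic_grid Q (a * c) (b * d) ->
    (forall I J, (I < a)%N -> (J < b)%N -> exists2 P, acute P &
       forall i j, (i <= c)%N -> (j <= d)%N -> P (Q (I * c + i) (J * d + j))%N) ->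
  \sum_(i < a * c) \sum_(j < b * d) cell_area Q i j =
  \sum_(I < a) \sum_(J < b) cell_area (fun I J => Q (I * c)%N (J * d)%N) I J.
Proof.
move=> [perb pera] aQ.
pose f I J := fan_area (fun i => Q (I * c + i)%N (J * d)%N) c.
pose g I J := fan_area (fun j => Q (I * c)%N (J * d + j)%N) d.
transitivity (\sum_(I < a) \sum_(J < b)
    (cell_area (fun I J => Q (I * c)%N (J * d)%N) I J +
     (f I J + g I.+1 J - f I J.+1 - g I J))); last first.
  under eq_bigr do rewrite big_split.
  rewrite big_split /= (discrete_stokes f g) [X in _ + X](_ : _ = 0) ?addr0//.
  have le_mul k n I l : (I < k)%N -> (l <= n)%N -> (I * n + l <= k * n)%N.
    move=> Ik ln; rewrite (leq_trans (n := (I.+1 * n)%N)) ?leq_mul2r ?Ik ?orbT//.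
    by rewrite mulSnr leq_add2l.
  rewrite !big1 ?addr0// => i _; apply/eqP; rewrite subr_eq0; apply/eqP.
    by apply: eq_fan_area => k kd; rewrite mul0n pera ?le_mul.
  by apply: eq_fan_area => k kc; rewrite mul0n perb ?le_mul.
rewrite (sum_nat_mul (fun i => \sum_(j < b * d) cell_area Q i j)).
apply: eq_bigr => I _.
under eq_bigr do rewrite (sum_nat_mul (cell_area Q _)).
rewrite exchange_big; apply: eq_bigr => J _ /=.
have [P aP PQ] := aQ I J (ltn_ord I) (ltn_ord J).
have := patch_area (Q := fun i j => Q (I * c + i)%N (J * d + j)%N) aP PQ.
by rewrite /cell_area /f /g !mulSnr !addn0 => <-;
  do 2![apply: eq_bigr => ? _]; rewrite !addnS.
Qed.

(* The half area of a cell is modulo 2 pi the circulation of a potential along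
   its sides, and on a torus the circulations cancel. *)
Lemma torus_area_int Q a b : periodic_grid Q a b ->
    (forall I J, (I < a)%N -> (J < b)%N -> exists2 P, acute P &
       forall i j, (i <= 1)%N -> (j <= 1)%N -> P (Q (I + i) (J + j))%N) ->
  (4 * pi)^-1 * \sum_(i < a) \sum_(j < b) cell_area Q i j \is a Num.int.
Proof.
move=> [perb pera] aQ; have [om [omN omP]] := spherical_area_potential R.
pose f i j := om (Q i j) (Q i.+1 j).
pose g i j := om (Q i j) (Q i j.+1).
have half i j : (i < a)%N -> (j < b)%N -> eq_mod2pi
    (arg (area_re (Q i j) (Q i.+1 j) (Q i.+1 j.+1))
         (triple (Q i j) (Q i.+1 j) (Q i.+1 j.+1))
     + arg (area_re (Q i j) (Q i.+1 j.+1) (Q i j.+1))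
           (triple (Q i j) (Q i.+1 j.+1) (Q i j.+1)))
    (f i j + g i.+1 j - f i j.+1 - g i j).
  move=> ia jb; have [P [uP dP] PQ] := aQ i j ia jb.
  have := PQ 0 0 isT isT; have := PQ 0 1 isT isT.
  have := PQ 1 0 isT isT; have := PQ 1 1 isT isT.
  rewrite !addn0 !addn1 /f /g.
  move: (Q i j) (Q i.+1 j) (Q i.+1 j.+1) (Q i j.+1) => p q r s Pr Pq Ps Pp.
  have tri x y z (Px : P x) (Py : P y) (Pz : P z) := omP _ _ _
    (uP _ Px) (uP _ Py) (uP _ Pz) (dP _ _ Px Py) (dP _ _ Py Pz) (dP _ _ Pz Px).
  have anti x y (Px : P x) (Py : P y) := omN _ _ (uP _ Px) (uP _ Py) (dP _ _ Px Py).
  apply: (eq_mod2pi_trans (eq_mod2piD (tri _ _ _ Pp Pq Pr) (tri _ _ _ Pp Pr Ps))).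
  have := eq_mod2piD (eq_mod2piD (anti _ _ Pp Pr) (anti _ _ Ps Pr)) (anti _ _ Pp Ps).
  by case=> k e; exists k; rewrite -e; ring.
pose S := \sum_(i < a) \sum_(j < b)
    (arg (area_re (Q i j) (Q i.+1 j) (Q i.+1 j.+1))
         (triple (Q i j) (Q i.+1 j) (Q i.+1 j.+1))
     + arg (area_re (Q i j) (Q i.+1 j.+1) (Q i j.+1))
           (triple (Q i j) (Q i.+1 j.+1) (Q i j.+1))).
have -> : \sum_(i < a) \sum_(j < b) cell_area Q i j = 2 * S.
  rewrite mulr_sumr; apply: eq_bigr => i _; rewrite mulr_sumr.
  by apply: eq_bigr => j _; rewrite mulrDr.
have : eq_mod2pi S 0.
  have -> : 0 = \sum_(i < a) \sum_(j < b) (f i j + g i.+1 j - f i j.+1 - g i j).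
    rewrite (discrete_stokes f g) !big1 ?addr0// => i _; apply/eqP; rewrite subr_eq0.
      by rewrite /g !pera// ltnW.
    by rewrite /f !perb// ltnW.
  by apply: eq_mod2pi_sum => i _; apply: eq_mod2pi_sum => j _; exact: half.
case=> k; rewrite subr0 => ->.
rewrite (_ : _ * _ = k%:~R) ?intr_int//.
rewrite (_ : 2 * _ = 4 * pi * k%:~R); last by ring.
by rewrite mulKf// mulf_neq0// gt_eqF ?pi_gt0.
Qed.

End Grids.

(** * Linking numbers of cycles as sums over edges *)

Section UniformContinuity.
Variable R : realType.
Local Notation space := 'rV[R]_3.

Lemma finite_uniform (I : finType) (P : I -> R -> Prop) :
    (forall i d e, 0 < e -> e <= d -> P i d -> P i e) ->
    (forall i, exists2 d, 0 < d & P i d) ->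
  exists2 d, 0 < d & forall i, P i d.
Proof.
move=> mono dP; have /choice[d dP'] i : exists d, 0 < d /\ P i d.
  by have [d d0 Pd] := dP i; exists d.
have d0 i : 0 < d i by case: (dP' i).
have Pd i : P i (d i) by case: (dP' i).
have m0 : 0 < \big[Num.min/1]_i d i by apply: lt_bigmin => // i _; exact: d0.
exists (\big[Num.min/1]_i d i) => // i; apply: mono (Pd i) => //.
exact: bigmin_le.
Qed.

(** Compactness for any property that persists when [d] shrinks; uniform continuity and the positive
    distance between disjoint arcs are both instances. *)
Lemma unit_interval_uniform (P : R -> R -> Prop) :
    (forall d e x, 0 < e -> e <= d -> P d x -> P e x) ->
    (forall x, x \in `[0, 1] -> exists r d, [/\ 0 < r, 0 < d &
       forall y, y \in `[0, 1] -> `|x - y| < r -> P d y]) ->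
  exists2 d, 0 < d & forall x, x \in `[0, 1] -> P d x.
Proof.
move=> mono loc.
have /compact_near_coveringP/near_covering_withinP cov := @segment_compact R 0 1.
have : \forall d \near 0^'+, `[0, 1] `<=` P d.
  apply: cov => x /loc[r [d [r0 d0 h]]]; near=> y e.
  have e0 : 0 < e by near: e; exact: nbhs_right_gt.
  have ed : e <= d by near: e; exact: nbhs_right_le.
  have xy : `|x - y| < r by near: y; apply/nbhs_normP; exists r.
  by move=> y01; apply: mono ed _ => //; exact: h.
move=> h; have [d [d0 Pd]] : exists d : R, 0 < d /\ `[0, 1] `<=` P d.
  have : \forall d \near 0^'+, 0 < d /\ `[0, 1] `<=` P d.
    by near=> d; split; near: d => //; exact: nbhs_right_gt.
  exact: filter_ex.
by exists d => // x; exact: Pd.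
Unshelve. all: by end_near. Qed.

Lemma within_continuous_normP (f : R -> space) : {within `[0, 1], continuous f} ->
  forall x e, x \in `[0, 1] -> 0 < e -> exists2 r, 0 < r &
    forall y, y \in `[0, 1] -> `|x - y| < r -> `|f x - f y| < e.
Proof.
move=> /subspace_continuousP cf x e x01 e0.
have /cvgr_dist_lt/(_ e e0)/nbhs_normP[r r0 h] := cf x x01.
by exists r => // y y01 xy; exact: h.
Qed.

Lemma unit_interval_unif_continuous (f : R -> space) :
  {within `[0, 1], continuous f} ->
  forall e, 0 < e -> exists2 d, 0 < d & forall s t, s \in `[0, 1] ->
    t \in `[0, 1] -> `|s - t| <= d -> `|f s - f t| <= e.
Proof.
move=> cf e e0.
have [] := @unit_interval_uniform (fun d s => forall t, t \in `[0, 1] ->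
  `|s - t| <= d -> `|f s - f t| <= e).
- by move=> d d' s _ d'd h t t01 st; apply: h => //; exact: le_trans d'd.
- move=> x x01; have [|r r0 h] := within_continuous_normP cf x01 (e := e / 2).
    by rewrite divr_gt0.
  exists (r / 2), (r / 4); split; rewrite ?divr_gt0// => s s01 xs t t01 st.
  rewrite -(subrKA (f x)) (le_trans (ler_normD _ _))//.
  rewrite (splitr e) lerD// ?(distrC _ (f x)) ltW// h//; first by lra.
  by have := ler_distD s x t; lra.
- by move=> d d0 h; exists d => // s t s01; exact: h.
Qed.

Lemma disjoint_curves_dist (f g : R -> space) :
    {within `[0, 1], continuous f} -> {within `[0, 1], continuous g} ->
    (forall s t, s \in `[0, 1] -> t \in `[0, 1] -> f s != g t) ->
  exists2 d, 0 < d &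
    forall s t, s \in `[0, 1] -> t \in `[0, 1] -> d <= `|g t - f s|.
Proof.
move=> cf cg fg.
have [] := @unit_interval_uniform (fun d s => forall t, t \in `[0, 1] ->
  d <= `|g t - f s|).
- by move=> d d' s _ d'd h t t01; exact: le_trans (h t t01).
(* The same principle is applied to [t] with [x] fixed; half of the bound found survives a small
   move of [x]. *)
- move=> x x01.
  have [] := @unit_interval_uniform (fun d t => d <= `|g t - f x|).
  + by move=> d d' t _; exact: le_trans.
  + move=> t t01; have gf0 : 0 < `|g t - f x|.
      by rewrite normr_gt0 subr_eq0 eq_sym fg.
    have [|r r0 h] := within_continuous_normP cg t01 (e := `|g t - f x| / 2).
      by rewrite divr_gt0.
    exists r, (`|g t - f x| / 2); split; rewrite ?divr_gt0// => y y01 ty.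
    by have := h y y01 ty; have := ler_distD (g y) (g t) (f x); lra.
  + move=> d d0 h.
    have [|r r0 h'] := within_continuous_normP cf x01 (e := d / 2).
      by rewrite divr_gt0.
    exists r, (d / 2); split; rewrite ?divr_gt0// => y y01 xy t t01.
    have := h t t01; have := h' y y01 xy; have := ler_distD (f y) (g t) (f x).
    by rewrite (distrC (f y)); lra.
- by move=> d d0 h; exists d => // s t s01; exact: h.
Qed.

End UniformContinuity.

(** * The degree of a map from the torus, computed on a single fine grid *)

Section Degree.
Variable R : realType.
Local Notation space := 'rV[R]_3.

(** Rectangular grids are needed because the two cycles may have different lengths, while the grid
    must subdivide every edge evenly. *)
Definition rect_degree (F : R -> R -> space) a b : R :=
  (4 * pi)^-1 * \sum_(i < a) \sum_(j < b)
    cell_area (fun i j => F (i%:R / a%:R) (j%:R / b%:R)) i j.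

Definition fine_torus (F : R -> R -> space) (da db : R) :=
  [/\ forall s, s \in `[0, 1] -> F s 1 = F s 0,
      forall t, t \in `[0, 1] -> F 1 t = F 0 t,
      forall s t, s \in `[0, 1] -> t \in `[0, 1] -> unit_vec (F s t) &
      forall s s' t t', s \in `[0, 1] -> s' \in `[0, 1] -> t \in `[0, 1] ->
        t' \in `[0, 1] -> `|s - s'| <= da -> `|t - t'| <= db ->
        0 < dot (F s t) (F s' t')].

Lemma frac_in01 i n : (i <= n)%N -> i%:R / n%:R \in `[0, 1 : R].
Proof.
case: n => [|n] le_in; first by rewrite invr0 mulr0 in_itv/= lexx ler01.
by rewrite in_itv/= divr_ge0// ler_pdivrMr ?ltr0n// mul1r ler_nat.
Qed.

Lemma rect_degree_aux F da db a b c d : fine_torus F da db ->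
    (0 < a)%N -> (0 < b)%N -> (0 < c)%N -> (0 < d)%N ->
    a%:R^-1 <= da -> b%:R^-1 <= db ->
  let Q i j := F (i%:R / (a * c)%:R) (j%:R / (b * d)%:R) in
  periodic_grid Q (a * c) (b * d) /\
  (forall I J, (I < a)%N -> (J < b)%N -> exists2 P, acute P &
     forall i j, (i <= c)%N -> (j <= d)%N -> P (Q (I * c + i) (J * d + j))%N).
Proof.
move=> [Fb Fa Fu Fd] a0 b0 c0 d0 ada bdb Q; split.
  split=> k kn; rewrite /Q mul0r divff ?pnatr_eq0 -?lt0n ?muln_gt0 ?a0 ?b0//.
    by apply: Fb; exact: frac_in01.
  by apply: Fa; exact: frac_in01.
have le_mul k n l i : (k < n)%N -> (i <= l)%N -> (k * l + i <= n * l)%N.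
  move=> kn il; rewrite (leq_trans (n := (k.+1 * l)%N)) ?leq_mul2r ?kn ?orbT//.
  by rewrite mulSnr leq_add2l.
have near n l k i i' : (0 < n)%N -> (0 < l)%N -> (i <= l)%N -> (i' <= l)%N ->
    `|(k * l + i)%:R / (n * l)%:R - (k * l + i')%:R / (n * l)%:R| <= n%:R^-1 :> R.
  move=> n0 l0 il i'l; rewrite -mulrBl normrM normfV normr_nat.
  rewrite !natrD opprD addrACA subrr add0r ler_pdivrMr ?ltr0n ?muln_gt0 ?n0//.
  rewrite natrM mulKf ?pnatr_eq0 -?lt0n//.
  move: il i'l; rewrite -!(ler_nat R) ler_norml => il i'l.
  by have := ler0n R i; have := ler0n R i'; lra.
move=> I J Ia Jb; exists [set p | exists i j, [/\ (i <= c)%N, (j <= d)%N &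
    p = Q (I * c + i) (J * d + j)]%N]; last by move=> i j ic jd; exists i, j.
split=> [p [i [j [ic jd ->]]]|p q [i [j [ic jd ->]]] [i' [j' [ic' jd' ->]]]].
  by apply: Fu; apply: frac_in01; exact: le_mul.
apply: Fd; try by apply: frac_in01; exact: le_mul.
  by apply: le_trans ada; exact: near.
by apply: le_trans bdb; exact: near.
Qed.

Lemma rect_degree_refine F da db a b c d : fine_torus F da db ->
    (0 < a)%N -> (0 < b)%N -> (0 < c)%N -> (0 < d)%N ->
    a%:R^-1 <= da -> b%:R^-1 <= db ->
  rect_degree F (a * c) (b * d) = rect_degree F a b.
Proof.
move=> fF a0 b0 c0 d0 ada bdb; congr (_ * _).
have [perQ aQ] := rect_degree_aux fF a0 b0 c0 d0 ada bdb.
rewrite (torus_refinement perQ aQ); apply: eq_bigr => I _; apply: eq_bigr => J _.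
have frac k n l : (0 < l)%N -> (k * l)%:R / (n * l)%:R = k%:R / n%:R :> R.
  by move=> l0; rewrite !natrM -mulf_div divff ?mulr1// pnatr_eq0 -lt0n.
by rewrite /cell_area !frac.
Qed.

Lemma rect_degree_int F da db a b : fine_torus F da db ->
    (0 < a)%N -> (0 < b)%N -> a%:R^-1 <= da -> b%:R^-1 <= db ->
  rect_degree F a b \is a Num.int.
Proof.
move=> fF a0 b0 ada bdb.
have [] := rect_degree_aux fF a0 b0 (ltnSn 0) (ltnSn 0) ada bdb.
rewrite !muln1 => perQ aQ; apply: torus_area_int => // I J Ia Jb.
by have [P aP PQ] := aQ I J Ia Jb; exists P => // i j i1 j1;
  have := PQ i j i1 j1; rewrite !muln1.
Qed.

(** The [a] by [b] grid and a fine square grid have a common refinement, with [a * N.+1] by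
    [b * N.+1] cells. So the sequence is eventually constant, and the limit is a value on one
    grid. *)
Lemma torus_degree_rect F da db a b : fine_torus F da db -> 0 < da -> 0 < db ->
    (0 < a)%N -> (0 < b)%N -> a%:R^-1 <= da -> b%:R^-1 <= db ->
  torus_degree F = rect_degree F a b.
Proof.
move=> fF da0 db0 a0 b0 ada bdb.
have small (e : R) : 0 < e -> \forall N \near \oo, N.+1%:R^-1 <= e.
  move=> e0; have := near_infty_natSinv_lt (PosNum e0).
  by apply: filterS => N /ltW.
apply: lim_near_cst => //; near=> N.
rewrite -[LHS]/(rect_degree F N.+1 N.+1).
rewrite -(rect_degree_refine (a := a) (b := b) (c := N.+1) (d := N.+1) fF)//.
rewrite (mulnC a) (mulnC b).
by rewrite (rect_degree_refine (c := a) (d := b) fF)//;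
  near: N; exact: small.
Unshelve. all: by end_near. Qed.

End Degree.

(** * Acute directions and moduli of continuity of piecewise curves *)

Section Directions.
Variable R : realType.
Local Notation space := 'rV[R]_3.
Implicit Types u v w : space.

Lemma coord_le_norm u i : `|u 0 i| <= `|u|.
Proof.
rewrite [`|u|]mx_normrE.
by apply: (le_bigmax _ (fun i => `|u i.1 i.2|) (0, i)).
Qed.

Lemma norm_sqr_le_dot u : `|u| ^+ 2 <= dot u u.
Proof.
have [->|u0] := eqVneq u 0.
  by rewrite normr0 expr0n sumr_ge0// => i _; rewrite -expr2 sqr_ge0.
have /mx_norm_neq0[[i j] /= e] : mx_norm u != 0 by rewrite -[mx_norm u]/`|u| normr_eq0.
rewrite -[`|u|]/(mx_norm u) e (ord1 i) real_normK ?num_real// /dot (bigD1 j)//= -expr2.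
by rewrite lerDl sumr_ge0// => k _; rewrite -expr2 sqr_ge0.
Qed.

(** The norm is the largest absolute coordinate, so that Cauchy-Schwarz is replaced by a bound with
    the factor 3, the number of coordinates. *)
Lemma dot_gt0_near u v : 3 * `|v - u| < `|u| -> 0 < dot u v.
Proof.
set w := v - u => wu; have -> : v = u + w by rewrite /w subrKC.
have -> : dot u (u + w) = dot u u + dot u w.
  by rewrite /dot -big_split; apply: eq_bigr => i _; rewrite mxE mulrDr.
have uw : `|dot u w| <= 3 * (`|u| * `|w|).
  rewrite /dot (le_trans (ler_norm_sum _ _ _))//.
  rewrite [leRHS](_ : _ = \sum_(i < 3) `|u| * `|w|); last first.
    by rewrite sumr_const card_ord mulr_natl.
  by apply: ler_sum => i _; rewrite normrM ler_pM// coord_le_norm.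
have w0 : 0 <= `|w| by [].
have u0 : 0 < `|u| by lra.
move: uw; rewrite ler_norml => /andP[uw _].
have uw' : 3 * (`|u| * `|w|) < `|u| ^+ 2.
  by rewrite mulrCA expr2 ltr_pM2l.
by have := norm_sqr_le_dot u; lra.
Qed.

Lemma dot_unit_dir u v : dot (unit_dir u) (unit_dir v) =
  (Num.sqrt (dot u u))^-1 * (Num.sqrt (dot v v))^-1 * dot u v.
Proof.
by rewrite /unit_dir /dot mulr_sumr; apply: eq_bigr => i _; rewrite !mxE; ring.
Qed.

Lemma unit_dir_unit u : u != 0 -> unit_vec (unit_dir u).
Proof.
move=> u0; have uu : 0 < dot u u.
  by apply: lt_le_trans (norm_sqr_le_dot u); rewrite exprn_gt0// normr_gt0.
by rewrite /unit_vec dot_unit_dir -invfM -expr2 sqr_sqrtr ?ltW// mulVf ?gt_eqF.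
Qed.

Lemma dot_unit_dir_gt0 u v : u != 0 -> v != 0 -> 0 < dot u v ->
  0 < dot (unit_dir u) (unit_dir v).
Proof.
have pos w : w != 0 -> 0 < dot w w.
  move=> w0; apply: lt_le_trans (norm_sqr_le_dot w).
  by rewrite exprn_gt0// normr_gt0.
by move=> u0 v0 uv; rewrite dot_unit_dir !mulr_gt0// invr_gt0 sqrtr_gt0 pos.
Qed.

Lemma unit_interval_param k (s : R) : (0 < k)%N -> s \in `[0, 1] ->
  exists i t, [/\ (i < k)%N, t \in `[0, 1] & s = (i%:R + t) / k%:R].
Proof.
move=> k0; rewrite in_itv/= => /andP[s0 s1].
have kR : 0 < k%:R :> R by rewrite ltr0n.
have ks0 : 0 <= k%:R * s by rewrite mulr_ge0.
have [ks1 ks2] := andP (truncn_itv ks0).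
have se : s = k%:R * s / k%:R by rewrite -mulrA mulrCA divff ?mulr1// gt_eqF.
have [lk|lk] := ltnP (Num.truncn (k%:R * s)) k.
  exists (Num.truncn (k%:R * s)), (k%:R * s - (Num.truncn (k%:R * s))%:R).
  split=> //; last by rewrite subrKC.
  by rewrite in_itv/= subr_ge0 ks1/= lerBlDl -natr1 in ks2 *; rewrite ltW.
(* The right end belongs to the last piece, with local parameter 1. *)
have s1' : s = 1.
  apply/eqP; rewrite eq_le s1 /= -(ler_pM2l kR) mulr1 (le_trans _ ks1)//.
  by rewrite ler_nat.
exists k.-1, 1; split; first by rewrite prednK.
  by rewrite in_itv/= ler01 lexx.
by rewrite s1' natr1 prednK// divff// gt_eqF.
Qed.

(** As [d < 1], parameters at distance at most [d / k] lie on the same arc or on consecutive ones;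
    the factor 2 comes from passing through the common endpoint. *)
Lemma polyarc_modulus (f : R -> space) (arc : nat -> R -> space) k d e :
    (0 < k)%N -> d < 1 -> 0 <= e ->
    (forall i t, (i < k)%N -> t \in `[0, 1] -> f ((i%:R + t) / k%:R) = arc i t) ->
    (forall i s t, (i < k)%N -> s \in `[0, 1] -> t \in `[0, 1] ->
       `|s - t| <= d -> `|arc i s - arc i t| <= e) ->
  forall s t, s \in `[0, 1] -> t \in `[0, 1] -> `|s - t| <= d / k%:R ->
    `|f s - f t| <= 2 * e.
Proof.
move=> k0 d1 e0 farc arcP.
suff le s t : s \in `[0, 1] -> t \in `[0, 1] -> s <= t ->
    `|s - t| <= d / k%:R -> `|f s - f t| <= 2 * e.
  move=> s t s01 t01 st; have [le_st|/ltW le_ts] := leP s t; first exact: le.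
  by rewrite distrC; apply: le; rewrite // distrC.
move=> /(unit_interval_param k0)[i [s' [ik s01 ->]]].
move=> /(unit_interval_param k0)[j [t' [jk t01 ->]]].
have kR : 0 < k%:R :> R by rewrite ltr0n.
rewrite ler_pM2r ?invr_gt0// -mulrBl normrM normfV (gtr0_norm kR).
rewrite ler_pM2r ?invr_gt0// distrC => st.
rewrite ger0_norm ?subr_ge0// => std; rewrite !farc//.
have /andP[s0 s1] : 0 <= s' <= 1 by [].
have /andP[t0 t1] : 0 <= t' <= 1 by [].
have u0 : 0 \in `[0, 1 : R] by rewrite in_itv/= lexx ler01.
have u1 : 1 \in `[0, 1 : R] by rewrite in_itv/= lexx ler01.
have [ij|ji|ij] := ltngtP i j; last first.
- rewrite ij in std st *; rewrite (le_trans (arcP _ _ _ _ _ _ _))//; last by lra.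
  by rewrite ler_norml; apply/andP; split; lra.
(* With the arcs in this order, the inequality between the parameters forces them to be equal, at
   the junction of the two arcs. *)
- have : j%:R + 1 <= i%:R :> R by rewrite natr1 ler_nat.
  move=> ji'; have es : i%:R + s' = j%:R + t' by lra.
  by rewrite -!farc// es subrr normr0 mulr_ge0.
- have ij' : j = i.+1.
    apply/eqP; rewrite eqn_leq ij andbT -ltnS -(ltr_nat R) -!natr1; lra.
  have e1 : arc i 1 = arc j 0.
    by rewrite -!farc// ij' -natr1 addr0.
  rewrite ij' -natr1 in std.
  rewrite -(subrKA (arc i 1)) (le_trans (ler_normD _ _))//.
  rewrite mulr2n mulrDl mul1r lerD//.
    by apply: arcP => //; rewrite ler_norml; apply/andP; split; lra.
  by rewrite e1; apply: arcP => //; rewrite ler_norml; apply/andP; split; lra.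
Qed.

End Directions.

(** * The Gauss map of a pair of cycles, edge by edge *)

Section SpatialGraphs.
Variable R : realType.
Local Notation space := 'rV[R]_3.
Implicit Types G H : spatial_graph R.

Lemma cycle_adj (X : sgraph) (c : seq X) x0 i : is_cycle c -> (i < size c)%N ->
  adj (nth x0 c i) (next c (nth x0 c i)).
Proof. by move=> /and3P[_ _ cc] ic; apply: next_cycle; rewrite ?mem_nth. Qed.

Lemma cycle_curve_arc G (c : seq G) x0 i (t : R) :
    is_cycle c -> (i < size c)%N -> t \in `[0, 1] ->
  cycle_curve c ((i%:R + t) / (size c)%:R) =
    epath (nth x0 c i) (next c (nth x0 c i)) t.
Proof.
move=> cc ic; rewrite in_itv/= => /andP[t0 t1].
have [_ uc _] := and3P cc.
have aG := @cycle_adj _ c x0 _ cc.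
case: c cc ic uc aG => [//|y p] cc ic uc aG; rewrite /cycle_curve.
set k := size (y :: p) in ic *.
have -> : k%:R * ((i%:R + t) / k%:R) = i%:R + t.
  by rewrite mulrC divfK// pnatr_eq0.
have next_i j : (j < k)%N -> next (y :: p) (nth y (y :: p) j) = nth y (y :: p) j.+1.
  by move=> jk; rewrite next_nth mem_nth// index_uniq.
rewrite !(set_nth_default y x0 ic).
move: t1; rewrite le_eqVlt => /predU1P[->|t1]; last first.
  have -> : Num.truncn (i%:R + t) = i.
    by apply: truncn_def; rewrite -natr1; lra.
  by rewrite addrC addKr.
(* At [t = 1] the curve already reads the start of the next edge. After the last edge the index
   [size c] is out of range, and the default of [nth] is the first vertex, as it should be. *)
have -> : Num.truncn (i%:R + 1 : R) = i.+1 by rewrite natr1 natrK.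
rewrite natr1 subrr epath1; last first.
  by have := aG i ic; rewrite !(set_nth_default y x0) ?ltnS.
rewrite (next_i i ic); move: (ic); rewrite leq_eqVlt => /predU1P[ik|ik]; last first.
  by rewrite epath0//; have := aG _ ik; rewrite !(set_nth_default y x0) ?ltnS.
rewrite ik nth_default ?leqnn//.
by rewrite epath0//; have := aG 0%N isT.
Qed.

Definition edge_dir G H (x y : G) (u v : H) (s t : R) : space :=
  unit_dir (epath u v t - epath x y s).

(** The solid angle swept by one pair of edges, in units of the whole sphere. It is a real number
    with no reason to be an integer, as its square does not close up. *)
Definition edge_winding n G H (x y : G) (u v : H) : R :=
  (4 * pi)^-1 * \sum_(i < n) \sum_(j < n)
    cell_area (fun i j => edge_dir x y u v (i%:R / n%:R) (j%:R / n%:R)) i j.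

Definition edge_modulus G (d e : R) := forall x y : G, adj x y ->
  forall s t, s \in `[0, 1] -> t \in `[0, 1] ->
    `|s - t| <= d -> `|epath x y s - epath x y t| <= e.

Definition edge_distance G H (h : R) := forall (x y : G) (u v : H),
  adj x y -> adj u v ->
  forall s t, s \in `[0, 1] -> t \in `[0, 1] -> h <= `|epath u v t - epath x y s|.

Lemma edge_modulus_exists G e : 0 < e -> exists2 d, 0 < d & edge_modulus G d e.
Proof.
move=> e0; have [] := @finite_uniform R (G * G)%type (fun p d => adj p.1 p.2 ->
  forall s t, s \in `[0, 1] -> t \in `[0, 1] ->
    `|s - t| <= d -> `|epath p.1 p.2 s - epath p.1 p.2 t| <= e).
- move=> p d d' _ d'd h ad s t s01 t01 st; apply: h => //.
  exact: le_trans st d'd.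
- move=> [x y] /=; have [ad|nad] := boolP (adj x y); last by exists 1.
  have [d d0 h] := unit_interval_unif_continuous (epath_continuous ad) e0.
  by exists d.
- by move=> d d0 h; exists d => // x y; exact: (h (x, y)).
Qed.

Lemma edge_distance_exists G H : disjointly_embedded G H ->
  exists2 h, 0 < h & edge_distance G H h.
Proof.
move=> GH; have [] := @finite_uniform R (G * G * (H * H))%type (fun p d =>
  adj p.1.1 p.1.2 -> adj p.2.1 p.2.2 ->
  forall s t, s \in `[0, 1] -> t \in `[0, 1] ->
    d <= `|epath p.2.1 p.2.2 t - epath p.1.1 p.1.2 s|).
- move=> p d d' _ d'd h ad ad' s t s01 t01; apply: le_trans d'd _.
  exact: h.
- move=> [[x y] [u v]] /=.
  have [ad|nad] := boolP (adj x y); last by exists 1.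
  have [ad'|nad'] := boolP (adj u v); last by exists 1.
  have [s t s01 t01|d d0 h] := disjoint_curves_dist (epath_continuous ad)
      (epath_continuous ad').
    apply/eqP => e; suff : (image_of G `&` image_of H) (epath x y s).
      by rewrite GH.
    split; right; first by exists x, y; split=> //; exists s.
    by exists u, v; split=> //; exists t.
  by exists d.
- by move=> d d0 h; exists d => // x y u v; exact: (h ((x, y), (u, v))).
Qed.

Section FixedScale.
Variables (G H : spatial_graph R) (h d : R).
Hypotheses (h0 : 0 < h) (d0 : 0 < d) (d1 : d < 1).
Hypothesis GH : edge_distance G H h.
Hypotheses (modG : edge_modulus G d (h / 16)) (modH : edge_modulus H d (h / 16)).

Lemma edge_dir_acute x y u v (adxy : adj x y) (aduv : adj u v)
    (S : set (R * R)) :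
    (forall p, S p -> p.1 \in `[0, 1] /\ p.2 \in `[0, 1]) ->
    (forall p q, S p -> S q -> `|p.1 - q.1| <= d /\ `|p.2 - q.2| <= d) ->
  acute [set a | exists2 p, S p & a = @edge_dir G H x y u v p.1 p.2].
Proof.
move=> S01 Sd; have ne s t : s \in `[0, 1] -> t \in `[0, 1] ->
    epath u v t - epath x y s != 0.
  move=> s01 t01; rewrite -normr_gt0.
  by apply: lt_le_trans h0 (GH adxy aduv s01 t01).
split=> [_ [p /S01[p1 p2] ->]|_ _ [p Sp ->] [q Sq ->]].
  by apply: unit_dir_unit; exact: ne.
have [[p1 p2] [q1 q2]] := (S01 _ Sp, S01 _ Sq).
have [pq1 pq2] := Sd _ _ Sp Sq.
apply: dot_unit_dir_gt0; try exact: ne.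
apply: dot_gt0_near; apply: (lt_le_trans _ (GH adxy aduv p1 p2)).
have e1 := modG adxy p1 q1 pq1; have e2 := modH aduv q2 p2.
rewrite distrC in pq2; have {}e2 := e2 pq2.
rewrite [X in `|X|](_ : _ = (epath u v q.2 - epath u v p.2) +
  (epath x y p.1 - epath x y q.1)); last first.
  by rewrite opprB addrACA [RHS]addrACA; congr (_ + _); rewrite addrC.
have := le_trans (ler_normD _ _) (lerD e2 e1); have := h0; move: `|_ + _| => e h1 he.
by lra.
Qed.

(** Origin of the constant 16: passing through a vertex doubles the modulus [h / 16], both curves
    may move, and [3 * (h / 8 + h / 8) < h] is what [dot_gt0_near] asks for. *)
Lemma fine_torus_cycles (C : seq G) (D : seq H) : is_cycle C -> is_cycle D ->
  fine_torus (fun s t => unit_dir (cycle_curve D t - cycle_curve C s))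
    (d / (size C)%:R) (d / (size D)%:R).
Proof.
move=> cC cD.
have [x0 C0] : exists x0 : G, (0 < size C)%N.
  by case: C cC => [//|x0 C] _; exists x0.
have [u0 D0] : exists u0 : H, (0 < size D)%N.
  by case: D cD => [//|u0 D] _; exists u0.
have aC := @cycle_adj _ C x0 _ cC; have aD := @cycle_adj _ D u0 _ cD.
have arcC i t := @cycle_curve_arc G C x0 i t cC.
have arcD i t := @cycle_curve_arc H D u0 i t cD.
have dist s t : s \in `[0, 1] -> t \in `[0, 1] ->
    h <= `|cycle_curve D t - cycle_curve C s|.
  move=> /(unit_interval_param C0)[i [s' [iC s01 ->]]].
  move=> /(unit_interval_param D0)[j [t' [jD t01 ->]]].
  by rewrite arcC// arcD//; apply: GH => //; [exact: aC|exact: aD].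
have ne s t : s \in `[0, 1] -> t \in `[0, 1] ->
    cycle_curve D t - cycle_curve C s != 0.
  by move=> s01 t01; rewrite -normr_gt0; exact: lt_le_trans h0 (dist _ _ s01 t01).
have h16 : 0 <= h / 16 by rewrite divr_ge0// ltW.
have mC := polyarc_modulus C0 d1 h16 arcC
  (fun i s t iC s01 t01 => modG (aC i iC) s01 t01).
have mD := polyarc_modulus D0 d1 h16 arcD
  (fun i s t iD s01 t01 => modH (aD i iD) s01 t01).
have closed (K : spatial_graph R) (c : seq K) : is_cycle c ->
    cycle_curve c 1 = cycle_curve c 0 :> space.
  case: c => [//|y p] cc.
  have u0' : 0 \in `[0, 1 : R] by rewrite in_itv/= lexx ler01.
  have u1' : 1 \in `[0, 1 : R] by rewrite in_itv/= lexx ler01.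
  have := @cycle_curve_arc K (y :: p) y 0 0 cc isT u0'.
  rewrite addr0 mul0r => ->.
  have := @cycle_curve_arc K (y :: p) y (size p) 1 cc (leqnn _) u1'.
  rewrite natr1 divff ?pnatr_eq0// => ->.
  rewrite epath0; last exact: cycle_adj.
  rewrite epath1; last exact: cycle_adj.
  have [_ uc _] := and3P cc.
  by rewrite next_nth mem_nth// index_uniq// nth_default.
split.
- by move=> s s01; rewrite closed.
- by move=> t t01; rewrite closed.
- by move=> s t s01 t01; apply: unit_dir_unit; exact: ne.
- move=> s s' t t' s01 s01' t01 t01' ss tt.
  apply: dot_unit_dir_gt0; try exact: ne.
  apply: dot_gt0_near; apply: (lt_le_trans _ (dist _ _ s01 t01)).
  have e1 := mC _ _ s01 s01' ss.
  rewrite distrC in tt; have e2 := mD _ _ t01' t01 tt.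
  rewrite [X in `|X|](_ : _ = (cycle_curve D t' - cycle_curve D t) +
    (cycle_curve C s - cycle_curve C s')); last first.
    by rewrite opprB addrACA [RHS]addrACA; congr (_ + _); rewrite addrC.
  have := le_trans (ler_normD _ _) (lerD e2 e1); have := h0; move: `|_ + _| => e h1 he.
  by lra.
Qed.

Variable n : nat.
Hypotheses (n0 : (0 < n)%N) (nd : n%:R^-1 <= d).

(** With [n] steps on every edge the grid is a union of [n] by [n] blocks, one for each pair of
    edges, and it is fine enough for its degree to be the linking number. *)
Lemma Lk_edges (C : seq G) (D : seq H) : is_cycle C -> is_cycle D ->
  Lk (cycle_curve C) (cycle_curve D) =
    \sum_(x <- C) \sum_(u <- D) edge_winding n x (next C x) u (next D u) /\
  Lk (cycle_curve C) (cycle_curve D) \is a Num.int.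
Proof.
move=> cC cD; have fF := fine_torus_cycles cC cD.
have [x0 C0] : exists x0 : G, (0 < size C)%N.
  by case: C cC {fF} => [//|x0 C] _; exists x0.
have [u0 D0] : exists u0 : H, (0 < size D)%N.
  by case: D cD {fF} => [//|u0 D] _; exists u0.
have mesh k : (0 < k)%N -> (k * n)%:R^-1 <= d / k%:R.
  by move=> k0; rewrite natrM invfM mulrC ler_pM2r// invr_gt0 ltr0n.
have kn0 k : (0 < k)%N -> (0 < k * n)%N by move=> k0; rewrite muln_gt0 k0.
have dk k : (0 < k)%N -> 0 < d / k%:R by move=> k0; rewrite divr_gt0// ltr0n.
rewrite /Lk (torus_degree_rect fF (dk _ C0) (dk _ D0) (kn0 _ C0) (kn0 _ D0)
  (mesh _ C0) (mesh _ D0)).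
split; last exact: (rect_degree_int fF (kn0 _ C0) (kn0 _ D0) (mesh _ C0) (mesh _ D0)).
rewrite /rect_degree (big_nth x0) big_mkord mulr_sumr.
rewrite (sum_nat_mul (fun i => _ * \sum_(j < _) cell_area _ i j)).
apply: eq_bigr => i _.
rewrite (big_nth u0) big_mkord -mulr_sumr.
under eq_bigr do rewrite (sum_nat_mul (cell_area _ _)).
rewrite exchange_big mulr_sumr; apply: eq_bigr => j _; congr (_ * _).
apply: eq_bigr => i' _; apply: eq_bigr => j' _; rewrite /cell_area -!addnS.
have frac k l m : (0 < k)%N -> (l * n + m)%:R / (k * n)%:R =
    (l%:R + m%:R / n%:R) / k%:R :> R.
  move=> k0; rewrite natrD !natrM; field.
  by rewrite !pnatr_eq0 -!lt0n k0 n0.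
have i01 m : (m <= n)%N -> m%:R / n%:R \in `[0, 1 : R] by exact: frac_in01.
rewrite !frac// /edge_dir !(cycle_curve_arc x0 cC)// ?i01// ?(ltnW (ltn_ord _))//.
rewrite !(cycle_curve_arc u0 cD)// ?i01// ?(ltnW (ltn_ord _))//.
Qed.

(** Reversing an edge reflects its block of the grid onto itself, and [quad_area_flip] applies to
    each cell. *)
Lemma edge_winding_rev x y u v : adj x y -> adj u v ->
  edge_winding n y x u v = - @edge_winding n G H x y u v /\
  edge_winding n x y v u = - @edge_winding n G H x y u v.
Proof.
move=> adxy aduv.
have i01 m : (m <= n)%N -> m%:R / n%:R \in `[0, 1 : R] by exact: frac_in01.
have rev m : (m <= n)%N -> 1 - m%:R / n%:R = (n - m)%:R / n%:R :> R.
  by move=> mn; rewrite natrB// mulrBl divff// pnatr_eq0 -lt0n.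
pose P i j := edge_dir x y u v (i%:R / n%:R) (j%:R / n%:R).
have flip i j : (i < n)%N -> (j < n)%N ->
    quad_area (P i.+1 j) (P i j) (P i j.+1) (P i.+1 j.+1) = - cell_area P i j /\
    quad_area (P i j.+1) (P i.+1 j.+1) (P i.+1 j) (P i j) = - cell_area P i j.
  move=> ni nj.
  pose S : set (R * R) := [set p | exists k l, [/\ (k <= 1)%N, (l <= 1)%N &
    p = ((i + k)%:R / n%:R, (j + l)%:R / n%:R)]].
  have near m k l : (k <= 1)%N -> (l <= 1)%N ->
      `|(m + k)%:R / n%:R - (m + l)%:R / n%:R| <= d :> R.
    move=> k1 l1; apply: le_trans nd; rewrite -mulrBl normrM normfV normr_nat.
    rewrite ler_piMl ?invr_ge0// !natrD opprD addrACA subrr add0r.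
    by move: k1 l1; rewrite -!(ler_nat R) ler_norml => k1 l1;
      have := ler0n R k; have := ler0n R l; lra.
  have aP : acute [set a | exists2 p, S p & a = edge_dir x y u v p.1 p.2].
    apply: edge_dir_acute => // [_ [k [l [k1 l1 ->]]]|].
      by split; apply: (i01 (_ + _)%N); lia.
    by move=> _ _ [k [l [k1 l1 ->]]] [k' [l' [k1' l1' ->]]]; split; exact: near.
  have inP k l : (k <= 1)%N -> (l <= 1)%N ->
      [set a | exists2 p, S p & a = edge_dir x y u v p.1 p.2] (P (i + k) (j + l))%N.
    by move=> k1 l1; exists ((i + k)%:R / n%:R, (j + l)%:R / n%:R) => //; exists k, l.
  have := quad_area_flip aP (inP 0 0 isT isT)%N (inP 1 0 isT isT)%N
    (inP 1 1 isT isT)%N (inP 0 1 isT isT)%N.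
  by rewrite !addn0 !addn1.
have rev_ordE (i : 'I_n) : (n - i = (rev_ord i).+1)%N /\ (n - i.+1 = rev_ord i)%N.
  by rewrite /= subnSK.
split; rewrite -mulrN -sumrN; congr (_ * _).
  rewrite (reindex_inj rev_ord_inj); apply: eq_bigr => i _.
  rewrite -sumrN; apply: eq_bigr => j _.
  rewrite -(flip i j (ltn_ord i) (ltn_ord j)).1 /cell_area /edge_dir.
  have [e1 e2] := rev_ordE (rev_ord i); rewrite rev_ordK in e1 e2.
  rewrite !(epath_rev adxy)// ?i01 ?rev// ?(ltnW (ltn_ord _))//.
  by rewrite e1 e2.
apply: eq_bigr => i _.
rewrite (reindex_inj rev_ord_inj) -sumrN; apply: eq_bigr => j _.
rewrite -(flip i j (ltn_ord i) (ltn_ord j)).2 /cell_area /edge_dir.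
have [e1 e2] := rev_ordE (rev_ord j); rewrite rev_ordK in e1 e2.
rewrite !(epath_rev aduv)// ?i01 ?rev// ?(ltnW (ltn_ord _))//.
by rewrite e1 e2.
Qed.

End FixedScale.

(** All that the combinatorics needs from space: one function of pairs of edges, the same for all
    pairs of cycles, antisymmetric and with integral cycle sums. *)
Theorem linking_form G H : disjointly_embedded G H ->
  exists E : G -> G -> H -> H -> R,
    (forall x y u v, adj x y -> adj u v ->
       E y x u v = - E x y u v /\ E x y v u = - E x y u v) /\
    (forall (C : seq G) (D : seq H), is_cycle C -> is_cycle D ->
       Lk (cycle_curve C) (cycle_curve D) =
         \sum_(x <- C) \sum_(u <- D) E x (next C x) u (next D u) /\
       Lk (cycle_curve C) (cycle_curve D) \is a Num.int).
Proof.
move=> /edge_distance_exists[h h0 GH].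
have h16 : 0 < h / 16 by rewrite divr_gt0.
have [dG dG0 modG] := edge_modulus_exists G h16.
have [dH dH0 modH] := edge_modulus_exists H h16.
pose d := Num.min (Num.min dG dH) (1 / 2).
have d0 : 0 < d by rewrite !lt_min dG0 dH0 divr_gt0.
have d1 : d < 1 by rewrite gt_min; apply/orP; right; lra.
have [ddG ddH] : d <= dG /\ d <= dH by rewrite !ge_min !lexx !orbT.
pose n := (Num.truncn d^-1).+1.
have nd : n%:R^-1 <= d.
  rewrite -[leRHS]invrK lef_pV2 ?posrE ?invr_gt0 ?ltr0n// ltW//.
  by have /truncn_itv/andP[] : 0 <= d^-1 by rewrite invr_ge0 ltW.
have {}modG : edge_modulus G d (h / 16).
  by move=> z w ad s t s01 t01 st; apply: modG => //; exact: le_trans ddG.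
have {}modH : edge_modulus H d (h / 16).
  by move=> z w ad s t s01 t01 st; apply: modH => //; exact: le_trans ddH.
exists (@edge_winding n G H); split.
  by move=> x y u v; exact: (edge_winding_rev h0 d0 d1 GH modG modH _ nd).
by move=> C D; exact: (Lk_edges h0 d0 d1 GH modG modH _ nd).
Qed.

End SpatialGraphs.

(** * Weak forms and weak pairings *)

Section WeakForms.
Variable V : finType.
Implicit Types (a : V -> V -> int) (c : seq V) (x y z p q r : V).

Definition cycle_sum a c := \sum_(x <- c) a x (next c x).

Definition weak_form a := (forall x y, a y x = - a x y) /\
  (forall c, uniq c -> (2 < size c)%N -> `|cycle_sum a c| <= 1).

(** A cycle sum without [next], which therefore computes on explicit lists and yields linear
    inequalities. *)
Fixpoint walk_sum a x c e :=
  if c is y :: c' then a x y + walk_sum a y c' e else a x e.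

Lemma map_next_cons x c : uniq (x :: c) -> map (next (x :: c)) (x :: c) = rcons c x.
Proof.
move=> uc; apply: (@eq_from_nth _ x) => [|i]; rewrite size_map ?size_rcons// => ic.
rewrite (nth_map x)// next_nth mem_nth// index_uniq// nth_rcons.
by move: ic; rewrite ltnS leq_eqVlt => /predU1P[->|->]//;
  rewrite ltnn eqxx nth_default.
Qed.

Lemma cycle_sumE a x c : uniq (x :: c) -> cycle_sum a (x :: c) = walk_sum a x c x.
Proof.
move=> uc; have := map_next_cons uc; rewrite /cycle_sum.
move: (next (x :: c)) => f; move: {2 5}x => e.
elim: c x {uc} => [|y c IHc] x /=; first by rewrite big_seq1 => -[->].
by rewrite big_cons => -[-> e']; rewrite IHc.
Qed.

Definition tri a x y z := a x y + a y z + a z x.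

Lemma cycle_sum3 a x y z : uniq [:: x; y; z] -> cycle_sum a [:: x; y; z] = tri a x y z.
Proof. by move=> u; rewrite cycle_sumE// /= addrA. Qed.

(* The indices in s select the vertices of a cycle among those listed in vs. *)
Lemma weak_cycle a x vs i s : weak_form a -> uniq (x :: vs) ->
    uniq (i :: s) -> all (fun k => k <= size vs)%N (i :: s) -> (1 < size s)%N ->
  `|walk_sum a (nth x (x :: vs) i) (map (nth x (x :: vs)) s) (nth x (x :: vs) i)|
    <= 1.
Proof.
move=> [_ wa] uvs us als ss.
have u : uniq (map (nth x (x :: vs)) (i :: s)).
  rewrite map_inj_in_uniq// => k l /(allP als) kv /(allP als) lv /eqP.
  by rewrite nth_uniq// => /eqP.
by have := wa _ u; rewrite cycle_sumE//; apply; rewrite /= size_map.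
Qed.

(* A star form is, up to a coboundary and modulo 2, supported by the edges
   joining the center p to the points of S. *)
Definition star p (S : pred V) x y z :=
  [|| (x == p) && (S y != S z), (y == p) && (S z != S x)
    | (z == p) && (S x != S y)].

Variable a : V -> V -> int.
Hypothesis wa : weak_form a.

Let anti x y : a y x = - a x y. Proof. by case: wa. Qed.

Lemma weak_form_xx x : a x x = 0.
Proof. by have := anti x x; lia. Qed.

Lemma tri_swap x y z : tri a y x z = - tri a x y z.
Proof. by rewrite /tri (anti x y) (anti y z) (anti z x); ring. Qed.

Lemma tri_swapr x y z : tri a x z y = - tri a x y z.
Proof. by rewrite /tri (anti x y) (anti y z) (anti z x); ring. Qed.

Lemma tri_rot x y z : tri a y z x = tri a x y z.
Proof. by rewrite /tri; ring. Qed.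

Lemma tri_cocycle p x y z : tri a x y z = tri a p x y + tri a p y z + tri a p z x.
Proof. by rewrite /tri (anti p x) (anti p y) (anti p z); ring. Qed.

Lemma tri_le1 x y z : `|tri a x y z| <= 1.
Proof.
have [e|xy] := eqVneq x y.
  by rewrite e /tri weak_form_xx (anti z y); lia.
have [e|yz] := eqVneq y z.
  by rewrite e /tri weak_form_xx (anti z x); lia.
have [e|xz] := eqVneq x z.
  by rewrite e /tri weak_form_xx (anti z y); lia.
have u : uniq [:: x; y; z] by rewrite /= !inE negb_or xy xz yz.
by rewrite -cycle_sum3//; case: wa => _; apply.
Qed.

(** The oriented faces of a tetrahedron sum to zero, and any two of them add up to a 4-cycle. So no
    two nonzero faces have the same sign, and at most two faces are nonzero. *)
Lemma tri_other_sides p q r x : uniq [:: p; q; r; x] ->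
    tri a p q r != 0 -> tri a q r x != 0 -> tri a p r x = 0 /\ tri a p q x = 0.
Proof.
move=> u.
have := @weak_cycle a p [:: q; r; x] 0 [:: 1; 2; 3] wa u isT isT isT.
have := @weak_cycle a p [:: q; r; x] 0 [:: 1; 3; 2] wa u isT isT isT.
have := @weak_cycle a p [:: q; r; x] 0 [:: 2; 1; 3] wa u isT isT isT.
have := tri_le1 p q r; have := tri_le1 p q x; have := tri_le1 p r x.
have := tri_le1 q r x; rewrite /= /tri.
rewrite ?(anti p q) ?(anti p r) ?(anti p x) ?(anti q r) ?(anti q x) ?(anti r x).
by lia.
Qed.

(** The 5-cycles [p q x y r] and [p q y x r] have sums [tri a p q r + tri a q x y] and
    [tri a p q r - tri a q x y], both bounded by 1. *)
Lemma tri_opposite_sides p q r x y : uniq [:: p; q; r; x; y] ->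
    tri a p q r != 0 -> tri a q r x = 0 -> tri a q r y = 0 -> tri a q x y = 0.
Proof.
move=> u.
have := @weak_cycle a p [:: q; r; x; y] 0 [:: 1; 3; 4; 2] wa u isT isT isT.
have := @weak_cycle a p [:: q; r; x; y] 0 [:: 1; 4; 3; 2] wa u isT isT isT.
have := tri_le1 p q r; have := tri_le1 q x y.
have := tri_le1 p q x; have := tri_le1 p q y; have := tri_le1 p r x.
have := tri_le1 p r y; have := tri_le1 p x y; have := tri_le1 r x y.
rewrite /= /tri.
rewrite ?(anti p q) ?(anti p r) ?(anti p x) ?(anti p y) ?(anti q r) ?(anti q x).
rewrite ?(anti q y) ?(anti r x) ?(anti r y) ?(anti x y).
by lia.
Qed.

(** In each of the three tetrahedra the outer triangle, oriented compatibly, has the value opposite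
    to that of [p q r]. The hexagon [p y r x q z] around the four triangles then has a sum of
    absolute value 2. *)
Lemma tri_three_sides p q r x y z : uniq [:: p; q; r; x; y; z] ->
    tri a p q r != 0 -> tri a q r x != 0 -> tri a p r y != 0 ->
    tri a p q z != 0 -> False.
Proof.
move=> u tpqr tqrx tpry tpqz.
have sub s : uniq s -> all (fun k => k < 6)%N s ->
    uniq (map (nth p [:: p; q; r; x; y; z]) s).
  move=> us als; rewrite map_inj_in_uniq// => k l /(allP als) kv /(allP als) lv /eqP.
  by rewrite nth_uniq// => /eqP.
have [t1 t2] := tri_other_sides (sub [:: 0; 1; 2; 3] isT isT) tpqr tqrx.
have [t3 t4] : tri a q r y = 0 /\ tri a q p y = 0.
  by apply: tri_other_sides (sub [:: 1; 0; 2; 4] isT isT) _ _; rewrite // tri_swap oppr_eq0.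
have [t5 t6] : tri a r q z = 0 /\ tri a r p z = 0.
  apply: tri_other_sides (sub [:: 2; 0; 1; 5] isT isT) _ _ => //.
  by rewrite tri_rot tri_rot.
have t7 : tri a p x y = 0.
  apply: tri_opposite_sides (sub [:: 2; 0; 1; 3; 4] isT isT) _ _ _ => //.
    by rewrite tri_rot tri_rot.
  by rewrite tri_swap t4 oppr0.
have t8 : tri a p x z = 0.
  apply: tri_opposite_sides (sub [:: 1; 0; 2; 3; 5] isT isT) _ _ _ => //.
    by rewrite tri_swap oppr_eq0.
  by rewrite tri_swap t6 oppr0.
have t9 : tri a q y z = 0.
  apply: tri_opposite_sides (sub [:: 0; 1; 2; 4; 5] isT isT) _ _ _ => //.
  by rewrite tri_swap t5 oppr0.
pose w := fun s => @weak_cycle a p [:: q; r; x; y; z] 0 s wa u.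
have := w [:: 4; 2; 3; 1; 5] isT isT isT; have := w [:: 1; 3; 2; 4; 5] isT isT isT.
have := w [:: 1; 5; 3; 2; 4] isT isT isT; have := w [:: 1; 3; 5; 4] isT isT isT.
move: tpqr t1 t2 t3 t4 t5 t6 t7 t8 t9; rewrite {sub w} /= /tri.
rewrite ?(anti p q) ?(anti p r) ?(anti p x) ?(anti p y) ?(anti p z) ?(anti q r).
rewrite ?(anti q x) ?(anti q y) ?(anti q z) ?(anti r x) ?(anti r y) ?(anti r z).
rewrite ?(anti x y) ?(anti x z) ?(anti y z).
by lia.
Qed.

End WeakForms.

Ltac distinct :=
  rewrite /= ?inE ?negb_or ?andbT;
  repeat match goal with
  | H : is_true (uniq _) |- _ => rewrite /= ?inE ?negb_or ?andbT in H
  | H : is_true (_ \notin _) |- _ => rewrite /= ?inE ?negb_or in H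
  | H : is_true (_ && _) |- _ => case/andP: H => ? ?
  end;
  repeat (apply/andP; split);
  first [done | by rewrite eq_sym].

(** * Every weak form is a star *)

Section StarForms.
Variables (V : finType) (a : V -> V -> int).
Hypothesis wa : weak_form a.
Implicit Types (p q r x y z : V).

(** As no other linked triangle lies on the side [q r], triangles through [q] avoiding [p] vanish by
    [tri_opposite_sides], and the cocycle identity extends this to all triangles avoiding [p]. Those
    at [p] are then differences of the values [tri a p q v], which can only be 0 or
    [tri a p q r]. *)
Lemma star_form_center p q r : uniq [:: p; q; r] -> tri a p q r != 0 ->
    (forall x, x \notin [:: p; q; r] -> tri a q r x = 0) ->
  forall x y z, uniq [:: x; y; z] ->
    (tri a x y z != 0) = star p (fun v => tri a p q v != 0) x y z.
Proof.
move=> u tpqr side.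
have deg x y : tri a x x y = 0 by rewrite /tri (weak_form_xx wa) (wa.1 x y); lia.
have deg' x y : tri a x y y = 0 by rewrite /tri (weak_form_xx wa) (wa.1 x y); lia.
have out x y : x != p -> y != p -> tri a q x y = 0.
  move=> xp yp.
  have [->|xq] := eqVneq x q; first exact: deg.
  have [->|yq] := eqVneq y q; first by rewrite (tri_rot a q q x) deg.
  have [->|xy] := eqVneq x y; first exact: deg'.
  have qr0 v : v != p -> tri a q r v = 0.
    move=> vp; have [->|vq] := eqVneq v q; first by rewrite (tri_rot a q q r) deg.
    have [->|vr] := eqVneq v r; first exact: deg'.
    by apply: side; rewrite !inE !negb_or vp vq vr.
  have [e|xr] := eqVneq x r; first by rewrite e qr0.
  have [e|yr] := eqVneq y r.
    by rewrite e (tri_rot a r q x) (tri_swap wa) qr0 ?oppr0.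
  apply: (tri_opposite_sides wa) tpqr (qr0 _ xp) (qr0 _ yp).
  by distinct.
have far x y z : x != p -> y != p -> z != p -> tri a x y z = 0.
  by move=> xp yp zp; rewrite (tri_cocycle wa q) !out.
have at_p x y : x != p -> y != p ->
    (tri a p x y != 0) = ((tri a p q x != 0) != (tri a p q y != 0)).
  move=> xp yp.
  have qp : q != p by distinct.
  have rp : r != p by distinct.
  have sign v : v != p -> tri a p q v = 0 \/ tri a p q v = tri a p q r.
    move=> vp; have := tri_cocycle wa p q r v; rewrite out//.
    rewrite (tri_swapr wa p q v).
    have := tri_le1 wa p q v; have := tri_le1 wa p q r; have := tri_le1 wa p r v.
    by move: (tri a p q v) (tri a p q r) (tri a p r v) tpqr => ? ? ?; lia.
  have -> : tri a p x y = tri a p q y - tri a p q x.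
    have := tri_cocycle wa p q x y; rewrite out//.
    by rewrite (tri_swapr wa p q y); lia.
  have [->|->] := sign _ xp; have [->|->] := sign _ yp;
    by rewrite ?subr0 ?sub0r ?subrr ?oppr_eq0 ?eqxx ?tpqr.
move=> x y z; rewrite /= !inE negb_or => /and3P[/andP[xy xz] yz _]; rewrite /star.
have [e|xp] := eqVneq x p.
  subst x; rewrite (eq_sym y) (eq_sym z) (negbTE xy) (negbTE xz) /= orbF.
  by apply: at_p; rewrite eq_sym.
have [e|yp] := eqVneq y p.
  subst y; rewrite (eq_sym z) (negbTE yz) /= orbF -(tri_rot a x p z).
  by apply: at_p; rewrite // eq_sym.
have [e|zp] := eqVneq z p; last by rewrite far.
by subst z; rewrite /= (tri_rot a p x y) at_p.
Qed.

(** By [tri_three_sides] a linked triangle has a side that lies on no other linked triangle; the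
    vertex opposite to it is the center. *)
Lemma star_form (v0 : V) : exists p (S : pred V), forall x y z, uniq [:: x; y; z] ->
  (tri a x y z != 0) = star p S x y z.
Proof.
have [[[p q] r] /andP[u t]|none] := pickP (fun T : V * V * V =>
    uniq [:: T.1.1; T.1.2; T.2] && (tri a T.1.1 T.1.2 T.2 != 0)); last first.
  (* When all triangles vanish, any center with an empty split will do. *)
  exists v0, pred0 => x y z u; have := none (x, y, z); rewrite /= in u *.
  by rewrite u /star /= !andbF => ->.
pose used p q r := [exists x, (x \notin [:: p; q; r]) && (tri a q r x != 0)].
have center x y z : uniq [:: x; y; z] -> tri a x y z != 0 -> ~~ used x y z ->
    exists p (S : pred V), forall x y z, uniq [:: x; y; z] ->
      (tri a x y z != 0) = star p S x y z.
  move=> u' t' /existsPn side; exists x; eexists; apply: star_form_center u' t' _.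
  by move=> v vn; have := side v; rewrite vn negbK => /eqP.
have [/existsP[x /andP[xn tx]]|] := boolP (used p q r); last exact: center.
have t' : tri a q p r != 0 by rewrite (tri_swap wa) oppr_eq0.
have u' : uniq [:: q; p; r].
  by distinct.
have [/existsP[y /andP[yn ty]]|] := boolP (used q p r); last exact: center.
have t'' : tri a r p q != 0 by rewrite -(tri_rot a r p q).
have u'' : uniq [:: r; p; q].
  by distinct.
have [/existsP[z /andP[zn tz]]|] := boolP (used r p q); last exact: center.
have out4 p' q' r' v : uniq [:: p'; q'; r'] -> v \notin [:: p'; q'; r'] ->
    uniq [:: p'; q'; r'; v].
  by move=> uu vn; distinct.
have [t1 t2] := tri_other_sides wa (out4 _ _ _ _ u xn) t tx.
have [t3 t4] := tri_other_sides wa (out4 _ _ _ _ u' yn) t' ty.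
have [t5 t6] := tri_other_sides wa (out4 _ _ _ _ u'' zn) t'' tz.
exfalso; apply: (tri_three_sides wa _ t tx ty tz).
(* A coincidence among the outer vertices would make a linked triangle one of those just shown to
   vanish. *)
have xy : x != y by apply: contra_neq ty => <-.
have xz : x != z by apply: contra_neq tz => <-.
have yz : y != z.
  apply: contra_neq tz => <-; rewrite (tri_swap wa).
  by apply/eqP; rewrite oppr_eq0 t4.
by distinct.
Qed.

End StarForms.

(** * A cycle on which two weak forms are both nonzero *)

Section CommonCycle.
Variable W : finType.
Implicit Types (a : W -> W -> int) (u v w : W).

(** Such a form is a coboundary, [a x y = a u y - a u x], and telescopes along the cycle. *)
Lemma tri0_cycle_sum a : weak_form a ->
    (forall u v w, uniq [:: u; v; w] -> tri a u v w = 0) ->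
  forall c, cycle_sum a c = 0 \/ ~~ uniq c.
Proof.
move=> wa a0 [|u c]; first by left; rewrite /cycle_sum big_nil.
have [uc|] := boolP (uniq (u :: c)); last by right.
left; have tri0 x y : tri a u x y = 0.
  have [e|ux] := eqVneq u x; first by rewrite e /tri (weak_form_xx wa) (wa.1 x y); lia.
  have [e|uy] := eqVneq u y; first by rewrite e /tri (weak_form_xx wa) (wa.1 x y); lia.
  have [e|xy] := eqVneq x y; first by rewrite e /tri (weak_form_xx wa) (wa.1 u y); lia.
  by apply: a0; distinct.
rewrite cycle_sumE//.
suff walk x : walk_sum a x c u = a x u by rewrite walk (weak_form_xx wa).
elim: c x {uc} => //= y c IHc x; rewrite IHc.
by have := tri0 x y; rewrite /tri (wa.1 x u); lia.
Qed.

Lemma tri_linked a c : weak_form a -> uniq c -> cycle_sum a c != 0 ->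
  exists u v w, uniq [:: u; v; w] /\ tri a u v w != 0.
Proof.
move=> wa uc ac; apply: contrapT => none.
have [//|e|] := tri0_cycle_sum wa _ c; last by rewrite uc.
  move=> u v w uu; apply/eqP/negP => t; apply: none; exists u, v, w.
  by split=> //; apply/negP.
by rewrite e in ac.
Qed.

Lemma star_split p (S : pred W) u v w : uniq [:: u; v; w] -> star p S u v w ->
  exists x y, [/\ x != p, y != p & S x != S y].
Proof.
move=> uu /or3P[]/andP[/eqP e s]; subst p.
- by exists v, w; split=> //; distinct.
- by exists w, u; split=> //; distinct.
- by exists u, v; split=> //; distinct.
Qed.

Lemma cycle_sum4 a u v w x : weak_form a -> uniq [:: u; v; w; x] ->
  cycle_sum a [:: u; v; w; x] = tri a u v w + tri a u w x.
Proof. by move=> wa uu; rewrite cycle_sumE//= /tri (wa.1 u w); ring. Qed.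

(** If neither triangle serves for both forms, each form is nonzero on exactly one of the two halves
    of the quadrilateral [u w v x], hence on the quadrilateral. *)
Lemma common_cycle4 a a' u v w x : weak_form a -> weak_form a' ->
    uniq [:: u; v; w; x] -> tri a u v w != 0 -> tri a' u v x != 0 ->
  exists c, [/\ uniq c, (2 < size c)%N, cycle_sum a c != 0 & cycle_sum a' c != 0].
Proof.
move=> wa wa' uu t t'.
have uuvx : uniq [:: u; v; x] by distinct.
have uuvw : uniq [:: u; v; w] by distinct.
have uuwvx : uniq [:: u; w; v; x] by distinct.
have [t0|] := eqVneq (tri a u v x) 0; last first.
  by move=> t1; exists [:: u; v; x]; rewrite !cycle_sum3.
have [t0'|] := eqVneq (tri a' u v w) 0; last first.
  by move=> t1; exists [:: u; v; w]; rewrite !cycle_sum3.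
exists [:: u; w; v; x]; rewrite !cycle_sum4// t0 (tri_swapr wa) (tri_swapr wa') t0'.
by rewrite addr0 !oppr_eq0 oppr0 add0r.
Qed.

(** Two stars always have nonzero triangles on a common edge: the edge between their centers, or,
    when the centers coincide, an edge from the center to a well chosen point. Then [common_cycle4]
    applies, unless one triangle already serves for both. *)
Lemma common_cycle a a' c c' : weak_form a -> weak_form a' ->
    uniq c -> cycle_sum a c != 0 -> uniq c' -> cycle_sum a' c' != 0 ->
  exists d, [/\ uniq d, (2 < size d)%N, cycle_sum a d != 0 & cycle_sum a' d != 0].
Proof.
move=> wa wa' uc ac uc' ac'.
have [u [v [w [uu t]]]] := tri_linked wa uc ac.
have [u' [v' [w' [uu' t']]]] := tri_linked wa' uc' ac'.
have [p [S starS]] := star_form wa u; have [q [S' starS']] := star_form wa' u.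
rewrite starS// in t; rewrite starS'// in t'.
have [i [j [ip jp Sij]]] := star_split uu t.
have [k [l [kq lq Skl]]] := star_split uu' t'.
have triangle x y z : uniq [:: x; y; z] -> star p S x y z -> star q S' x y z ->
    exists d, [/\ uniq d, (2 < size d)%N, cycle_sum a d != 0 & cycle_sum a' d != 0].
  move=> uxyz; rewrite -starS// -starS'// => s s'.
  by exists [:: x; y; z]; split; rewrite // cycle_sum3.
have [e|pq] := eqVneq p q.
  subst q; have ij : i != j by apply: contra_neq Sij => ->.
  have upij : uniq [:: p; i; j] by distinct.
  have [Sij'|Sij'] := boolP (S' i == S' j); last first.
    by apply: (triangle p i j) => //; rewrite /star eqxx ?Sij ?Sij'.
  have [x [xp Six]] : exists x, x != p /\ S' i != S' x.
    have [e|ne] := eqVneq (S' i) (S' k); last by exists k.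
    by exists l; rewrite e.
  have xi : x != i by apply: contra_neq Six => ->.
  have xj : x != j by apply: contra_neq Six => ->; apply/eqP.
  apply: (@common_cycle4 _ _ p i j x wa wa'); first by distinct.
    by rewrite starS// /star eqxx Sij.
  by rewrite starS' /star ?eqxx ?Six//; distinct.
have [x [xp Sx]] : exists x, x != p /\ S q != S x.
  have [e|ne] := eqVneq (S q) (S i); last by exists i.
  by exists j; rewrite e.
have [y [yq Sy]] : exists y, y != q /\ S' p != S' y.
  have [e|ne] := eqVneq (S' p) (S' k); last by exists k.
  by exists l; rewrite e.
have xq : x != q by apply: contra_neq Sx => ->.
have yp : y != p by apply: contra_neq Sy => ->.
have [e|xy] := eqVneq x y.
  subst y; apply: (triangle p q x); first by distinct.
    by rewrite /star eqxx Sx.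
  by rewrite /star eqxx (eq_sym (S' x)) Sy orbT.
apply: (@common_cycle4 _ _ p q x y wa wa'); first by distinct.
  by rewrite starS /star ?eqxx ?Sx//; distinct.
by rewrite starS' /star ?eqxx ?(eq_sym (S' y)) ?Sy ?orbT//; distinct.
Qed.

End CommonCycle.

(** * Integer pairings between the cycles of two complete graphs *)

Section Pairings.
Variables V W : finType.
Implicit Types (B : V -> V -> W -> W -> int).

Definition form_of_cycle B (d : seq W) x y := cycle_sum (B x y) d.

Definition dual_pairing B : W -> W -> V -> V -> int := fun u v x y => B x y u v.

Definition weak_pairing B :=
  [/\ forall x y u v, B y x u v = - B x y u v,
      forall x y u v, B x y v u = - B x y u v &
      forall c d, uniq c -> uniq d -> (2 < size c)%N -> (2 < size d)%N ->
        `|cycle_sum (form_of_cycle B d) c| <= 1].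

Definition linked_triple B x y z := exists d,
  [/\ uniq d, (2 < size d)%N & tri (form_of_cycle B d) x y z != 0].

End Pairings.

Section PairingTheory.
Variables V W : finType.
Variable B : V -> V -> W -> W -> int.
Hypothesis wB : weak_pairing B.

Lemma cycle_sum_dual c d : cycle_sum (form_of_cycle B d) c =
  cycle_sum (form_of_cycle (dual_pairing B) c) d.
Proof. exact: exchange_big. Qed.

Lemma weak_pairing_dual : weak_pairing (dual_pairing B).
Proof.
case: wB => a1 a2 w; split=> [u v x y|u v x y|d c ud uc sd sc].
- exact: a2.
- exact: a1.
- by rewrite -cycle_sum_dual; exact: w.
Qed.

Lemma weak_form_of_cycle d : uniq d -> (2 < size d)%N -> weak_form (form_of_cycle B d).
Proof.
case: wB => a1 _ w ud sd; split=> [x y|c uc sc]; last exact: w.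
by rewrite /form_of_cycle /cycle_sum -sumrN; apply: eq_bigr.
Qed.

Lemma linked_tripleP x y z : uniq [:: x; y; z] -> linked_triple B x y z <->
  exists2 d, uniq d & (2 < size d)%N /\
    cycle_sum (form_of_cycle (dual_pairing B) [:: x; y; z]) d != 0.
Proof.
move=> u; split=> [[d [ud sd t]]|[d ud [sd t]]].
  by exists d => //; rewrite -cycle_sum_dual cycle_sum3.
by exists d; split; rewrite // -cycle_sum3// cycle_sum_dual.
Qed.

(** [common_cycle] is used on the side of [W] and [star_form] on the side of [V], for the cycle
    found. The whole star is linked because that one cycle witnesses it. *)
Lemma linked_triple_pair x y z x' y' z' : uniq [:: x; y; z] -> uniq [:: x'; y'; z'] ->
    linked_triple B x y z -> linked_triple B x' y' z' ->
  exists p (S : pred V), [/\ star p S x y z, star p S x' y' z' &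
    forall i j k, uniq [:: i; j; k] -> star p S i j k -> linked_triple B i j k].
Proof.
move=> u u' /linked_tripleP[//|d ud [sd t]] /linked_tripleP[//|d' ud' [sd' t']].
have wD c : uniq c -> (2 < size c)%N -> weak_form (form_of_cycle (dual_pairing B) c).
  case: (weak_pairing_dual) => a1 _ w uc sc; split=> [k l|e ue se]; last exact: w.
  by rewrite /form_of_cycle /cycle_sum -sumrN; apply: eq_bigr.
have [e [ue se]] := common_cycle (wD _ u isT) (wD _ u' isT) ud t ud' t'.
rewrite -!cycle_sum_dual !cycle_sum3// => s s'.
have [p [S starS]] := star_form (weak_form_of_cycle ue se) x.
exists p, S; split; rewrite -?starS// => i j k ui sijk.
by exists e; split; rewrite // starS.
Qed.

End PairingTheory.

(** * Six vertices or more *)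

Section LinkedTriples.
Variable V : finType.
Variable lk : V -> V -> V -> Prop.
Implicit Types (p q i j k l x y z : V).

Definition common_point := exists p, forall x y z,
  uniq [:: x; y; z] -> lk x y z -> p \in [:: x; y; z].

(** Counting common points expresses sharing an edge (2) and being the same triangle (3) without
    edge sets. *)
Definition special_triple := exists a b c, uniq [:: a; b; c] /\
  forall x y z, uniq [:: x; y; z] -> count (mem [:: a; b; c]) [:: x; y; z] != 3%N ->
    (lk x y z <-> count (mem [:: a; b; c]) [:: x; y; z] == 2%N).

Hypothesis lk_rot : forall x y z, lk x y z -> lk y z x.
Hypothesis lk_swap : forall x y z, lk x y z -> lk y x z.
Hypothesis lk_pair : forall x y z x' y' z',
  uniq [:: x; y; z] -> uniq [:: x'; y'; z'] -> lk x y z -> lk x' y' z' ->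
  exists p (S : pred V), [/\ star p S x y z, star p S x' y' z' &
    forall i j k, uniq [:: i; j; k] -> star p S i j k -> lk i j k].
Hypothesis V6 : (6 <= #|V|)%N.

Let fresh (s : seq V) : (size s < 6)%N -> exists x, x \notin s.
Proof.
move=> s6; apply/existsP; rewrite -negb_forall; apply/negP => /forallP s_all.
have : (#|V| <= size s)%N.
  by rewrite cardT uniq_leq_size ?enum_uniq// => x _; exact: s_all.
by rewrite leqNgt (leq_trans s6 V6).
Qed.

Let star_mem p (S : pred V) x y z : star p S x y z -> p \in [:: x; y; z].
Proof. by move=> /or3P[]/andP[/eqP<- _]; rewrite !inE eqxx ?orbT. Qed.

(** The center of a star containing both triangles would belong to both. *)
Let lk_disjoint x y z x' y' z' :
  uniq [:: x; y; z; x'; y'; z'] -> lk x y z -> lk x' y' z' -> False.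
Proof.
move=> u l l'.
have [||p [S [/star_mem + /star_mem]]] := lk_pair _ _ l l'; try by distinct.
rewrite !inE => /or3P[]/eqP e /or3P[]/eqP e' _; move: u; rewrite -e -e' /= !inE eqxx ?orbT/= ?andbF //.
Qed.

Let lk_mem x y z q : uniq [:: x; y; z] -> lk x y z -> q \in [:: x; y; z] ->
  exists y' z', [/\ uniq [:: q; y'; z'], lk q y' z' &
    [:: q; y'; z'] =i [:: x; y; z]].
Proof.
move=> u l; rewrite !inE => /or3P[]/eqP->.
- by exists y, z.
- exists z, x; split; [by distinct|exact: lk_rot|].
  by move=> v; rewrite !inE orbA orbC.
- exists x, y; split; [by distinct|by do 2!apply: lk_rot|].
  by move=> v; rewrite !inE orbC orbA.
Qed.

Let lk_center c a b a' b' : uniq [:: c; a; b; a'; b'] -> lk c a b -> lk c a' b' ->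
  exists S : pred V, [/\ S a != S b, S a' != S b' &
    forall y z, y != c -> z != c -> S y != S z -> lk c y z].
Proof.
move=> u l l'.
have [||p [S [s s' sub]]] := lk_pair _ _ l l'; try by distinct.
have pc : p = c.
  move: (star_mem s) (star_mem s') u; rewrite !inE => /or3P[]/eqP-> // /or3P[]/eqP-> //;
    by rewrite /= !inE eqxx ?orbT/= ?andbF.
subst p; move: s s'; rewrite /star eqxx /=.
have [ac bc] : a != c /\ b != c by split; distinct.
have [a'c b'c] : a' != c /\ b' != c by split; distinct.
rewrite (negbTE ac) (negbTE bc) (negbTE a'c) (negbTE b'c) !orbF.
move=> s s'; exists S; split=> // y z yc zc syz; apply: sub.
  have yz : y != z by apply: contra_neq syz => ->.
  by distinct.
by rewrite /star eqxx syz.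
Qed.

(** Two points on each side of the split: enough linked triangles at [p] to force those avoiding [p]
    to contain a whole side. *)
Let balanced p (S : pred V) i j k l := [/\ uniq [:: p; i; j; k; l],
  S i = S j, S k = S l, S i != S k &
  forall y z, y != p -> z != p -> S y != S z -> lk p y z].

Let balanced_center c a b a' b' : uniq [:: c; a; b; a'; b'] ->
  lk c a b -> lk c a' b' -> exists S i j k l, balanced c S i j k l.
Proof.
move=> u lab lab'; have [S [sab sab' sub]] := lk_center u lab lab'.
have [e|ne] := eqVneq (S a) (S a').
  exists S, a, a', b, b'; split=> //; first by distinct.
  by move: sab sab'; rewrite -e; case: (S a) (S b) (S b') => [] [] [].
exists S, a, b', b, a'; split=> //; first by distinct.
  by move: ne sab'; case: (S a) (S a') (S b') => [] [] [].
by move: ne sab; case: (S a) (S a') (S b) => [] [] [].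
Qed.

Hypothesis no_common : ~ common_point.

Let avoid p : exists x y z, [/\ uniq [:: x; y; z], lk x y z & p \notin [:: x; y; z]].
Proof.
apply: contrapT => none; apply: no_common; exists p => x y z u l.
by apply/negPn/negP => pn; apply: none; exists x, y, z.
Qed.

(** If one side of the split at [p] is a single point [q], all triangles on the edge [p q] are
    linked. A linked triangle avoiding [p] must then contain [q], and it meets some triangle [q p w]
    in [q] only, which makes [q] a balanced center. *)
Let balanced_exists : exists p S i j k l, balanced p S i j k l.
Proof.
have edge p q : p != q -> (forall x, x != p -> x != q -> lk p q x) ->
    exists p S i j k l, balanced p S i j k l.
  move=> pq full; have [x [y [z [u l pn]]]] := avoid p.
  have qU : q \in [:: x; y; z].
    apply/negPn/negP => qn; have [//|w wn] := fresh (s := [:: p; q; x; y; z]).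
    by apply: (lk_disjoint _ l (full w _ _)); distinct.
  have [b [c [uqbc lqbc e]]] := lk_mem u l qU.
  have pn' : p \notin [:: q; b; c] by rewrite e.
  have [//|w wn] := fresh (s := [:: p; q; b; c]).
  exists q; apply: (@balanced_center q b c p w) => //; first by distinct.
  by apply: lk_swap; apply: full; distinct.
have [x [_ [_ [_ _ _]]]] : exists x y z : V, [/\ True, True & True].
  by have [//|x _] := fresh (s := [::]); exists x, x, x.
have [a [b [c [u l _]]]] := avoid x.
have [p [S [s _ sub]]] := lk_pair u u l l.
have [i [k [ip kp sik]]] := star_split u s.
have full y z : y != p -> z != p -> S y != S z -> lk p y z.
  move=> yp zp syz; apply: sub; last by rewrite /star eqxx syz.
  have yz : y != z by apply: contra_neq syz => ->.
  by distinct.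
have single i' k' : i' != p -> S i' != S k' ->
    (forall j, j != p -> S j = S i' -> j = i') ->
    exists p S i j k l, balanced p S i j k l.
  move=> ip' sik' one; apply: (edge p i'); first by rewrite eq_sym.
  move=> y yp yi; apply: full => //; apply: contra_neq yi => e.
  by apply: one.
have [[j [jp ji sj]]|none] := pselect (exists j, [/\ j != p, j != i & S j = S i]).
  have [[m [mp mk sm]]|none] := pselect (exists m, [/\ m != p, m != k & S m = S k]).
    exists p, S, i, j, k, m; split=> //.
    have ne y z : S y != S z -> y != z by apply: contra_neq => ->.
    have := ne _ _ sik; have := ne i m; have := ne j k; have := ne j m.
    rewrite sj sm => /(_ sik) ? /(_ sik) ? /(_ sik) ? ?.
    by distinct.
  apply: (single k i) => //; first by rewrite eq_sym.
  move=> m mp sm; apply: contrapT => /eqP mk; apply: none.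
  by exists m.
apply: (single i k) => // j jp sj; apply: contrapT => /eqP ji; apply: none.
by exists j.
Qed.

(** The side of [i] turns out to be exactly [i] and [j], so that [p i x] and [p j x] are linked for
    all other [x]. Taking [i] as a center adds the triangles [i j x], and [p i j] is the special
    triangle. *)
Let special_of_balanced p (S : pred V) i j k l z : balanced p S i j k l ->
    uniq [:: p; i; j; z] -> lk i j z ->
    (forall s, s != p -> S s = S i -> s \in [:: i; j; z]) -> special_triple.
Proof.
move=> [u sij skl sik full] uz lz sub.
have ne y w : S y != S w -> y != w by apply: contra_neq => ->.
(* If [z] were on the side of [i] and [j], the star centered at [i] would contain a triangle
   disjoint from [p j k] or from [p z k]. *)
have [sz|sz] := eqVneq (S z) (S i).
  have zk : z != k by apply: ne; rewrite sz.
  have zl : z != l by apply: ne; rewrite sz -skl.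
  have lik : lk i p k by apply: lk_swap; apply: full => //; distinct.
  have [|S' [sjz _ full']] := @lk_center i j z p k _ lz lik; first by distinct.
  exfalso; have [e|ne'] := eqVneq (S' l) (S' j).
    have l1 : lk i l z by apply: full'; rewrite ?e//; distinct.
    have l2 : lk p j k by apply: full; rewrite -?sij//; distinct.
    by apply: (lk_disjoint _ l1 l2); distinct.
  have l1 : lk i l j by apply: full' => //; distinct.
  have l2 : lk p z k by apply: full; rewrite ?sz//; distinct.
  by apply: (lk_disjoint _ l1 l2); distinct.
have out x : x \notin [:: p; i; j] -> S x != S i.
  move=> xn; apply: contraNneq sz => e; have := sub x _ e.
  rewrite !inE => h; have : x != p by distinct.
  move/h; case/or3P => /eqP e'; subst x; rewrite ?e//; exfalso.
    by move: xn; rewrite !inE eqxx orbT.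
  by move: xn; rewrite !inE eqxx !orbT.
have li x : x \notin [:: p; i; j] -> lk p i x.
  by move=> xn; apply: full; rewrite 1?eq_sym ?out//; distinct.
have lj x : x \notin [:: p; i; j] -> lk p j x.
  by move=> xn; apply: full; rewrite 1?eq_sym -?sij ?out//; distinct.
have [//|x xn] := fresh (s := [:: p; i; j; z]).
have [//|y yn] := fresh (s := [:: p; i; j; z; x]).
have lix : lk i p x by apply: lk_swap; apply: li; distinct.
(* The linked triangles [i j z] and [i p x] meet in [i] only. In the split they give, every point
   outside [p], [i], [j] must be opposite to [j]. *)
have [|S' [sjz spx full']] := @lk_center i j z p x _ lz lix; first by distinct.
have sjp : S' j = S' p.
  apply/eqP/negPn/negP => sjp.
  have l1 : lk i x z.
    apply: full'; try by distinct.
    by move: sjp spx sjz; case: (S' j) (S' p) (S' x) (S' z) => [] [] [] [].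
  have l2 : lk p j y by apply: lj; distinct.
  by apply: (lk_disjoint _ l1 l2); distinct.
have sxz : S' x = S' z.
  by move: sjp spx sjz; case: (S' j) (S' p) (S' x) (S' z) => [] [] [] [].
have opp w : w \notin [:: p; i; j] -> S' w != S' j.
  move=> wn; have [->|wx] := eqVneq w x; first by rewrite sjp eq_sym.
  have [->|wz] := eqVneq w z; first by rewrite eq_sym.
  apply/negP => /eqP e.
  have l1 : lk i w z by apply: full'; rewrite ?e//; distinct.
  have l2 : lk p j x by apply: lj; distinct.
  by apply: (lk_disjoint _ l1 l2); distinct.
have lij w : w \notin [:: p; i; j] -> lk i j w.
  by move=> wn; apply: full'; rewrite 1?eq_sym ?opp//; distinct.
exists p, i, j; split; first by distinct.
set T := [:: p; i; j].
have two v w y' : uniq [:: v; w; y'] -> v \in T -> w \in T -> y' \notin T -> lk v w y'.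
  move=> uv vT wT yT; have vw : v != w by distinct.
  move: vT wT vw; rewrite /T !inE => /or3P[]/eqP-> /or3P[]/eqP->;
    rewrite ?eqxx// => _; first [exact: li|exact: lj|exact: lij|apply: lk_swap];
    first [exact: li|exact: lj|exact: lij].
(* The side of [T] opposite to [v], with a sixth point, spans a disjoint linked triangle. *)
have one v w y' : uniq [:: v; w; y'] -> v \in T -> w \notin T -> y' \notin T ->
    ~ lk v w y'.
  move=> uv vT wT yT hl; have [//|t tn] := fresh (s := [:: p; i; j; w; y']).
  have tT : t \notin T by rewrite /T; distinct.
  move: (hl) vT; rewrite /T !inE => _ /or3P[]/eqP e; subst v.
  - by apply: (lk_disjoint _ hl (lij t tT)); distinct.
  - by apply: (lk_disjoint _ hl (lj t tT)); distinct.
  - by apply: (lk_disjoint _ hl (li t tT)); distinct.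
have none v w y' : uniq [:: v; w; y'] -> v \notin T -> w \notin T -> y' \notin T ->
    ~ lk v w y'.
  move=> uv vT wT yT hl.
  (* With six points the complement of [T] may be just this triangle, so every triangle on an edge
     of [T] meets it. The star at [v] instead yields a linked triangle with only [p] in [T]. *)
  have lv : lk v p i by do 2!apply: lk_rot; exact: li.
  have [|S'' [swy spi sub'']] := @lk_center v w y' p i _ hl lv; first by distinct.
  have pT : p \in T by rewrite inE eqxx.
  have [up up'] : uniq [:: p; v; y'] /\ uniq [:: p; v; w].
    by move: vT wT yT; rewrite /T => vT wT yT; split; distinct.
  have [vp [wv yv]] : p != v /\ w != v /\ y' != v by do ?split; distinct.
  have [e|ne'] := eqVneq (S'' p) (S'' w).
    by apply: (one p v y') => //; apply: lk_swap; apply: sub''; rewrite ?e.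
  by apply: (one p v w) => //; apply: lk_swap; apply: sub''.
move=> a b c uabc; rewrite /= -!/(mem T _) !addn0.
have rot' x' y' z' : lk x' y' z' -> lk z' x' y' by move=> ?; do 2!apply: lk_rot.
have [aT|aT] := boolP (a \in T); have [bT|bT] := boolP (b \in T);
  have [cT|cT] := boolP (c \in T) => //= _; split=> // hl.
- exact: two.
- by apply: lk_rot; apply: two => //; distinct.
- by case: (one a b c).
- by apply: rot'; apply: two => //; distinct.
- by case: (one b c a) => //; [distinct|exact: lk_rot].
- by case: (one c a b) => //; [distinct|exact: rot'].
- by case: (none a b c).
Qed.

(** A linked triangle avoiding the balanced center meets every linked triangle through it, hence
    contains one of the two sides; the sides play symmetric roles. *)
Lemma linked_triples_special : special_triple.
Proof.
have [p [S [i [j [k [l bal]]]]]] := balanced_exists.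
have [u sij skl sik full] := bal.
have [x [y [z [ux lx pn]]]] := avoid p.
have side q r : S q != S r -> (forall s, s != p -> S s = S q -> s \in [:: x; y; z]) \/
    (forall s, s != p -> S s = S r -> s \in [:: x; y; z]).
  move=> qr; apply: contrapT => /not_orP[/existsNP[s /not_implyP[sp /not_implyP[sq sn]]]].
  move=> /existsNP[t /not_implyP[tp /not_implyP[tr tn]]].
  have st : S s != S t by rewrite sq tr.
  have st' : s != t by apply: contra_neq st => ->.
  move/negP in sn; move/negP in tn.
  by apply: (lk_disjoint _ lx (full s t sp tp st)); distinct.
have third i' j' : i' != j' -> i' \in [:: x; y; z] -> j' \in [:: x; y; z] ->
    exists z', [/\ uniq [:: p; i'; j'; z'], lk i' j' z' & [:: i'; j'; z'] =i [:: x; y; z]].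
  move=> ij' iU jU; have [b [c [ub lb e]]] := lk_mem ux lx iU.
  have pn' : p \notin [:: i'; b; c] by rewrite e.
  have : j' \in [:: i'; b; c] by rewrite e.
  rewrite !inE eq_sym (negbTE ij') /= => /orP[]/eqP ->.
    by exists c; split=> //; distinct.
  exists b; split; [by distinct|by apply: lk_swap; do 2!apply: lk_rot|].
  by move=> v; rewrite -e !inE; case: (v == i') (v == b) (v == c) => [] [] [].
have [sub|sub] := side i k sik.
  have [||| z' [uz lz e]] := third i j; [by distinct|by apply: sub; distinct| |].
    by apply: sub; rewrite -?sij//; distinct.
  by apply: (special_of_balanced bal uz lz) => s sp sS; rewrite e; exact: sub.
have bal' : balanced p S k l i j by split; rewrite // 1?eq_sym//; distinct.
have [||| z' [uz lz e]] := third k l; [by distinct|by apply: sub; distinct| |].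
  by apply: sub; rewrite -?skl//; distinct.
by apply: (special_of_balanced bal' uz lz) => s sp sS; rewrite e; exact: sub.
Qed.

End LinkedTriples.

(** * Five vertices *)

(* A mod 2 cocycle on the triples of five points is determined by its values on
   the triples 012, 013, 014, 023, 024, 034 through the point 0, which make up
   its code. *)
Definition base_triples : seq (nat * nat * nat) :=
  [:: (0, 1, 2); (0, 1, 3); (0, 1, 4); (0, 2, 3); (0, 2, 4); (0, 3, 4)]%N.

Definition triples5 : seq (nat * nat * nat) :=
  base_triples ++ [:: (1, 2, 3); (1, 2, 4); (1, 3, 4); (2, 3, 4)]%N.

Definition nat_star (p : nat) (s : nat -> bool) (x y z : nat) :=
  [|| (x == p) && (s y != s z), (y == p) && (s z != s x)
    | (z == p) && (s x != s y)].

Definition code_of (f : nat -> nat -> nat -> bool) : bitseq :=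
  [seq f t.1.1 t.1.2 t.2 | t <- base_triples].

(** The last four bits come from the cocycle condition on the tetrahedra through the point 0. *)
Definition values (c : bitseq) : bitseq :=
  if c is [:: b012; b013; b014; b023; b024; b034] then
    c ++ [:: b012 (+) b013 (+) b023; b012 (+) b014 (+) b024;
             b013 (+) b014 (+) b034; b023 (+) b024 (+) b034]
  else [::].

Fixpoint addc (c d : bitseq) : bitseq :=
  match c, d with a :: c', b :: d' => addb a b :: addc c' d' | _, _ => [::] end.

Definition orc (c d : bitseq) : bitseq := [seq e.1 || e.2 | e <- zip c d].

Definition all_bits n : seq bitseq :=
  iter n (fun l => map (cons true) l ++ map (cons false) l) [:: [::]].

(** There are 26 of them among the 64 codes: zero, 10 for the edges (splits that isolate a point)
    and 15 for the splits two against two. *)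
Definition star_codes : seq bitseq := Eval vm_compute in
  undup [seq code_of (nat_star p (nth false s)) | p <- iota 0 5, s <- all_bits 5].

Definition in_triple (p : nat) (t : nat * nat * nat) :=
  [|| p == t.1.1, p == t.1.2 | p == t.2].

Definition triple_meet (t s : nat * nat * nat) :=
  (in_triple t.1.1 s + in_triple t.1.2 s + in_triple t.2 s)%N.

Definition code_through p (c : bitseq) :=
  all (fun e => e.1 ==> in_triple p e.2) (zip (values c) triples5).

Definition special_values (v : bitseq) s :=
  all (fun e => (triple_meet e.2 s == 3) || (e.1 == (triple_meet e.2 s == 2)))
    (zip v triples5).

(* Decision trees, for fast evaluation of predicates on codes. *)
Inductive dtree := Leaf of bool | Node of dtree & dtree.

Fixpoint eval_dtree t (c : bitseq) : bool :=
  match t, c with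
  | Leaf b, _ => b
  | Node t1 t2, b :: c' => if b then eval_dtree t1 c' else eval_dtree t2 c'
  | _, _ => false
  end.

Fixpoint mk_dtree n (P : bitseq -> bool) (pre : bitseq) : dtree :=
  if n is n'.+1 then
    Node (mk_dtree n' P (rcons pre true)) (mk_dtree n' P (rcons pre false))
  else Leaf (P pre).

Definition star_tree := Eval vm_compute in mk_dtree 6 (mem star_codes) [::].
Definition through_trees := Eval vm_compute in
  [seq mk_dtree 6 (code_through p) [::] | p <- iota 0 5].

Definition compatible (x : bitseq) := all (fun s => eval_dtree star_tree (addc s x)).

(** Conditionals rather than boolean connectives, here and in the searches, because evaluation by
    value would compute both arguments of a connective. *)
Definition structured_codes (l : seq bitseq) :=
  if has (fun t => all (eval_dtree t) l) through_trees then true else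
  has (special_values (foldr orc (nseq 10 false) (map values l))) triples5.

(* The arguments are the codes of the triangles 012, 013, 023, 014, 024, 034 of
   a complete graph on five vertices. *)
Definition search5 a :=
  all (fun b => if ~~ compatible b [:: a] then true else let ab := addc a b in
  all (fun c => if ~~ compatible c [:: ab; a; b] then true else
    let ac := addc a c in let bc := addc b c in
  all (fun d => if ~~ compatible d [:: a; b; bc; ac] then true else
    let ad := addc a d in let bd := addc b d in let cd := addc c d in
    let acd := addc a cd in
  all (fun e => if ~~ compatible e [:: ad; a; d; c; addc b cd; bc; cd; bd; ab]
    then true else
    let s := [:: b; d; c; e; bd; addc c e; acd; addc ab e; ac; addc a e; addc b e;
      cd; ab; ad] in
  all (fun f => if ~~ compatible f s then true else
    structured_codes [:: a; b; c; d; e; f; addc ab c; addc ad e;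
      addc b (addc d f); addc c (addc e f)])
  star_codes) star_codes) star_codes) star_codes) star_codes.

(** Any compatible family containing [acc] then covers exactly the triples meeting [s] in two
    points, apart from [s] itself. *)
Definition special_within s (acc : seq bitseq) :=
  all (fun e => (triple_meet e.2 s == 2) ==> e.1)
    (zip (foldr orc (nseq 10 false) (map values acc)) triples5)
  && all (fun c => if ~~ compatible c acc then true else
       all (fun e => e.1 ==> (2 <= triple_meet e.2 s)%N) (zip (values c) triples5))
     star_codes.

(* Extends acc by codes avoiding each of the points in turn, until it has no
   point in common; then it must determine the special triple. *)
Fixpoint clique_search (ts : seq dtree) (acc : seq bitseq) : bool :=
  if ts is t :: ts' then
    if all (eval_dtree t) acc then
      all (fun c => if eval_dtree t c || ~~ compatible c acc then true
        else clique_search ts' (c :: acc)) star_codes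
    else clique_search ts' acc
  else has (special_within^~ acc) triples5.

Lemma clique_search_cons t ts acc : clique_search (t :: ts) acc =
  if all (eval_dtree t) acc then
    all (fun c => if eval_dtree t c || ~~ compatible c acc then true
      else clique_search ts (c :: acc)) star_codes
  else clique_search ts acc.
Proof. by []. Qed.

Lemma clique_searchT : clique_search through_trees [::].
Proof. by vm_cast_no_check (erefl true). Qed.

(** Up to relabelling five points, these are the only nonzero stars: the triples on the edge 01, and
    the star at 0 separating 1, 2 from 3, 4. *)
Lemma search5T : search5 [:: true; true; true; false; false; false]
  && search5 [:: false; true; true; true; true; false].
Proof. by vm_cast_no_check (erefl true). Qed.

Lemma eval_star_tree c : c \in star_codes -> eval_dtree star_tree c.
Proof. by apply/allP: c; vm_compute. Qed.

Lemma eval_through p c : (p < 5)%N -> c \in star_codes ->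
  eval_dtree (nth (Leaf true) through_trees p) c = code_through p c.
Proof.
move=> p5 cs; apply/eqP.
have /allP/(_ p) : all (fun p => all (fun c =>
  eval_dtree (nth (Leaf true) through_trees p) c == code_through p c) star_codes)
  (iota 0 5) by vm_compute.
by rewrite mem_iota p5 => /(_ isT)/allP; apply.
Qed.

(** If no point is common, a few codes of the family, each avoiding a prescribed point, already
    determine the special triple for the whole family. *)
Lemma clique_structured (A : bitseq -> Prop) :
    (forall c, A c -> c \in star_codes) ->
    (forall c d, A c -> A d -> addc c d \in star_codes) ->
  (exists2 p, (p < 5)%N & forall c, A c -> code_through p c) \/
  exists2 s, s \in triples5 & forall i, (i < 10)%N ->
    let t := nth (0, 0, 0)%N triples5 i in triple_meet t s != 3 ->
    ((exists2 c, A c & nth false (values c) i) <-> triple_meet t s == 2).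
Proof.
move=> As Ac.
have [|none] := pselect (exists2 p, (p < 5)%N & forall c, A c -> code_through p c).
  by left.
have miss p : (p < 5)%N -> exists2 c, A c & ~~ code_through p c.
  move=> p5; apply: contrapT => no; apply: none; exists p => // c cA.
  by apply/negPn/negP => cp; apply: no; exists c.
right.
(* Follows the branch of the search along which every code added belongs to [A]. *)
have find (ts : seq dtree) (acc : seq bitseq) :
    (forall k, (k < size ts)%N ->
       exists2 c, A c & ~~ eval_dtree (nth (Leaf true) ts k) c) ->
    (forall c, c \in acc -> A c) -> clique_search ts acc ->
    exists acc', (forall c, c \in acc' -> A c) /\ has (special_within^~ acc') triples5.
  elim: ts acc => [|t ts IHts] acc tsA accA; first by exists acc.
  have tsA' k : (k < size ts)%N -> exists2 c, A c & ~~ eval_dtree (nth (Leaf true) ts k) c.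
    exact: (tsA k.+1).
  rewrite clique_search_cons; case: ifP => _; last exact: IHts.
  have [c cA ct] := tsA 0%N isT; rewrite [nth _ _ _]/= in ct; move/allP => h; have := h c (As _ cA).
  have comp : compatible c acc.
    by apply/allP => d /accA dA; apply: eval_star_tree; exact: Ac.
  rewrite (negbTE ct) comp /=; apply: IHts => //.
  by move=> d; rewrite inE => /predU1P[->|/accA].
have [|//|acc [accA /hasP[s s3 /andP[/allP cover /allP within]]]] :=
    find through_trees [::] _ _ clique_searchT.
  by move=> p p5; have [c cA cp] := miss p p5; exists c; rewrite // eval_through// As.
have vsize c : c \in star_codes -> size (values c) = 10%N.
  move=> cs; apply/eqP; have /allP : all (fun c => size (values c) == 10%N) star_codes.
    by vm_compute.
  by apply.
exists s => // i i10 t meet3.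
have tn c : size c = 10%N -> nth (false, (0, 0, 0)%N) (zip c triples5) i = (nth false c i, t).
  by move=> c10; rewrite nth_zip// c10.
split=> [[c cA ci]|meet2].
  have := within c (As _ cA).
  have -> : compatible c acc.
    by apply/allP => d /accA dA; apply: eval_star_tree; exact: Ac.
  move=> /= /allP/(_ (nth false (values c) i, t)).
  rewrite -tn ?vsize ?As// mem_nth ?size_zip ?vsize ?As// tn ?vsize ?As//= ci.
  move=> /(_ isT)/= m2.
  have m4 : (triple_meet t s <= 3)%N.
    rewrite /triple_meet; case: (in_triple _ s) (in_triple _ s) (in_triple _ s) => [] [] [] //.
  by move: m2 m4 meet3; case: (triple_meet t s) => [|[|[|[|m]]]].
have union_size l : (forall c, c \in l -> A c) ->
    size (foldr orc (nseq 10 false) (map values l)) = 10%N.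
  elim: l => //= c l IHl lA; have cA : A c by apply: lA; rewrite mem_head.
  have lA' d : d \in l -> A d by move=> dl; apply: lA; rewrite inE dl orbT.
  by rewrite size_map size_zip IHl// vsize//; exact: As.
have := cover (nth false (foldr orc (nseq 10 false) (map values acc)) i, t).
rewrite -tn ?union_size// mem_nth ?size_zip ?union_size// tn ?union_size//= meet2.
move=> /(_ isT)/=; clear cover within.
elim: acc accA => [|c l IHl] lA.
  by rewrite -[foldr _ _ _]/(nseq 10 false) nth_nseq if_same.
rewrite [foldr _ _ _]/=.
have cA : A c by apply: lA; rewrite mem_head.
have lA' d : d \in l -> A d by move=> dl; apply: lA; rewrite inE dl orbT.
have [c10 l10] := (vsize _ (As _ cA), union_size _ lA').
rewrite (nth_map (false, false)) ?size_zip ?c10 ?l10//.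
rewrite nth_zip ?c10 ?l10//= => /orP[ci|h]; last exact: IHl lA' h.
by exists c.
Qed.

Lemma structured_codesP l : (forall c, c \in l -> c \in star_codes) ->
    structured_codes l ->
  (exists2 p, (p < 5)%N & forall c, c \in l -> code_through p c) \/
  exists2 s, s \in triples5 & forall i, (i < 10)%N ->
    let t := nth (0, 0, 0)%N triples5 i in triple_meet t s != 3 ->
    ((exists2 c, c \in l & nth false (values c) i) <-> triple_meet t s == 2).
Proof.
move=> ls; rewrite /structured_codes.
have vsize c : c \in star_codes -> size (values c) = 10%N.
  move=> cs; apply/eqP; have /allP : all (fun c => size (values c) == 10%N) star_codes.
    by vm_compute.
  by apply.
have [/(has_nthP (Leaf true))[p p5 /allP h] _|_ /hasP[s s3 /allP h]] :=
    boolP (has (fun t => all (eval_dtree t) l) through_trees).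
  by left; exists p => // c cl; rewrite -eval_through ?ls//; exact: h.
right; exists s; first exact: s3.
move=> i i10; set t := nth _ triples5 i => meet3.
have union_spec l' : (forall c, c \in l' -> c \in star_codes) ->
    size (foldr orc (nseq 10 false) (map values l')) = 10%N /\
    (nth false (foldr orc (nseq 10 false) (map values l')) i <->
     exists2 c, c \in l' & nth false (values c) i).
  elim: l' => [_|c l' IHl l's].
    split=> //; rewrite -[foldr _ _ _]/(nseq 10 false) nth_nseq if_same.
    by split=> // -[].
  have [|sz IH] := IHl; first by move=> d dl; apply: l's; rewrite inE dl orbT.
  have c10 := vsize _ (l's _ (mem_head _ _)).
  rewrite [foldr _ _ _]/=; split; first by rewrite size_map size_zip c10 sz.
  rewrite (nth_map (false, false)) ?size_zip ?c10 ?sz// nth_zip ?c10 ?sz//=.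
  split=> [/orP[ci|/IH[d dl di]]|[d]].
  - by exists c; rewrite ?mem_head.
  - by exists d; rewrite // inE dl orbT.
  - rewrite inE => /predU1P[->->//|dl di]; apply/orP; right; apply/IH.
    by exists d.
have [sz eqv] := union_spec l ls.
have tn : nth (false, (0, 0, 0)%N)
    (zip (foldr orc (nseq 10 false) (map values l)) triples5) i =
    (nth false (foldr orc (nseq 10 false) (map values l)) i, t).
  by rewrite nth_zip// sz.
have := h (nth false (foldr orc (nseq 10 false) (map values l)) i, t).
rewrite -tn mem_nth ?size_zip ?sz// tn => /(_ isT).
rewrite [X in is_true X -> _]/= (negbTE meet3) orFb => /eqP <-.
by split=> h'; apply/eqv.
Qed.

Lemma search5P a b c d e f : search5 a ->
    b \in star_codes -> c \in star_codes -> d \in star_codes ->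
    e \in star_codes -> f \in star_codes ->
    compatible b [:: a] -> compatible c [:: addc a b; a; b] ->
    compatible d [:: a; b; addc b c; addc a c] ->
    compatible e [:: addc a d; a; d; c; addc b (addc c d); addc b c; addc c d;
      addc b d; addc a b] ->
    compatible f [:: b; d; c; e; addc b d; addc c e; addc a (addc c d);
      addc (addc a b) e; addc a c; addc a e; addc b e; addc c d; addc a b; addc a d] ->
  structured_codes [:: a; b; c; d; e; f; addc (addc a b) c; addc (addc a d) e;
    addc b (addc d f); addc c (addc e f)].
Proof.
move=> sa bs cs ds es fs hb hc hd he hf.
move: sa; rewrite /search5 => /allP/(_ b bs); rewrite hb.
move=> /allP/(_ c cs); rewrite hc => /allP/(_ d ds); rewrite hd.
by move=> /allP/(_ e es); rewrite he => /allP/(_ f fs); rewrite hf.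
Qed.
Lemma perm_triple_ind (T : eqType) (P : T -> T -> T -> Prop) :
    (forall x y z, P x y z -> P y z x) -> (forall x y z, P x y z -> P y x z) ->
  forall x y z x' y' z', perm_eq [:: x; y; z] [:: x'; y'; z'] -> P x y z -> P x' y' z'.
Proof.
move=> rot swap x y z x' y' z'.
have pair (a b c d : T) : perm_eq [:: a; b] [:: c; d] ->
    (a = c /\ b = d) \/ (a = d /\ b = c).
  move=> e; have := perm_mem e a; rewrite !inE eqxx => /esym/orP[]/eqP ac.
    left; split=> //; move: e; rewrite ac perm_cons => /perm_mem/(_ b).
    by rewrite !inE eqxx => /esym/eqP.
  right; split=> //; rewrite ac in e.
  have := perm_trans e (permEl (perm_catC [:: c] [:: d])).
  by rewrite /= perm_cons => /perm_mem/(_ b); rewrite !inE eqxx => /esym/eqP.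
have head (a b c d f : T) : perm_eq [:: a; b; c] [:: a; d; f] ->
    P a b c -> P a d f.
  rewrite perm_cons => /pair[[-> ->]//|[-> ->] l].
  by apply: rot; apply: swap.
move=> e; have := perm_mem e x'; rewrite !inE eqxx => /or3P[]/eqP xE; subst x'.
- exact: head.
- move/rot; apply: head.
  by apply: perm_trans e; rewrite (perm_catC [:: _; _] [:: _]).
- move/rot/rot; apply: head.
  by apply: perm_trans e; rewrite (perm_catC [:: _] [:: _; _]).
Qed.

(** * From pairings on five points to codes *)

Section FivePoints.
Variables (V W : finType) (B : V -> V -> W -> W -> int).
Hypothesis wB : weak_pairing B.
Variable v : nat -> V.
Hypothesis v_inj : forall i j, (i < 5)%N -> (j < 5)%N -> v i = v j -> i = j.
Hypothesis v_surj : forall x, exists2 i, (i < 5)%N & x = v i.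

(** Sums over pairs of cycles are at most 1 in absolute value, so their parity still tells whether
    they vanish. *)
Definition parity (n : int) := odd `|n|%N.

Lemma parityD m n : parity (m + n) = parity m (+) parity n.
Proof. by rewrite /parity; lia. Qed.

Lemma parityN m : parity (- m) = parity m.
Proof. by rewrite /parity; lia. Qed.

Lemma parity_small m : `|m| <= 1 -> parity m = (m != 0).
Proof. by rewrite /parity; lia. Qed.

Definition triple_form i j k := form_of_cycle (dual_pairing B) [:: v i; v j; v k].

Definition cycle_code (d : seq W) :=
  code_of (fun i j k => parity (cycle_sum (triple_form i j k) d)).

Definition tri_code (u w x : W) :=
  code_of (fun i j k => parity (tri (triple_form i j k) u w x)).

Lemma eq_code f g : {in base_triples, forall t, f t.1.1 t.1.2 t.2 = g t.1.1 t.1.2 t.2} ->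
  code_of f = code_of g.
Proof. by move=> fg; apply/eq_in_map. Qed.

Lemma triple5P t : t \in triples5 ->
  [/\ (t.1.1 < 5)%N, (t.1.2 < 5)%N, (t.2 < 5)%N & uniq [:: v t.1.1; v t.1.2; v t.2]].
Proof.
move=> tt; have : [&& t.1.1 < 5, t.1.2 < 5, t.2 < 5 & uniq [:: t.1.1; t.1.2; t.2]]%N.
  by move: t tt; apply/allP.
move=> /and4P[t1 t2 t3]; rewrite /= !inE !negb_or => u.
have ne i j : (i < 5)%N -> (j < 5)%N -> i != j -> v i != v j.
  by move=> i5 j5; apply: contra_neq; exact: v_inj.
by move: u; rewrite !andbT => /andP[/andP[? ?] ?]; split=> //; rewrite !ne.
Qed.

Lemma base_triples_sub : {subset base_triples <= triples5}.
Proof. by apply/allP. Qed.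

Lemma weak_triple_form t : t \in triples5 -> weak_form (triple_form t.1.1 t.1.2 t.2).
Proof.
by move=> /triple5P[_ _ _ u]; apply: weak_form_of_cycle u isT; exact: weak_pairing_dual.
Qed.

Lemma tri_code_cycle u w x : uniq [:: u; w; x] -> tri_code u w x = cycle_code [:: u; w; x].
Proof. by move=> uu; apply: eq_code => t _; rewrite cycle_sum3. Qed.

Lemma tri_code_swap u w x : tri_code w u x = tri_code u w x.
Proof.
by apply: eq_code => t /base_triples_sub/weak_triple_form wt; rewrite tri_swap// parityN.
Qed.

Lemma tri_code_swapr u w x : tri_code u x w = tri_code u w x.
Proof.
by apply: eq_code => t /base_triples_sub/weak_triple_form wt; rewrite tri_swapr// parityN.
Qed.

Lemma tri_code_cocycle p u w x :
  tri_code u w x = addc (addc (tri_code p u w) (tri_code p w x)) (tri_code p u x).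
Proof.
transitivity (code_of (fun i j k => parity (tri (triple_form i j k) p u w) (+)
    parity (tri (triple_form i j k) p w x) (+) parity (tri (triple_form i j k) p u x)));
  last by [].
apply: eq_code => t /base_triples_sub/weak_triple_form wt.
by rewrite (tri_cocycle wt p u w x) 2!parityD (tri_swapr wt p u x) parityN.
Qed.

Lemma cycle_code4 u w x y : uniq [:: u; w; x; y] ->
  addc (tri_code u w x) (tri_code u x y) = cycle_code [:: u; w; x; y].
Proof.
move=> uu; transitivity (code_of (fun i j k => parity (tri (triple_form i j k) u w x) (+)
    parity (tri (triple_form i j k) u x y))); first by [].
apply: eq_code => t /base_triples_sub/weak_triple_form wt.
by rewrite cycle_sum4// parityD.
Qed.

Lemma cycle_code5 u w x y z : uniq [:: u; w; x; y; z] ->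
  addc (addc (tri_code u w x) (tri_code u x y)) (tri_code u y z) =
  cycle_code [:: u; w; x; y; z].
Proof.
move=> uu; transitivity (code_of (fun i j k => parity (tri (triple_form i j k) u w x) (+)
    parity (tri (triple_form i j k) u x y) (+) parity (tri (triple_form i j k) u y z)));
  first by [].
apply: eq_code => t /base_triples_sub/weak_triple_form wt.
rewrite -!parityD cycle_sumE//= /tri (wt.1 u x) (wt.1 u y).
by congr parity; ring.
Qed.

Lemma cycle_code_star d : uniq d -> (2 < size d)%N -> cycle_code d \in star_codes.
Proof.
move=> ud sd; have [p [S starS]] := star_form (weak_form_of_cycle wB ud sd) (v 0).
have [q q5 pq] := v_surj p.
pose s := [seq S (v i) | i <- iota 0 5].
have -> : cycle_code d = code_of (nat_star q (nth false s)).
  apply: eq_code => t /base_triples_sub tt.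
  have [t1 t2 t3 ut] := triple5P tt.
  have wt := weak_triple_form tt.
  rewrite parity_small; last by case: wt => _; apply.
  rewrite /triple_form -cycle_sum_dual cycle_sum3// starS// /star /nat_star pq.
  have veq i : (i < 5)%N -> (v i == v q) = (i == q).
    by move=> i5; apply/eqP/eqP => [|->//]; exact: v_inj.
  have nthS i : (i < 5)%N -> nth false s i = S (v i).
    by move=> i5; rewrite (nth_map 0%N) ?size_iota// nth_iota.
  by rewrite !veq// !nthS.
have /allP/(_ q) : all (fun p => all (fun s => code_of (nat_star p (nth false s))
    \in star_codes) (all_bits 5)) (iota 0 5) by vm_compute.
rewrite mem_iota q5 => /(_ isT)/allP; apply.
by rewrite /s /=; case: (S _) (S _) (S _) (S _) (S _) => [] [] [] [] [].
Qed.

Lemma tri_code_star u w x : uniq [:: u; w; x] -> tri_code u w x \in star_codes.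
Proof. by move=> uu; rewrite tri_code_cycle// cycle_code_star. Qed.

(** Summing over a triangle of [W] leaves an antisymmetric form on [V], whose triangles satisfy the
    cocycle condition built into [values]. *)
Lemma tri_code_values u w x i : (i < 10)%N ->
  let t := nth (0, 0, 0)%N triples5 i in
  nth false (values (tri_code u w x)) i =
    parity (tri (triple_form t.1.1 t.1.2 t.2) u w x).
Proof.
pose g y z := tri (B y z) u w x.
have [a1 _ _] := wB.
have anti y z : g z y = - g y z by rewrite /g /tri !(a1 y z); ring.
have cut t : t \in triples5 ->
    tri (triple_form t.1.1 t.1.2 t.2) u w x = tri g (v t.1.1) (v t.1.2) (v t.2).
  move=> /triple5P[_ _ _ ut]; rewrite /tri /triple_form /form_of_cycle.
  by rewrite !cycle_sumE//= /dual_pairing /g /tri; ring.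
have coc i' j k : parity (tri g (v i') (v j) (v k)) = parity (tri g (v 0) (v i') (v j)) (+)
    parity (tri g (v 0) (v i') (v k)) (+) parity (tri g (v 0) (v j) (v k)).
  rewrite -(parityN (tri g (v 0) (v i') (v k))) -!parityD; congr parity.
  by rewrite /tri (anti (v 0) (v j)) (anti (v 0) (v k)) (anti (v i') (v k)); ring.
have code : tri_code u w x = code_of (fun i j k => parity (tri g (v i) (v j) (v k))).
  by apply: eq_code => t /base_triples_sub tt; rewrite cut.
move=> i10 t; rewrite cut ?mem_nth// code /t.
by move: i i10 {t}; do 10?[case=> [_|]] => //=; rewrite ?coc.
Qed.

(** By [tri_linked], a triangle of [V] linking some cycle of [W] links a triangle of [W]; the codes
    of triangles therefore suffice. *)
Lemma linked_triple_codes i : (i < 10)%N ->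
  let t := nth (0, 0, 0)%N triples5 i in
  linked_triple B (v t.1.1) (v t.1.2) (v t.2) <->
  exists u w x, uniq [:: u; w; x] /\ nth false (values (tri_code u w x)) i.
Proof.
move=> i10 t; have tt : t \in triples5 by rewrite mem_nth.
have [_ _ _ ut] := triple5P tt; have wt := weak_triple_form tt.
split=> [/(linked_tripleP _ ut)[d ud [sd h]]|[u [w [x [uu]]]]].
  have [u [w [x [uu h']]]] := tri_linked wt ud h.
  exists u, w, x; split; rewrite // tri_code_values// parity_small//.
  exact: tri_le1.
rewrite tri_code_values// -/t parity_small; last exact: tri_le1.
by move=> h; apply/(linked_tripleP _ ut); exists [:: u; w; x]; rewrite // cycle_sum3.
Qed.

Lemma linked_triple_rot x y z : linked_triple B x y z -> linked_triple B y z x.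
Proof. by move=> [d [ud sd t]]; exists d; rewrite tri_rot. Qed.

Lemma linked_triple_swap x y z : linked_triple B x y z -> linked_triple B y x z.
Proof.
move=> [d [ud sd t]]; exists d; split=> //.
by rewrite (tri_swap (weak_form_of_cycle wB ud sd)) oppr_eq0.
Qed.

Lemma linked_triple_perm x y z x' y' z' : perm_eq [:: x; y; z] [:: x'; y'; z'] ->
  linked_triple B x y z -> linked_triple B x' y' z'.
Proof. exact: perm_triple_ind linked_triple_rot linked_triple_swap _ _ _ _ _ _. Qed.

Lemma triples5_cover x y z : uniq [:: x; y; z] -> exists2 i, (i < 10)%N &
  let t := nth (0, 0, 0)%N triples5 i in perm_eq [:: x; y; z] [:: v t.1.1; v t.1.2; v t.2].
Proof.
have [i i5 ->] := v_surj x; have [j j5 ->] := v_surj y; have [k k5 ->] := v_surj z.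
move=> u; have {u} : uniq [:: i; j; k] by apply: (@map_uniq _ _ v).
move=> uu; suff [t /(nthP (0, 0, 0)%N)[n n10 e] e'] :
    exists2 t, t \in triples5 & perm_eq [:: i; j; k] [:: t.1.1; t.1.2; t.2].
  by exists n => //; rewrite -e in e'; exact: (perm_map v e').
have : all (fun i => all (fun j => all (fun k => uniq [:: i; j; k] ==>
  has (fun t => perm_eq [:: i; j; k] [:: t.1.1; t.1.2; t.2]) triples5)
  (iota 0 5)) (iota 0 5)) (iota 0 5) by vm_compute.
move=> /allP/(_ i); rewrite mem_iota i5 => /(_ isT)/allP/(_ j).
rewrite mem_iota j5 => /(_ isT)/allP/(_ k); rewrite mem_iota k5 => /(_ isT).
by rewrite uu => /hasP[t tt e]; exists t.
Qed.

End FivePoints.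

Lemma addcC c d : addc c d = addc d c.
Proof. by elim: c d => [|a c IHc] [|b d] //=; rewrite addbC IHc. Qed.

Lemma addcA c d e : addc c (addc d e) = addc (addc c d) e.
Proof. by elim: c d e => [|a c IHc] [|b d] [|x e] //=; rewrite addbA IHc. Qed.

Lemma addcAC c d e : addc (addc c d) e = addc (addc c e) d.
Proof. by rewrite -addcA (addcC d) addcA. Qed.

(** * Families of codes that suffice for the conclusion *)

Section FivePointConclusions.
Variables (V W : finType) (B : V -> V -> W -> W -> int).
Hypothesis wB : weak_pairing B.
Variable v : nat -> V.
Hypothesis v_inj : forall i j, (i < 5)%N -> (j < 5)%N -> v i = v j -> i = j.
Hypothesis v_surj : forall x, exists2 i, (i < 5)%N & x = v i.
Local Notation tcode := (tri_code B v).
Local Notation lk := (linked_triple B).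

Lemma in_tripleE i t : (i < 5)%N -> t \in triples5 ->
  (v i \in [:: v t.1.1; v t.1.2; v t.2]) = in_triple i t.
Proof.
move=> i5 /(triple5P v_inj)[t1 t2 t3 _]; rewrite !inE /in_triple.
have veq j : (j < 5)%N -> (v i == v j) = (i == j).
  by move=> j5; apply/eqP/eqP => [|->//]; exact: v_inj.
by rewrite !veq.
Qed.

(** [A] need not contain all codes of triangles of [W], only cover the same triples. *)
Lemma structured_of_codes (A : bitseq -> Prop) :
    (exists2 p, (p < 5)%N & forall c, A c -> code_through p c) \/
    (exists2 s, s \in triples5 & forall i, (i < 10)%N ->
      let t := nth (0, 0, 0)%N triples5 i in triple_meet t s != 3 ->
      ((exists2 c, A c & nth false (values c) i) <-> triple_meet t s == 2)) ->
    (forall c, A c -> c \in star_codes) ->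
    (forall i, (i < 10)%N ->
      (exists2 c, A c & nth false (values c) i) <->
      exists u w x, uniq [:: u; w; x] /\ nth false (values (tcode u w x)) i) ->
  common_point lk \/ special_triple lk.
Proof.
move=> structA As hA.
have lkA i : (i < 10)%N -> let t := nth (0, 0, 0)%N triples5 i in
    lk (v t.1.1) (v t.1.2) (v t.2) <-> exists2 c, A c & nth false (values c) i.
  move=> i10 t; split=> [/(linked_triple_codes wB v_inj i10)/(hA i i10)//|].
  by move/(hA i i10)/(linked_triple_codes wB v_inj i10).
have vsize c : c \in star_codes -> size (values c) = 10%N.
  move=> cs; apply/eqP; have /allP : all (fun c => size (values c) == 10%N) star_codes.
    by vm_compute.
  by apply.
case: structA => [[p p5 pA]|[s ss sA]]; [left|right].
  exists (v p) => x y z u l; have [i i10 e] := triples5_cover v_surj u.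
  have /(lkA i i10)[c cA ci] := linked_triple_perm wB e l.
  have /allP/(_ (true, nth (0, 0, 0)%N triples5 i)) := pA c cA.
  rewrite (perm_mem e) in_tripleE ?mem_nth//= => -> //.
  rewrite -ci -nth_zip ?vsize ?As//.
  by rewrite mem_nth// size_zip vsize ?As.
have [s1 s2 s3 us] := triple5P v_inj ss.
exists (v s.1.1), (v s.1.2), (v s.2); split=> // x y z u.
have [i i10 e] := triples5_cover v_surj u.
have tt : nth (0, 0, 0)%N triples5 i \in triples5 by rewrite mem_nth.
have [t1 t2 t3 ut] := triple5P v_inj tt.
have -> : count (mem [:: v s.1.1; v s.1.2; v s.2]) [:: x; y; z] =
    triple_meet (nth (0, 0, 0)%N triples5 i) s.
  by rewrite (permP e) /= !in_tripleE// addn0 addnA.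
move=> m3; have [h1 h2] := sA i i10 m3; split=> [l|/h2/(lkA i i10)].
  by apply/h1/(lkA i i10); exact: (linked_triple_perm wB e l).
by apply: linked_triple_perm; rewrite // perm_sym.
Qed.

(** Two triangles on the edge [u w] add up to the quadrilateral [u x w y]. *)
Lemma share_star u w x y : uniq [:: u; w; x; y] ->
  addc (tcode u w x) (tcode u w y) \in star_codes.
Proof.
move=> uu; rewrite -(tri_code_swapr wB v_inj u w x) (cycle_code4 wB v_inj); last by distinct.
by apply: cycle_code_star => //; distinct.
Qed.

Lemma addcc_star u w x : addc (tcode u w x) (tcode u w x) \in star_codes.
Proof. by rewrite /tri_code /= !addbb. Qed.

(** The faces of a tetrahedron share edges pairwise, so that [clique_structured] applies to their
    codes. *)
Lemma structured_four a b c d : uniq [:: a; b; c; d] ->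
    (forall u w x i, uniq [:: u; w; x] -> (i < 10)%N ->
       nth false (values (tcode u w x)) i ->
       tcode u w x \in [:: tcode a b c; tcode a b d; tcode a c d; tcode b c d]) ->
  common_point lk \/ special_triple lk.
Proof.
move=> uu four; pose l := [:: tcode a b c; tcode a b d; tcode a c d; tcode b c d].
have in_l e : e \in l -> [|| e == tcode a b c, e == tcode a b d, e == tcode a c d
    | e == tcode b c d] by rewrite !inE.
have sl e : e \in l -> e \in star_codes.
  by move=> /in_l/or4P[]/eqP->; apply: (tri_code_star wB v_inj v_surj); distinct.
have swp := tri_code_swap wB v_inj; have swpr := tri_code_swapr wB v_inj.
apply: (@structured_of_codes (fun e => e \in l)) => //.
  apply: clique_structured => // e f.
  have s1 : addc (tcode a b c) (tcode a b d) \in star_codes by exact: share_star.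
  have s2 : addc (tcode a b c) (tcode a c d) \in star_codes.
    by rewrite -(swpr a b c); apply: share_star; distinct.
  have s3 : addc (tcode a b c) (tcode b c d) \in star_codes.
    by rewrite -(swp a b c) -(swpr b a c); apply: share_star; distinct.
  have s4 : addc (tcode a b d) (tcode a c d) \in star_codes.
    by rewrite -(swpr a b d) -(swpr a c d); apply: share_star; distinct.
  have s5 : addc (tcode a b d) (tcode b c d) \in star_codes.
    by rewrite -(swp a b d) -(swpr b a d) -(swpr b c d); apply: share_star; distinct.
  have s6 : addc (tcode a c d) (tcode b c d) \in star_codes.
    rewrite -(swp a c d) -(swpr c a d) -(swp b c d) -(swpr c b d).
    by apply: share_star; distinct.
  by move=> /in_l/or4P[]/eqP-> /in_l/or4P[]/eqP->; rewrite ?addcc_star// addcC.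
move=> i i10; split=> [[e]|[u [w [x [uuwx h]]]]]; last first.
  by exists (tcode u w x) => //; apply: four uuwx i10 h.
move=> /in_l/or4P[]/eqP-> h.
- by exists a, b, c; split=> //; distinct.
- by exists a, b, d; split=> //; distinct.
- by exists a, c, d; split=> //; distinct.
- by exists b, c, d; split=> //; distinct.
Qed.

(** The triangles on a fixed edge [q j] have pairwise compatible codes. They cover the same triples
    as all the others, because [j y z] is unlinked and [q y z] is thus modulo 2 the sum of [q j y]
    and [q j z]. *)
Lemma structured_hub q : (forall u w x i, uniq [:: u; w; x] -> (i < 10)%N ->
       nth false (values (tcode u w x)) i -> q \in [:: u; w; x]) ->
  common_point lk \/ special_triple lk.
Proof.
move=> hub; have swp := tri_code_swap wB v_inj; have swpr := tri_code_swapr wB v_inj.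
have front u w x : uniq [:: u; w; x] -> q \in [:: u; w; x] ->
    exists y z, uniq [:: q; y; z] /\ tcode u w x = tcode q y z.
  move=> uu; rewrite !inE => /or3P[]/eqP e; subst q.
  - by exists w, x.
  - by exists u, x; split; [distinct|rewrite swp].
  - by exists u, w; split; [distinct|rewrite -(swpr u w x) -(swp u x w)].
have [[j jq]|none] := pselect (exists j, j != q); last first.
  left; exists (v 0) => x y z u [[|a [|b d]] [ud sd _]] //; exfalso; apply: none.
  have [e|ne] := eqVneq a q; last by exists a.
  by exists b; move: ud; rewrite /= inE negb_or e eq_sym => /andP[/andP[]].
pose A c := exists2 k, uniq [:: q; j; k] & c = tcode q j k.
have As c : A c -> c \in star_codes.
  by move=> [k uk ->]; exact: (tri_code_star wB v_inj v_surj).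
apply: (@structured_of_codes A) => //.
  apply: clique_structured => // _ _ [k uk ->] [l ul ->].
  have [->|kl] := eqVneq k l; first exact: addcc_star.
  by apply: share_star; distinct.
move=> i i10; split=> [[c [k uk ->] h]|[u [w [x [uu h]]]]]; first by exists q, j, k.
have [y [z [uq e]]] := front _ _ _ uu (hub _ _ _ _ uu i10 h).
rewrite e in h.
have [ey|yj] := eqVneq y j; first by exists (tcode q y z); rewrite // ey; exists z; rewrite -?ey.
have [ez|zj] := eqVneq z j.
  by exists (tcode q y z); rewrite // ez swpr; exists y; rewrite // -ez; distinct.
have ujyz : uniq [:: j; y; z] by distinct.
move: h; rewrite (tri_code_values wB v_inj)//.
set t := nth _ _ i => h.
have tt : t \in triples5 by rewrite mem_nth.
have wt := weak_triple_form wB v_inj tt.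
have : parity (tri (triple_form B v t.1.1 t.1.2 t.2) j y z) = false.
  rewrite -(tri_code_values wB v_inj)//; apply/negP => /(hub _ _ _ _ ujyz i10).
  by apply/negP; distinct.
move: h; rewrite (tri_cocycle wt j q y z) 2!parityD => + e0; rewrite e0 addbF.
have [h _|_ /= h] := boolP (parity (tri (triple_form B v t.1.1 t.1.2 t.2) j q y)).
  exists (tcode q j y); first by exists y => //; distinct.
  by rewrite -swp (tri_code_values wB v_inj).
exists (tcode q j z); first by exists z => //; distinct.
rewrite -swp (tri_code_values wB v_inj)// -/t.
by rewrite (tri_swapr wt j q z) parityN in h.
Qed.

End FivePointConclusions.

Lemma compatible_cons x s l : eval_dtree star_tree (addc s x) -> compatible x l ->
  compatible x (s :: l).
Proof. by rewrite /compatible => sx lx; apply/andP. Qed.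

(** [t i j] stands for the code of the triangle [0 i j]. The hypotheses run over the cycles on five
    points: triangles and quadrilaterals ([share]) through 0, those avoiding 0 ([triangle], [quad]),
    and pentagons ([path]). *)
Lemma search5_graph (t : nat -> nat -> bitseq) :
    (forall i j, t i j = t j i) ->
    (forall i j, uniq [:: 0; i; j] -> all (leq^~ 4) [:: i; j] -> t i j \in star_codes)%N ->
    (forall i j k, uniq [:: 0; i; j; k] -> all (leq^~ 4) [:: i; j; k] ->
       addc (t i j) (t i k) \in star_codes)%N ->
    (forall i j k, uniq [:: 0; i; j; k] -> all (leq^~ 4) [:: i; j; k] ->
       addc (addc (t i j) (t j k)) (t i k) \in star_codes)%N ->
    (forall i j k l, uniq [:: 0; i; j; k; l] -> all (leq^~ 4) [:: i; j; k; l] ->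
       addc (addc (t i j) (t j k)) (t k l) \in star_codes)%N ->
    (forall i j k l, uniq [:: 0; i; j; k; l] -> all (leq^~ 4) [:: i; j; k; l] ->
       addc (addc (addc (t i j) (t j k)) (t k l)) (t l i) \in star_codes)%N ->
    search5 (t 1 2)%N ->
  structured_codes [:: t 1 2; t 1 3; t 2 3; t 1 4; t 2 4; t 3 4;
    addc (addc (t 1 2) (t 1 3)) (t 2 3); addc (addc (t 1 2) (t 1 4)) (t 2 4);
    addc (t 1 3) (addc (t 1 4) (t 3 4)); addc (t 2 3) (addc (t 2 4) (t 3 4))]%N.
Proof.
move=> tC t_star share triangle path quad s12.
have sort : ((t 2 1 = t 1 2)%N * (t 3 1 = t 1 3)%N * (t 4 1 = t 1 4)%N *
    (t 3 2 = t 2 3)%N * (t 4 2 = t 2 4)%N * (t 4 3 = t 3 4)%N)%type.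
  by do ?split; exact: tC.
have perm3 x y z : addc (addc x y) z \in star_codes ->
  [/\ addc (addc x z) y \in star_codes, addc (addc y z) x \in star_codes,
      addc (addc y x) z \in star_codes, addc (addc z x) y \in star_codes &
      addc (addc z y) x \in star_codes].
  move=> h; rewrite (addcC z y) (addcC z x) (addcC y x) [addc (addc y z) x]addcAC.
  by rewrite (addcC y x) [addc (addc x z) y]addcAC.
apply: search5P => //; try by apply: t_star.
- by do !apply: compatible_cons => //; apply: eval_star_tree; exact: (share 1 2 3)%N.
- do !apply: compatible_cons => //; apply: eval_star_tree.
  + by have := triangle 1%N 2%N 3%N isT isT; rewrite ?sort => /perm3[].
  + by have := share 2%N 1%N 3%N isT isT; rewrite ?sort.
  + by have := share 3%N 1%N 2%N isT isT; rewrite ?sort.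
- do !apply: compatible_cons => //; apply: eval_star_tree.
  + exact: (share 1 2 4)%N.
  + exact: (share 1 3 4)%N.
  + by have := path 2%N 3%N 1%N 4%N isT isT; rewrite ?sort => /perm3[].
  + by have := path 3%N 2%N 1%N 4%N isT isT; rewrite ?sort => /perm3[].
- do !apply: compatible_cons => //; apply: eval_star_tree.
  + by have := triangle 1%N 2%N 4%N isT isT; rewrite ?sort => /perm3[].
  + by have := share 2%N 1%N 4%N isT isT; rewrite ?sort.
  + by have := share 4%N 1%N 2%N isT isT; rewrite ?sort.
  + by have := share 2%N 3%N 4%N isT isT; rewrite ?sort.
  + by have := quad 1%N 3%N 2%N 4%N isT isT; rewrite ?sort addcA addcAC.
  + by have := path 1%N 3%N 2%N 4%N isT isT; rewrite ?sort.
  + by have := path 1%N 4%N 2%N 3%N isT isT; rewrite ?sort => /perm3[].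
  + by have := path 3%N 1%N 4%N 2%N isT isT; rewrite ?sort.
  + by have := path 3%N 1%N 2%N 4%N isT isT; rewrite ?sort => /perm3[].
- do !apply: compatible_cons => //; apply: eval_star_tree.
  + by have := share 3%N 1%N 4%N isT isT; rewrite ?sort.
  + by have := share 4%N 1%N 3%N isT isT; rewrite ?sort.
  + by have := share 3%N 2%N 4%N isT isT; rewrite ?sort.
  + by have := share 4%N 2%N 3%N isT isT; rewrite ?sort.
  + by have := triangle 1%N 3%N 4%N isT isT; rewrite ?sort => /perm3[].
  + by have := triangle 2%N 3%N 4%N isT isT; rewrite ?sort => /perm3[].
  + by have := quad 1%N 2%N 3%N 4%N isT isT; rewrite ?sort addcA addcAC.
  + have := quad 3%N 1%N 2%N 4%N isT isT; rewrite ?sort.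
    by rewrite (addcC (t 1 3)%N).
  + by have := path 1%N 2%N 3%N 4%N isT isT; rewrite ?sort => h; first exact: h.
  + by have := path 1%N 2%N 4%N 3%N isT isT; rewrite ?sort.
  + by have := path 1%N 3%N 4%N 2%N isT isT; rewrite ?sort => /perm3[].
  + by have := path 2%N 3%N 4%N 1%N isT isT; rewrite ?sort => /perm3[].
  + by have := path 2%N 1%N 3%N 4%N isT isT; rewrite ?sort.
  + by have := path 2%N 1%N 4%N 3%N isT isT; rewrite ?sort.
Qed.
Lemma addcK c d : size c = size d -> addc (addc c d) d = c.
Proof.
elim: c d => [|a c IHc] [|b d] //= [e].
by rewrite IHc// -addbA addbb addbF.
Qed.

(** * Five points against five points *)

Section FiveByFive.
Variables (V W : finType) (B : V -> V -> W -> W -> int).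
Hypothesis wB : weak_pairing B.
Variable v : nat -> V.
Hypothesis v_inj : forall i j, (i < 5)%N -> (j < 5)%N -> v i = v j -> i = j.
Hypothesis v_surj : forall x, exists2 i, (i < 5)%N & x = v i.
Variable w : nat -> W.
Hypothesis w_inj : forall i j, (i < 5)%N -> (j < 5)%N -> w i = w j -> i = j.
Hypothesis w_surj : forall x, exists2 i, (i < 5)%N & x = w i.
Local Notation tcode := (tri_code B v).
Local Notation lk := (linked_triple B).

Lemma structured_five : search5 (tcode (w 0) (w 1) (w 2)) ->
  common_point lk \/ special_triple lk.
Proof.
move=> s12.
have swp := tri_code_swap wB v_inj; have swpr := tri_code_swapr wB v_inj.
pose t i j := tcode (w 0) (w i) (w j).
have uniq_w s : uniq s -> all (leq^~ 4)%N s -> uniq (map w s).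
  move=> us als; rewrite map_inj_in_uniq// => i j /(allP als) i4 /(allP als) j4.
  exact: w_inj.
have star_t u x y : uniq [:: u; x; y] -> tcode u x y \in star_codes.
  exact: (tri_code_star wB v_inj v_surj).
have cyc d := cycle_code_star wB v_inj v_surj (d := d).
have coc i j k : tcode (w i) (w j) (w k) = addc (addc (t i j) (t j k)) (t i k).
  exact: tri_code_cocycle.
have size_t i j k l : size (t i j) = size (t k l) by [].
pose l := [:: t 1 2; t 1 3; t 2 3; t 1 4; t 2 4; t 3 4;
    addc (addc (t 1 2) (t 1 3)) (t 2 3); addc (addc (t 1 2) (t 1 4)) (t 2 4);
    addc (t 1 3) (addc (t 1 4) (t 3 4)); addc (t 2 3) (addc (t 2 4) (t 3 4))]%N.
have st : structured_codes l.
  apply: search5_graph => // [i j|i j u al|i j k u al|i j k u al|i j k m u al|i j k m u al].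
  - exact: swpr.
  - by apply: star_t; exact: (uniq_w [:: 0; i; j]%N).
  - by apply: (share_star wB v_inj v_surj); exact: (uniq_w [:: 0; i; j; k]%N).
  - rewrite -coc; apply: star_t; apply: (uniq_w [:: i; j; k]) => //.
    by case/andP: u.
  - rewrite (cycle_code5 wB v_inj); last exact: (uniq_w [:: 0; i; j; k; m]%N).
    by apply: cyc => //; exact: (uniq_w [:: 0; i; j; k; m]%N).
  - have uw : uniq (map w [:: i; j; k; m]) by apply: uniq_w => //; case/andP: u.
    (* Coned from [w 0], the two halves of the quadrilateral both contain the diagonal, whose code
       cancels. *)
    have := cyc _ uw isT; rewrite -(cycle_code4 wB v_inj uw) !coc !addcA addcK//.
    by rewrite -[t m i]swpr.
have lE : l = [seq tcode (w e.1.1) (w e.1.2) (w e.2) | e <- [:: (0, 1, 2); (0, 1, 3);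
    (0, 2, 3); (0, 1, 4); (0, 2, 4); (0, 3, 4); (1, 2, 3); (1, 2, 4); (1, 3, 4);
    (2, 3, 4)]%N].
  rewrite /l [RHS]/map (coc 1 2 3)%N (coc 1 2 4)%N (coc 1 3 4)%N (coc 2 3 4)%N !addcA.
  by rewrite (addcAC (t 1 2)%N (t 2 3)%N) (addcAC (t 1 2)%N (t 2 4)%N)
    (addcAC (t 1 3)%N (t 3 4)%N) (addcAC (t 2 3)%N (t 3 4)%N).
have lP c : c \in l -> exists u x y, uniq [:: u; x; y] /\ c = tcode u x y.
  rewrite lE => /mapP[e ee ->]; exists (w e.1.1), (w e.1.2), (w e.2); split=> //.
  apply: (uniq_w [:: e.1.1; e.1.2; e.2]); move: e ee; apply/allP => //.
have ls c : c \in l -> c \in star_codes.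
  by move=> /lP[u [x [y [uu ->]]]]; exact: star_t.
apply: (@structured_of_codes _ _ _ wB v v_inj v_surj (fun c => c \in l)) => //.
  exact: structured_codesP.
move=> i i10; split=> [[c /lP[u [x [y [uu ->]]]] h]|[u [x [y [uu h]]]]].
  by exists u, x, y.
have [j j10 e] := triples5_cover w_surj uu.
exists (tcode u x y) => //.
have <- : tcode (w (nth (0, 0, 0)%N triples5 j).1.1)
    (w (nth (0, 0, 0)%N triples5 j).1.2) (w (nth (0, 0, 0)%N triples5 j).2) = tcode u x y.
  apply: (perm_triple_ind (P := fun a b c => tcode a b c = tcode u x y)) e _ => // a b c <-.
    by rewrite -(swp a b c) -(swpr b a c).
  exact: swp.
rewrite lE; apply/mapP; exists (nth (0, 0, 0)%N triples5 j) => //.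
by move: j j10 {e h}; do 10?[case=> [_|]].
Qed.

End FiveByFive.

(** * Labellings adapted to a star *)

Section Enumerations.
Variable T : finType.

Lemma enumeration x0 (s : seq T) : uniq s -> size s = #|T| ->
  (forall i j, (i < #|T|)%N -> (j < #|T|)%N -> nth x0 s i = nth x0 s j -> i = j) /\
  (forall x, exists2 i, (i < #|T|)%N & x = nth x0 s i).
Proof.
move=> us sT; split=> [i j iT jT /eqP|x].
  by rewrite nth_uniq ?sT// => /eqP.
have [y _||_ sE] := @uniq_min_size _ s (enum T) us.
- by rewrite mem_enum.
- by rewrite -cardE sT.
have xs : x \in s by rewrite sE mem_enum.
by exists (index x s); rewrite -?sT ?index_mem ?nth_index.
Qed.

Lemma complete_enumeration (s : seq T) : uniq s ->
  exists r, uniq (s ++ r) /\ size (s ++ r) = #|T|.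
Proof.
move=> us; exists [seq x <- enum T | x \notin s].
have u : uniq (s ++ [seq x <- enum T | x \notin s]).
  rewrite cat_uniq us filter_uniq ?enum_uniq// andbT /=.
  by apply/hasPn => x; rewrite mem_filter => /andP[].
split=> //; rewrite -(card_uniqP u); apply: eq_card => x.
by rewrite inE mem_cat mem_filter mem_enum andbT /= orbN.
Qed.

(** The four points other than [p] are split 1 + 3, 2 + 2 or 3 + 1; exchanging the sides leaves the
    two initial codes of the search. *)
Lemma star_enumeration p (S : pred T) x y : #|T| = 5 -> x != p -> y != p -> S x != S y ->
  exists v : nat -> T,
    [/\ forall i j, (i < 5)%N -> (j < 5)%N -> v i = v j -> i = j,
        forall x, exists2 i, (i < 5)%N & x = v i,
        v 0 = p &
        [/\ S (v 1) != S (v 2), S (v 3) = S (v 2) & S (v 4) = S (v 2)]%N \/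
        [/\ S (v 1) != S (v 3), S (v 2) = S (v 1) & S (v 4) = S (v 3)]%N].
Proof.
move=> T5 xp yp Sxy.
have [r [ur sr]] := @complete_enumeration [:: p] isT.
have r4 : size r = 4 by rewrite T5 in sr; case: sr.
pose r1 := [seq z <- r | S z]; pose r2 := [seq z <- r | ~~ S z].
have e12 : perm_eq (r1 ++ r2) r by apply/permPl; exact: (perm_filterC S r).
have e21 : perm_eq (r2 ++ r1) r by rewrite perm_catC.
have all1 : all S r1 by apply/allP => z; rewrite mem_filter => /andP[].
have all2 : all (predC S) r2 by apply/allP => z; rewrite mem_filter => /andP[].
have inr z : z != p -> z \in r.
  move=> zp; have [_ /(_ z)[i iT e]] := enumeration p ur sr.
  have : z \in p :: r by rewrite e mem_nth// sr.
  by rewrite inE (negbTE zp).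
have have_true : r1 != [::].
  apply/eqP => e; have xr := inr _ xp; have yr := inr _ yp.
  have : ~~ has S r by rewrite has_filter -/r1 e.
  by move=> /hasPn h; move: Sxy; rewrite !(negbTE (h _ _)).
have have_false : r2 != [::].
  apply/eqP => e; have xr := inr _ xp; have yr := inr _ yp.
  have : ~~ has (predC S) r by rewrite has_filter -/r2 e.
  move=> /hasPn h; move: Sxy; have := h _ xr; have := h _ yr.
  by rewrite /= !negbK => -> ->.
have s12 : (size r1 + size r2)%N = 4%N by rewrite -size_cat (perm_size e12).
have build s : perm_eq s r ->
    [/\ forall i j, (i < 5)%N -> (j < 5)%N -> nth p (p :: s) i = nth p (p :: s) j -> i = j &
        forall x, exists2 i, (i < 5)%N & x = nth p (p :: s) i].
  move=> e; have us : uniq (p :: s) by rewrite -(perm_uniq (_ : perm_eq (p :: r) _))//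
    perm_cons perm_sym.
  have := @enumeration p (p :: s) us; rewrite T5; apply.
  by rewrite /= (perm_size e) r4.
have [b12i b12s] := build _ e12; have [b21i b21s] := build _ e21.
clearbody r1 r2; clear e12 e21 inr ur sr r4.
move: r1 r2 all1 all2 have_true have_false s12 b12i b12s b21i b21s => r1 r2.
case: r1 r2 => [|x1 [|x2 [|x3 [|x4 r1]]]] // [|y1 [|y2 [|y3 [|y4 r2]]]] //=;
  try by move=> _ _ _ _ e; exfalso; move: e; clear; lia.
- move=> /andP[s1 _] /and4P[t1 t2 t3 _] _ _ _ bi bs _ _.
  exists (nth p [:: p; x1; y1; y2; y3]); split=> //=; left.
  by rewrite /= s1 (negbTE t1) (negbTE t2) (negbTE t3).
- move=> /and3P[s1 s2 _] /and3P[t1 t2 _] _ _ _ bi bs _ _.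
  exists (nth p [:: p; x1; x2; y1; y2]); split=> //=; right.
  by rewrite /= s1 s2 (negbTE t1) (negbTE t2).
- move=> /and4P[s1 s2 s3 _] /andP[t1 _] _ _ _ _ _ bi bs.
  exists (nth p [:: p; y1; x1; x2; x3]); split=> //=; left.
  by rewrite /= s1 s2 s3 (negbTE t1).
Qed.

End Enumerations.

(** * Five vertices against four, five, or at least six *)

Section FivePointTheorem.
Variables (V W : finType) (B : V -> V -> W -> W -> int).
Hypothesis wB : weak_pairing B.
Hypothesis V5 : #|V| = 5.
Local Notation lk := (linked_triple B).

(** The labels are chosen to shorten the search: a linked triangle of [W] comes first, and [V] is
    numbered so that its code is one of the two in [search5T]. *)
Lemma five_by_five : #|W| = 5 -> common_point lk \/ special_triple lk.
Proof.
move=> W5.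
have [[x [y [z [u l]]]]|none] := pselect (exists x y z, uniq [:: x; y; z] /\ lk x y z);
  last first.
  have [v0 _] : exists v0 : V, v0 \in V by apply/card_gt0P; rewrite V5.
  by left; exists v0 => x y z u l; exfalso; apply: none; exists x, y, z.
have [d ud [sd h]] := (linked_tripleP B u).1 l.
have wxyz : weak_form (form_of_cycle (dual_pairing B) [:: x; y; z]).
  by apply: weak_form_of_cycle u isT; exact: weak_pairing_dual.
have [a [b [c [uabc t]]]] := tri_linked wxyz ud h.
have wabc := weak_form_of_cycle wB uabc isT.
have [p [S starS]] := star_form wabc x.
have : tri (form_of_cycle B [:: a; b; c]) x y z != 0.
  by rewrite -(cycle_sum3 _ u) cycle_sum_dual (cycle_sum3 _ uabc).
rewrite starS// => /(star_split u)[i [j [ip jp Sij]]].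
have [v [v_inj v_surj v0 vS]] := star_enumeration V5 ip jp Sij.
have [r [ur sr]] := complete_enumeration uabc.
have [w_inj w_surj] := enumeration a ur sr; rewrite W5 in w_inj w_surj.
have code : tri_code B v a b c = code_of (fun i j k => star p S (v i) (v j) (v k)).
  apply: eq_code => e /base_triples_sub ee; have [_ _ _ ue] := triple5P v_inj ee.
  rewrite parity_small; last exact/tri_le1/weak_triple_form.
  rewrite -(starS _ _ _ ue) -(cycle_sum3 (form_of_cycle B [:: a; b; c]) ue).
  by rewrite cycle_sum_dual (cycle_sum3 _ uabc).
have ne k : (0 < k < 5)%N -> (v k == p) = false.
  move=> /andP[k0 k5]; rewrite -v0; apply/negP => /eqP e.
  by rewrite (v_inj k 0 k5 isT e) in k0.
have codes : tri_code B v a b c = [:: true; true; true; false; false; false] \/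
    tri_code B v a b c = [:: false; true; true; true; true; false].
  rewrite code; case: vS => [[e1 e2 e3]|[e1 e2 e3]]; [left|right];
    by rewrite /code_of /= /star v0 eqxx !ne//= e3 e2 ?eqxx ?e1.
have [s1 s2] := andP search5T.
have s : search5 (tri_code B v a b c) by case: codes => ->.
exact: (structured_five wB v_inj v_surj w_inj w_surj s).
Qed.

Lemma five_by_four : #|W| = 4 -> common_point lk \/ special_triple lk.
Proof.
move=> W4.
have [v0 _] : exists v0 : V, v0 \in V by apply/card_gt0P; rewrite V5.
have [a _] : exists a : W, a \in W by apply/card_gt0P; rewrite W4.
have [v_inj v_surj] := enumeration v0 (enum_uniq V) (esym (cardE V)).
have [w_inj w_surj] := enumeration a (enum_uniq W) (esym (cardE W)).
rewrite V5 in v_inj v_surj; rewrite W4 in w_inj w_surj.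
set v := nth v0 _ in v_inj v_surj; set w := nth a _ in w_inj w_surj.
have swp := tri_code_swap wB v_inj; have swpr := tri_code_swapr wB v_inj.
apply: (@structured_four _ _ _ wB v v_inj v_surj (w 0) (w 1) (w 2) (w 3))%N.
  have : uniq (map w [:: 0; 1; 2; 3]%N) by rewrite map_inj_in_uniq// => i j;
    rewrite !inE => /or4P[]/eqP-> /or4P[]/eqP->; exact: w_inj.
  by [].
move=> x y z _ u _ _.
have [i i4 xE] := w_surj x; have [j j4 yE] := w_surj y; have [k k4 zE] := w_surj z.
subst x y z; have {}u : uniq [:: i; j; k] by apply: (@map_uniq _ _ w).
have : all (fun i => all (fun j => all (fun k => uniq [:: i; j; k] ==>
  has (fun t => perm_eq [:: t.1.1; t.1.2; t.2] [:: i; j; k])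
    [:: (0, 1, 2); (0, 1, 3); (0, 2, 3); (1, 2, 3)])
  (iota 0 4)) (iota 0 4)) (iota 0 4) by vm_compute.
move=> /allP/(_ i); rewrite mem_iota i4 => /(_ isT)/allP/(_ j).
rewrite mem_iota j4 => /(_ isT)/allP/(_ k); rewrite mem_iota k4 => /(_ isT).
rewrite u => /hasP[t tt /(perm_map w) e].
have {}e : perm_eq [:: w t.1.1; w t.1.2; w t.2] [:: w i; w j; w k] := e.
pose P x y z : Prop := tri_code B v x y z \in
    [:: tri_code B v (w 0) (w 1) (w 2); tri_code B v (w 0) (w 1) (w 3);
        tri_code B v (w 0) (w 2) (w 3); tri_code B v (w 1) (w 2) (w 3)]%N.
apply: (perm_triple_ind (P := P)) e _ => [x y z|x y z|]; rewrite /P.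
- by rewrite -(swp x y z) -(swpr y x z).
- by rewrite -(swp x y z).
- by move: tt; rewrite !inE => /or4P[]/eqP->; rewrite eqxx ?orbT.
Qed.

Lemma tri_code_linked v u w x i :
    (forall i j, (i < 5)%N -> (j < 5)%N -> v i = v j -> i = j) -> (i < 10)%N ->
    nth false (values (tri_code B v u w x)) i -> linked_triple (dual_pairing B) u w x.
Proof.
move=> v_inj i10; rewrite (tri_code_values wB v_inj)//.
have tt : nth (0, 0, 0)%N triples5 i \in triples5 by rewrite mem_nth.
have wt := weak_triple_form wB v_inj tt; have [_ _ _ ut] := triple5P v_inj tt.
rewrite parity_small; last exact: tri_le1.
by move=> h; exists [:: v (nth (0, 0, 0)%N triples5 i).1.1;
  v (nth (0, 0, 0)%N triples5 i).1.2; v (nth (0, 0, 0)%N triples5 i).2].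
Qed.

Lemma tri_code_unlinked v u w x :
    (forall i j, (i < 5)%N -> (j < 5)%N -> v i = v j -> i = j) -> uniq [:: u; w; x] ->
    ~ linked_triple (dual_pairing B) u w x -> tri_code B v u w x = nseq 6 false.
Proof.
move=> v_inj uu unl.
apply: (@eq_from_nth _ false) => // i i6.
rewrite (nth_nseq false) i6; apply/negP => h; apply: unl.
apply: (@tri_code_linked v u w x i v_inj); first exact: leq_trans i6 _.
rewrite /= in i6; move: h; rewrite /tri_code /code_of.
by move: i i6; do 6?[case=> [_|]].
Qed.

(** The result for six vertices applies with the roles of [V] and [W] exchanged. A common point of
    the linked triangles of [W] leads to [structured_hub]; a special triangle reduces [W] to a
    tetrahedron. *)
Lemma five_by_many : (6 <= #|W|)%N -> common_point lk \/ special_triple lk.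
Proof.
move=> W6.
have wB' := weak_pairing_dual wB.
have [v0 _] : exists v0 : V, v0 \in V by apply/card_gt0P; rewrite V5.
have [v_inj v_surj] := enumeration v0 (enum_uniq V) (esym (cardE V)).
rewrite V5 in v_inj v_surj.
set v := nth v0 _ in v_inj v_surj.
have swp := tri_code_swap wB v_inj; have swpr := tri_code_swapr wB v_inj.
have [[q hub]|no_common] := pselect (common_point (linked_triple (dual_pairing B))).
  apply: (@structured_hub _ _ _ wB v v_inj v_surj q) => u w x i uu i10 h.
  by apply: hub => //; exact: tri_code_linked i10 h.
have [a [b [c [uabc special]]]] := linked_triples_special
  (@linked_triple_rot _ _ _) (linked_triple_swap wB')
  (@linked_triple_pair _ _ _ wB') W6 no_common.
have [d dn] : exists d, d \notin [:: a; b; c].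
  apply/existsP; rewrite -negb_forall; apply/negP => /forallP all_in.
  have : (#|W| <= 3)%N.
    by rewrite cardT (@uniq_leq_size _ _ [:: a; b; c]) ?enum_uniq// => x _; exact: all_in.
  by rewrite leqNgt (leq_trans _ W6).
(* In the tetrahedron [d e f y] the faces [d e y] and [d f y] have a single vertex in the special
   triangle, hence are unlinked; the other two faces have equal codes. *)
have shift e f y : e \in [:: a; b; c] -> f \in [:: a; b; c] -> y \notin [:: a; b; c] ->
    uniq [:: e; f; y] -> tri_code B v e f y = tri_code B v e f d.
  move=> eT fT yT u; have [->//|yd] := eqVneq y d.
  have ed : e != d by apply: contraNneq dn => <-.
  have fd : f != d by apply: contraNneq dn => <-.
  have zero g : g \in [:: a; b; c] -> uniq [:: d; g; y] ->
      tri_code B v d g y = nseq 6 false.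
    move=> gT ug; apply: tri_code_unlinked => // /special.
    by rewrite /= (negbTE dn) gT (negbTE yT) => /(_ ug isT).
  rewrite (tri_code_cocycle wB v_inj d) !zero//; try by distinct.
  rewrite -(swp d e f) -(swpr e d f).
  by rewrite /tri_code /code_of /= !addbF.
apply: (@structured_four _ _ _ wB v v_inj v_surj a b c d); first by distinct.
move=> u w x i uu i10 /(tri_code_linked v_inj i10) l.
pose P x y z := tri_code B v x y z \in [:: tri_code B v a b c; tri_code B v a b d;
  tri_code B v a c d; tri_code B v b c d].
have Prot x' y' z' : P x' y' z' -> P y' z' x'.
  by rewrite /P -(swp x' y' z') -(swpr y' x' z').
have Pswap x' y' z' : P x' y' z' -> P y' x' z' by rewrite /P -(swp x' y' z').
have two e f y : e \in [:: a; b; c] -> f \in [:: a; b; c] -> y \notin [:: a; b; c] ->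
    uniq [:: e; f; y] -> P e f y.
  move=> eT fT yT uefy; rewrite /P (shift e f y)//.
  have ef : e != f by distinct.
  move: eT fT ef; rewrite !inE => /or3P[]/eqP-> /or3P[]/eqP-> ef;
    first [by rewrite eqxx in ef
      | by rewrite ?(swp a b d) ?(swp a c d) ?(swp b c d) ?eqxx ?orbT].
have [c3|c3] := eqVneq (count (mem [:: a; b; c]) [:: u; w; x]) 3.
  have sub : {subset [:: u; w; x] <= [:: a; b; c]} by apply/allP; rewrite all_count c3.
  have [_ sE] := uniq_min_size uu sub (leqnn _).
  apply: (perm_triple_ind (P := P) Prot Pswap (uniq_perm uabc uu _)).
    by move=> y; rewrite sE.
  by rewrite /P mem_head.
have := (special _ _ _ uu c3).1 l; rewrite -/(P u w x).
have [uT|uT] := boolP (u \in [:: a; b; c]); have [wT|wT] := boolP (w \in [:: a; b; c]);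
  have [xT|xT] := boolP (x \in [:: a; b; c]); rewrite /= ?uT ?wT ?xT
    ?(negbTE uT) ?(negbTE wT) ?(negbTE xT) //= => _.
- exact: two.
- by apply: (Prot); apply: two => //; distinct.
- by apply: (Prot); apply: (Prot); apply: two => //; distinct.
Qed.

End FivePointTheorem.

Theorem weak_pairing_structured (V W : finType) (B : V -> V -> W -> W -> int) :
    weak_pairing B -> (5 <= #|V|)%N -> (4 <= #|W|)%N ->
  common_point (linked_triple B) \/ special_triple (linked_triple B).
Proof.
move=> wB; rewrite leq_eqVlt => /predU1P[/esym V5|V6].
  rewrite leq_eqVlt => /predU1P[/esym W4|]; first exact: five_by_four.
  rewrite leq_eqVlt => /predU1P[/esym W5|W6]; first exact: five_by_five.
  exact: five_by_many.
move=> _; have [common|no_common] := pselect (common_point (linked_triple B)).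
  by left.
right; apply: linked_triples_special V6 no_common.
- exact: linked_triple_rot.
- exact: linked_triple_swap.
- exact: linked_triple_pair.
Qed.
(** * Spatial complete graphs *)

Lemma cycle_complete (X : sgraph) : (forall x y : X, adj x y = (x != y)) ->
  forall c : seq X, is_cycle c = (2 < size c)%N && uniq c.
Proof.
move=> adjX c; rewrite /is_cycle; case: ltnP => //= sc; case uc: (uniq c) => //=.
apply: (@cycle_from_next _ _ c uc) => x xc; rewrite adjX.
case: c sc uc xc => [|x0 p] // sc uc; rewrite next_nth => xc; rewrite xc.
have i_lt : (index x (x0 :: p) < size (x0 :: p))%N by rewrite index_mem.
rewrite -[x in x != _](nth_index x0 xc) -[nth x0 p _]/(nth x0 (x0 :: p) _.+1).
move: i_lt; rewrite leq_eqVlt => /predU1P[e|lt_i]; last first.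
  by rewrite nth_uniq// 1?ltnW// eqn_leq ltnn andbF.
rewrite e [X in _ != X]nth_default// -[X in _ != X]/(nth x0 (x0 :: p) 0).
rewrite nth_uniq//; last by rewrite -e.
by apply/eqP => i0; rewrite i0 in e; rewrite -e in sc.
Qed.

Lemma sum_next (T : finType) (M : nmodType) (f : T -> M) c : uniq c ->
  \sum_(x <- c) f (next c x) = \sum_(x <- c) f x.
Proof.
case: c => [|x c] uc; first by rewrite !big_nil.
rewrite -(big_map (next (x :: c)) xpredT) (map_next_cons uc).
by apply: perm_big; rewrite perm_rcons.
Qed.

(** * From real edge contributions to an integer pairing *)

Section Gauge.
Variables (R : realType) (X Y : sgraph).
Variable E : X -> X -> Y -> Y -> R.
Hypothesis anti : forall x y u v, adj x y -> adj u v ->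
  E y x u v = - E x y u v /\ E x y v u = - E x y u v.
Hypothesis adjX : forall x y : X, adj x y = (x != y).
Hypothesis adjY : forall x y : Y, adj x y = (x != y).

Definition edge_sum (c : seq X) (d : seq Y) : R :=
  \sum_(x <- c) \sum_(u <- d) E x (next c x) u (next d u).

Hypothesis edge_sum_int : forall c d, is_cycle c -> is_cycle d ->
  edge_sum c d \is a Num.int.
Hypothesis edge_sum_le1 : forall c d, is_cycle c -> is_cycle d ->
  `|edge_sum c d| <= 1.

(** [E] is controlled on edges only. Vanishing on degenerate pairs makes antisymmetry hold
    everywhere, so that a base point may lie on the cycle itself. *)
Let F x y u v := if (x == y) || (u == v) then 0 else E x y u v.

Let antiF x y u v : F y x u v = - F x y u v /\ F x y v u = - F x y u v.
Proof.
rewrite /F (eq_sym y x) (eq_sym v u); case: ifP; first by rewrite oppr0.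
by move/norP=> [xy uv]; apply: anti; rewrite ?adjX ?adjY.
Qed.

Let wind x y z u v w := (F x y u v + F y z u v + F z x u v) +
  (F x y v w + F y z v w + F z x v w) + (F x y w u + F y z w u + F z x w u).

Let wind_int x y z u v w : wind x y z u v w \is a Num.int.
Proof.
have Fxx x' u' v' : F x' x' u' v' = 0 by rewrite /F eqxx.
have Fuu x' y' u' : F x' y' u' u' = 0 by rewrite /F eqxx orbT.
have [a1 a2] : (forall x y u v, F y x u v = - F x y u v) /\
    (forall x y u v, F x y v u = - F x y u v) by split=> *; apply antiF.
have int0 r : r = 0 :> R -> r \is a Num.int by move=> ->; exact: int_num0.
have [->|xy] := eqVneq x y.
  by apply: int0; rewrite /wind !Fxx !(a1 y z); ring.
have [->|yz] := eqVneq y z.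
  by apply: int0; rewrite /wind !Fxx !(a1 x z); ring.
have [->|xz] := eqVneq x z.
  by apply: int0; rewrite /wind !Fxx !(a1 y z); ring.
have [->|uv] := eqVneq u v.
  by apply: int0; rewrite /wind !Fuu !(a2 _ _ v w); ring.
have [->|vw] := eqVneq v w.
  by apply: int0; rewrite /wind !Fuu !(a2 _ _ u w); ring.
have [->|uw] := eqVneq u w.
  by apply: int0; rewrite /wind !Fuu !(a2 _ _ v w); ring.
have uX : uniq [:: x; y; z] by distinct.
have uY : uniq [:: u; v; w] by distinct.
have := @edge_sum_int [:: x; y; z] [:: u; v; w].
rewrite !cycle_complete// uX uY => /(_ isT isT); congr (_ \is a _).
have nX : [/\ next [:: x; y; z] x = y, next [:: x; y; z] y = z & next [:: x; y; z] z = x].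
  by rewrite /= !eqxx eq_sym (negbTE xy) eq_sym (negbTE xz) eq_sym (negbTE yz).
have nY : [/\ next [:: u; v; w] u = v, next [:: u; v; w] v = w & next [:: u; v; w] w = u].
  by rewrite /= !eqxx eq_sym (negbTE uv) eq_sym (negbTE uw) eq_sym (negbTE vw).
case: nX nY => [nx ny nz] [nu nv nw].
have FE x' y' u' v' : x' != y' -> u' != v' -> F x' y' u' v' = E x' y' u' v'.
  by move=> h h'; rewrite /F (negbTE h) (negbTE h').
rewrite /edge_sum !big_cons !big_nil nx ny nz nu nv nw /wind.
by rewrite !FE // 1?eq_sym //; ring.
Qed.

(* The windings of the pairs of triangles with fixed base points are integers,
   and differ from E by a coboundary in each of the two pairs of variables. *)
Lemma gauge : exists B : X -> X -> Y -> Y -> int, weak_pairing B /\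
  forall c d, uniq c -> uniq d -> (2 < size c)%N -> (2 < size d)%N ->
    (cycle_sum (form_of_cycle B d) c)%:~R = edge_sum c d.
Proof.
(* Without a base point there are no cycles, and the zero pairing will do. *)
have [[x0 _]|X0] := pselect (exists x0 : X, True); last first.
  exists (fun _ _ _ _ => 0); split.
    by split=> [*|*|[|x c]] //; rewrite ?oppr0//; case: X0; exists x.
  by move=> [|x c] //; case: X0; exists x.
have [[u0 _]|Y0] := pselect (exists u0 : Y, True); last first.
  exists (fun _ _ _ _ => 0); split.
    by split=> [*|*|c [|u d]] //; rewrite ?oppr0//; case: Y0; exists u.
  by move=> c [|u d] //; case: Y0; exists u.
pose B x y u v := Num.floor (wind x0 x y u0 u v).
have BE x y u v : (B x y u v)%:~R = wind x0 x y u0 u v by rewrite floorK ?wind_int.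
have [a1 a2] : (forall x y u v, F y x u v = - F x y u v) /\
    (forall x y u v, F x y v u = - F x y u v) by split=> *; apply antiF.
have sumB c d : uniq c -> uniq d -> (2 < size c)%N -> (2 < size d)%N ->
    (cycle_sum (form_of_cycle B d) c)%:~R = edge_sum c d.
  move=> uc ud sc sd.
  have neX x : x \in c -> x != next c x.
    by move=> xc; rewrite -adjX; apply: next_cycle xc; have := cycle_complete adjX c;
      rewrite /is_cycle sc uc /= => ->.
  have neY u : u \in d -> u != next d u.
    by move=> xd; rewrite -adjY; apply: next_cycle xd; have := cycle_complete adjY d;
      rewrite /is_cycle sd ud /= => ->.
  rewrite /cycle_sum /form_of_cycle rmorph_sum /=.
  transitivity (\sum_(x <- c) \sum_(u <- d) F x (next c x) u (next d u)); last first.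
    apply: eq_big_seq => x xc; apply: eq_big_seq => u ud'.
    by rewrite /F (negbTE (neX _ xc)) (negbTE (neY _ ud')).
  (* [K] is coned from [x0] in the first two variables only: the two coboundaries are removed one
     after the other, each telescoping along its cycle. *)
  pose K x y u v := F x0 x u v + F x y u v + F y x0 u v.
  transitivity (\sum_(x <- c) \sum_(u <- d) K x (next c x) u (next d u)).
    apply: eq_bigr => x _; rewrite /cycle_sum rmorph_sum /=.
    under eq_bigr do rewrite BE.
    transitivity (\sum_(u <- d) (K x (next c x) u (next d u)
        + (K x (next c x) u0 u - K x (next c x) u0 (next d u)))).
      apply: eq_bigr => u _; rewrite /wind /K (a2 _ _ u0) (a2 x _ u0) (a2 _ x0 u0).
      by ring.
    by rewrite big_split sumrB /= (sum_next (K x (next c x) u0) ud) subrr addr0.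
  rewrite exchange_big [RHS]exchange_big /=; apply: eq_bigr => u _.
  transitivity (\sum_(x <- c) (F x (next c x) u (next d u)
      + (F x0 x u (next d u) - F x0 (next c x) u (next d u)))).
    by apply: eq_bigr => x _; rewrite /K (a1 x0); ring.
  by rewrite big_split sumrB /= (sum_next (fun x => F x0 x u (next d u)) uc) subrr addr0.
exists B; split=> //; split=> [x y u v|x y u v|c d uc ud sc sd].
- apply/eqP; rewrite -(eqr_int R) mulrNz !BE /wind; apply/eqP.
  by rewrite !(a1 x0 x) !(a1 x0 y) !(a1 x y); ring.
- apply/eqP; rewrite -(eqr_int R) mulrNz !BE /wind; apply/eqP.
  by rewrite !(a2 _ _ u0 u) !(a2 _ _ u0 v) !(a2 _ _ u v); ring.
- rewrite -(ler_int R) intr_norm sumB//.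
  by apply: edge_sum_le1; rewrite cycle_complete// ?sc ?sd.
Qed.

End Gauge.

(** * Triangles as triples of vertices *)

Section Triangles.
Variable X : sgraph.
Hypothesis adjX : forall x y : X, adj x y = (x != y).

Lemma triangle_complete (T : seq X) : is_triangle T ->
  exists x y z, T = [:: x; y; z] /\ uniq [:: x; y; z].
Proof.
rewrite /is_triangle (cycle_complete adjX) => /andP[/andP[_ uT] /eqP sT].
by case: T uT sT => [|x [|y [|z []]]] // uT _; exists x, y, z.
Qed.

Lemma triangle3 (x y z : X) : is_triangle [:: x; y; z] = uniq [:: x; y; z].
Proof. by rewrite /is_triangle (cycle_complete adjX) andbT. Qed.

Lemma triangle_edgesP (x y z : X) (e : {set X}) : uniq [:: x; y; z] ->
  reflect (exists p q, [/\ p \in [:: x; y; z], q \in [:: x; y; z], p != q & e = [set p; q]%SET])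
    (e \in cycle_edges [:: x; y; z]).
Proof.
move=> u; have [xy xz yz] : [/\ x != y, x != z & y != z] by split; distinct.
have nx : next [:: x; y; z] x = y by rewrite /= eqxx.
have ny : next [:: x; y; z] y = z by rewrite /= eq_sym (negbTE xy) eqxx.
have nz : next [:: x; y; z] z = x.
  by rewrite /= eq_sym (negbTE xz) eq_sym (negbTE yz) eqxx.
apply: (iffP imsetP) => [[p pT ->]|[p [q [pT qT pq ->]]]].
  move: pT; rewrite !inE => /or3P[]/eqP->; rewrite ?nx ?ny ?nz.
  - by exists x, y; rewrite !inE !eqxx ?orbT.
  - by exists y, z; rewrite !inE !eqxx ?orbT.
  - by exists z, x; rewrite !inE !eqxx ?orbT [z == x]eq_sym.
have e1 : exists2 r, r \in [:: x; y; z] & [set x; y]%SET = [set r; next [:: x; y; z] r]%SET.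
  by exists x; rewrite ?nx// !inE eqxx.
have e2 : exists2 r, r \in [:: x; y; z] & [set y; z]%SET = [set r; next [:: x; y; z] r]%SET.
  by exists y; rewrite ?ny// !inE eqxx orbT.
have e3 : exists2 r, r \in [:: x; y; z] & [set x; z]%SET = [set r; next [:: x; y; z] r]%SET.
  by exists z; rewrite ?nz 1?finset.setUC// !inE eqxx !orbT.
move: pT qT pq; rewrite !inE => /or3P[]/eqP-> /or3P[]/eqP->; rewrite ?eqxx// => _ //.
all: by rewrite finset.setUC.
Qed.

Lemma share_edge_count (a b c x y z : X) : uniq [:: a; b; c] -> uniq [:: x; y; z] ->
  share_edge [:: x; y; z] [:: a; b; c] <-> (2 <= count (mem [:: a; b; c]) [:: x; y; z])%N.
Proof.
move=> uT0 uT; rewrite -size_filter; set s := [seq v <- _ | _].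
have us : uniq s by rewrite filter_uniq.
split=> [[e [/(triangle_edgesP _ uT)[p [q [pT qT pq ->]]]]]|s2].
  move=> /(triangle_edgesP _ uT0)[p' [q' [p'T0 q'T0 _ pq']]].
  have T0P v : v \in [set p; q]%SET -> v \in [:: a; b; c].
    by rewrite pq' => /set2P[]->.
  have upq : uniq [:: p; q] by rewrite /= inE pq.
  apply: (uniq_leq_size upq) => v vpq; rewrite mem_filter; apply/andP; split.
    by apply: T0P; move: vpq; rewrite !inE.
  by move: vpq; rewrite !inE => /orP[]/eqP->; [move: pT | move: qT]; rewrite !inE.
have sT v : v \in s -> v \in [:: a; b; c] /\ v \in [:: x; y; z].
  by rewrite mem_filter => /andP[].
case: s us s2 sT => [|p [|q s]] //= /andP[pq _] _ sT.
have {}pq : p != q by move: pq; rewrite inE negb_or => /andP[].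
have [pT0 pT] := sT p (mem_head _ _).
have [qT0 qT] : q \in [:: a; b; c] /\ q \in [:: x; y; z].
  by apply: sT; rewrite !inE eqxx orbT.
exists [set p; q]%SET; split; apply/triangle_edgesP => //.
  by exists p, q.
by exists p, q.
Qed.

Lemma triangle_edges_neq (a b c x y z : X) : uniq [:: a; b; c] -> uniq [:: x; y; z] ->
  (cycle_edges [:: x; y; z] != cycle_edges [:: a; b; c]) =
  (count (mem [:: a; b; c]) [:: x; y; z] != 3%N).
Proof.
move=> uT0 uT; congr negb; apply/eqP/eqP => [eT|cnt].
  apply/eqP; rewrite -[3%N]/(size [:: x; y; z]) -all_count; apply/allP => v vT.
  have [w wT vw] : exists2 w, w \in [:: x; y; z] & v != w.
    have [xv|xv] := eqVneq x v; last by exists x; rewrite ?inE ?eqxx// eq_sym.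
    by exists y; rewrite ?inE ?eqxx ?orbT// -xv; distinct.
  have : [set v; w]%SET \in cycle_edges [:: x; y; z].
    by apply/triangle_edgesP => //; exists v, w.
  rewrite eT => /(triangle_edgesP _ uT0)[p [q [pT0 qT0 _ vwpq]]].
  have : v \in [set v; w]%SET by rewrite !inE eqxx.
  by rewrite vwpq => /set2P[]->.
have sub : {subset [:: x; y; z] <= [:: a; b; c]}.
  by apply/allP; rewrite all_count; apply/eqP.
have [_ eqT] := uniq_min_size uT sub (leqnn 3).
apply/setP => e; apply/(triangle_edgesP _ uT)/(triangle_edgesP _ uT0).
  by move=> [p [q [pT qT pq ->]]]; exists p, q; split=> //; apply: sub.
by move=> [p [q [pT qT pq ->]]]; exists p, q; split=> //; rewrite eqT.
Qed.

End Triangles.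

Lemma iso_complete (X : sgraph) n : graph_iso X (complete_graph n) ->
  (forall x y : X, adj x y = (x != y)) /\ #|X| = n.
Proof.
move=> [f f_bij f_adj]; split=> [x y|]; last by rewrite (bij_eq_card f_bij) card_ord.
by rewrite -f_adj /= (inj_eq (bij_inj f_bij)).
Qed.

Lemma int_norm_lt2 (R : realType) (r : R) : r \is a Num.int -> ~ 2 <= `|r| -> `|r| <= 1.
Proof.
by move=> /intrP[k ->] /negP; rewrite -intr_norm -ltNge (ltr_int _ _ 2) (ler_int _ _ 1) ltzD1.
Qed.

(** * Incompatibility of the two conclusions *)

Section Exclusion.
Variables (R : realType) (G H : spatial_graph R).
Hypothesis adjG : forall x y : G, adj x y = (x != y).
Hypothesis G5 : (5 <= #|G|)%N.

(** Five vertices leave two points [d], [e] outside the special triangle [a b c]. The triangles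
    [a b d], [b c e] and [a c d] share edges with it, hence link [H], but have no vertex in
    common. *)
Lemma common_vertex_special_triangle : ~ (common_vertex G H /\ special_triangle G H).
Proof.
move=> [[p common] [T0 /(triangle_complete adjG)[a [b [c [-> uT0]]]] special]].
have /card_gt1P[d [e [dT0 eT0 de]]] : (1 < #|[predC (mem [:: a; b; c])]|)%N.
  have cardT : (3 + #|[predC (mem [:: a; b; c])]| = #|G|)%N.
    by rewrite -(card_uniqP uT0 : _ = 3%N) cardC.
  by rewrite -(ltn_add2l 3) cardT.
have {}dT0 : d \notin [:: a; b; c] by [].
have {}eT0 : e \notin [:: a; b; c] by [].
have through x y z : uniq [:: x; y; z] -> count (mem [:: a; b; c]) [:: x; y; z] = 2%N ->
    p \in [:: x; y; z].
  move=> u cnt; apply: common; rewrite ?triangle3//.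
  apply/special; rewrite ?triangle3// ?triangle_edges_neq ?cnt//.
  by apply/share_edge_count => //; rewrite cnt.
have in3 : [/\ a \in [:: a; b; c], b \in [:: a; b; c] & c \in [:: a; b; c]].
  by rewrite !inE !eqxx !orbT.
have [aT bT cT] := in3.
have abd : p \in [:: a; b; d].
  by apply: through; [distinct | rewrite /= aT bT (negbTE dT0)].
have bce : p \in [:: b; c; e].
  by apply: through; [distinct | rewrite /= cT bT (negbTE eT0)].
have acd : p \in [:: a; c; d].
  by apply: through; [distinct | rewrite /= aT cT (negbTE dT0)].
have [pE|pE|pE] : [\/ p = a, p = b | p = d].
  by move: abd; rewrite !inE => /or3P[]/eqP; [constructor 1|constructor 2|constructor 3].
- by move: bce; apply/negP; rewrite pE; distinct.
- by move: acd; apply/negP; rewrite pE; distinct.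
- by move: bce; apply/negP; rewrite pE; distinct.
Qed.

End Exclusion.

Theorem theorem1p3 (R : realType) (m n : nat) (hm : (5 <= m)%N) (hn : (4 <= n)%N)
    (G H : spatial_graph R)
    (hG : graph_iso G (complete_graph m)) (hH : graph_iso H (complete_graph n))
    (hdisj : disjointly_embedded G H) (hweak : weakly_linked G H) :
  (common_vertex G H \/ special_triangle G H) /\
  ~ (common_vertex G H /\ special_triangle G H).
Proof.
have [adjG cardG] := iso_complete hG; have [adjH cardH] := iso_complete hH.
split; last by apply: common_vertex_special_triangle; rewrite ?cardG.
have [E [anti LkE]] := linking_form hdisj.
have E_int c d : is_cycle c -> is_cycle d -> edge_sum E c d \is a Num.int.
  by move=> cc cd; rewrite /edge_sum; have [<-] := LkE c d cc cd.
have E_le1 c d : is_cycle c -> is_cycle d -> `|edge_sum E c d| <= 1.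
  move=> cc cd; apply: int_norm_lt2 (E_int _ _ cc cd) _.
  by have [] := LkE c d cc cd; rewrite /edge_sum => <- _; exact: hweak.2.
have [B [wB BE]] := gauge anti adjG adjH E_int E_le1.
have linkP x y z : uniq [:: x; y; z] ->
    links_graph H [:: x; y; z] <-> linked_triple B x y z.
  move=> u; have cT : is_cycle [:: x; y; z] by rewrite (cycle_complete adjG).
  split=> [[d cd]|[d [ud sd]]].
    have [] := LkE _ _ cT cd; rewrite /linked -/(edge_sum E _ _) => -> _.
    move: (cd); rewrite (cycle_complete adjH) => /andP[sd ud].
    by rewrite -BE// intr_eq0 cycle_sum3//; exists d.
  have cd : is_cycle d by rewrite (cycle_complete adjH) sd.
  exists d => //; have [] := LkE _ _ cT cd; rewrite /linked -/(edge_sum E _ _) => -> _.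
  by rewrite -BE// intr_eq0 cycle_sum3.
have [] := weak_pairing_structured wB; rewrite ?cardG ?cardH//.
  move=> [p common]; left; exists p => T /(triangle_complete adjG)[x [y [z [-> u]]]].
  by move=> /(linkP _ _ _ u); exact: common.
move=> [a [b [c [u0 special]]]]; right; exists [:: a; b; c]; first by rewrite triangle3.
move=> T /(triangle_complete adjG)[x [y [z [-> u]]]]; rewrite triangle_edges_neq// => ne3.
apply: (iff_trans (linkP _ _ _ u)); apply: (iff_trans (special _ _ _ u ne3)).
apply: (iff_trans _ (iff_sym (share_edge_count u0 u))).
by have := count_size (mem [:: a; b; c]) [:: x; y; z]; rewrite /= in ne3 *; split; lia.
Qed.
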